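(* Let $\mathscr M$ be a $\mathscr F_q^0(AK)_{\mathrm{ext}}$-module which is non-degenerate as a left $\mathscr F_{q,c}^0(AK)$-module, i.e. $\mathscr F_{q,c}^0(AK)\mathscr M=\mathscr M$, and let $$\mathcal V_0:\mathscr F_{q,c}^0(AK)\otimes\mathscr M\to\mathscr F_{q,c}^+(AK)\otimes\mathscr M,\quad x\otimes v\mapsto x_{(-1)}\otimes x_{(0)}v,$$ where $\gamma(x)=x_{(-1)}\otimes x_{(0)}$. Then for all $X\in U_q^0(\mathfrak b_{\mathbb R})$ one has $$\Sigma\mathcal V_0(1\otimes\pi(X))=(\pi\otimes\pi_\rhd)(\alpha(X))\Sigma\mathcal V_0,$$ where $\Sigma$ is the flip map.
   Context: LIE DATA. $\mathfrak g$ complex semisimple Lie algebra with Cartan subalgebra $\mathfrak h$, simple roots $\alpha_r$ ($r\in I$), positive roots $\Delta^+$, $\rho=\frac12\sum_{\alpha\in\Delta^+}\alpha$, weight lattice $P$, dominant weights $P^+$, fundamental weights $\varpi_r$, simple reflections $s_r$, longest Weyl group element $w_0=s_{r_1}\cdots s_{r_M}$ (fixed reduced expression); $(\cdot,\cdot)$ is the multiple of the Killing-induced form on $\mathfrak h^*$ with shortest roots of length $\sqrt2$; $\check\alpha=2\alpha/(\alpha,\alpha)$. $0<q<1$, $q_r=q^{(\alpha_r,\alpha_r)/2}$, $[n]_q=(q^{-n}-q^n)/(q^{-1}-q)$. $U_q(\mathfrak g)$: generators $K_\omega$ ($\omega\in P$), $E_r,F_r$; relations $K_0=1$, $K_\omega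 K_\chi=K_{\omega+\chi}$, $K_\omega E_r=q^{(\omega,\alpha_r)}E_rK_\omega$, $K_\omega F_r=q^{-(\omega,\alpha_r)}F_rK_\omega$, quantum Serre relations, $E_rF_s-F_sE_r=\delta_{rs}(K_{\alpha_r}-K_{\alpha_r}^{-1})/(q_r-q_r^{-1})$; coproduct $\hat\Delta(K_\omega)=K_\omega\otimes K_\omega$, $\hat\Delta(E_r)=E_r\otimes K_{\alpha_r}+1\otimes E_r$, $\hat\Delta(F_r)=F_r\otimes1+K_{\alpha_r}^{-1}\otimes F_r$; antipode $\hat S$. $U_q(\mathfrak k)$: same with $K_\omega^*=K_\omega$, $E_r^*=F_rK_{\alpha_r}$. $U_q(\mathfrak b)$ (resp. $U_q(\mathfrak b^-)$): Hopf subalgebra generated by $K_\omega,E_r$ (resp. $K_\omega,F_r$); in $U_q(\mathfrak b^-)$ write $L_\omega$ for $K_\omega$. $U_q^+(\mathfrak b_{\mathbb R})$: Hopf $*$-algebra generated by copies of the Hopf algebras $U_q(\mathfrak b)$, $U_q(\mathfrak b^-)$ with $K_\omega^*=L_\omega$, $E_r^*=F_rL_{\alpha_r}$, $K_\omega L_\chi=L_\chi K_\omega$, $K_\omega F_r=q^{-(\omega,\alpha_r)}F_rK_\omega$, $L_\omega E_r=q^{(\omega,\alpha_r)}E_rL_\omega$, $E_rF_s-F_sE_r=\delta_{rs}(K_{\alpha_r}-L_{\alpha_r}^{-1})/(q_r-q_r^{-1})$. $U_q^0(\mathfrak b_{\mathbb R})$: $*$-algebra generated by copies of the algebras $U_q(\mathfrak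 b)$, $U_q(\mathfrak b^-)$ with $K_\omega^*=L_\omega$, $E_r^*=F_rL_{\alpha_r}$, $K_\omega L_\chi=q^{-2(\omega,\chi)}L_\chi K_\omega$, $L_\omega E_r=q^{(\omega,\alpha_r)}E_rL_\omega$, $K_\omega F_r=q^{(\omega,\alpha_r)}F_rK_\omega$, $E_rF_s-F_sE_r=-\delta_{rs}L_{\alpha_r}^{-1}/(q_r-q_r^{-1})$; its right coaction $\alpha:U_q^0(\mathfrak b_{\mathbb R})\to U_q^0(\mathfrak b_{\mathbb R})\otimes U_q^+(\mathfrak b_{\mathbb R})$ is the algebra homomorphism restricting to $\hat\Delta$ on $U_q(\mathfrak b)$ and $U_q(\mathfrak b^-)$. $\mathrm{Pol}_q(K)$: for $\varpi\in P^+$, $V_\varpi$ is the irreducible Hilbert space $*$-representation of $U_q(\mathfrak k)$ with unit highest weight vector $\xi_\varpi$ of weight $\varpi$; $K_\omega\xi=q^{(\omega,\mathrm{wt}(\xi))}\xi$. $\mathrm{Pol}_q(K)$ is spanned by $U_\varpi(\xi,\eta)(x)=\langle\xi,x\eta\rangle$ (linear in the second variable), Hopf $*$-algebra dual to $U_q(\mathfrak k)$ with $\Delta(U_\varpi(\xi,\eta))=\sum_iU_\varpi(\xi,e_i)\otimes U_\varpi(e_i,\eta)$, $U_\varpi(\xi,\eta)^*(x)=\langle\eta,\hat S(x)\xi\rangle$, $\mathrm{lwt}(U_\varpi(\xi,\eta))=\mathrm{wt}(\xi)$, $\mathrm{rwt}(U_\varpi(\xi,\eta))=\mathrm{wt}(\eta)$.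 Lusztig operators: $T_r\xi=\sum_{-a+b-c=(\mathrm{wt}(\xi),\check\alpha_r)}\frac{(-1)^bq_r^{b-ac}}{[a]_{q_r}![b]_{q_r}![c]_{q_r}!}E_r^aF_r^bE_r^c\xi$, $T_{w_0}=T_{r_1}\cdots T_{r_M}$, $\eta_{w_0\varpi}=q^{-(\rho,\varpi)}T_{w_0}\xi_\varpi$ (unit lowest weight vector), $b_\varpi=U_\varpi(\xi_\varpi,\eta_{w_0\varpi})$. $\mathrm{Pol}_q(K)_{\mathrm{ext}}$ is the $*$-algebra generated by $\mathrm{Pol}_q(K)$, central $u_\omega$ ($\omega\in P$) with $u_\omega^*=u_{-\omega}$, $u_0=1$, $u_\omega u_\chi=u_{\omega+\chi}$, and self-adjoint $|b|_\omega$ with $|b|_0=1$, $|b|_\omega|b|_\chi=|b|_{\omega+\chi}$, $|b|_\omega x=q^{(\omega,\mathrm{lwt}(x)-w_0\mathrm{rwt}(x))}x|b|_\omega$ for $x\in\mathrm{Pol}_q(K)$, and $b_\varpi=u_\varpi|b|_\varpi$ for $\varpi\in P^+$. Gradings extend by $\mathrm{lwt}(|b|_\omega)=\mathrm{rwt}(|b|_\omega)=0$, $\mathrm{lwt}(u_\omega)=\omega$, $\mathrm{rwt}(u_\omega)=w_0\omega$. AMPLIFICATIONS. $\mathrm{Fun}(P,\mathbb C)$: functions on $P$; $\mathrm{Fun}_c$: finite support; $f_\omega(\chi)=f(\chi-\omega)$. $\mathscr F_q^+(AK)$, $\mathscr F_q^0(AK)$, $\mathscr F_q^0(AK)_{\mathrm{ext}}$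 are the $*$-algebras generated by $\mathrm{Fun}(P,\mathbb C)$ and $\mathrm{Pol}_q(K)$, $\mathrm{Pol}_q(K)$, $\mathrm{Pol}_q(K)_{\mathrm{ext}}$ with relations $fx=xf_{\mathrm{lwt}(x)-\mathrm{rwt}(x)}$, $fx=xf_{\mathrm{lwt}(x)}$, $fx=xf_{\mathrm{lwt}(x)}$ respectively; $\mathscr F^\epsilon_{q,c}(AK)$ ($\epsilon\in\{+,0\}$) is the span of $xf$, $x\in\mathrm{Pol}_q(K)$, $f\in\mathrm{Fun}_c(P,\mathbb C)$. With $\Delta(f)(\omega,\chi)=f(\omega+\chi)$, $xf\mapsto\Delta(x)\Delta(f)$ defines the comultiplication $\Delta$ on $\mathscr F^+_{q,c}(AK)$ and the left coaction $\gamma:\mathscr F^0_{q,c}(AK)\to M(\mathscr F^+_{q,c}(AK)\otimes\mathscr F^0_{q,c}(AK))$ ($M(\cdot)$: multiplier algebra), for which $\gamma(x)(1\otimes y)\in\mathscr F^+_{q,c}(AK)\otimes\mathscr F^0_{q,c}(AK)$; this and non-degeneracy of $\mathscr M$ make $\mathcal V_0$ well-defined. THE MAP $\pi$. Put $z_\omega(\chi)=q^{(\omega,\chi)}$, $k_\omega=q^{-\frac12(\omega,\omega)}z_\omega u_{-\omega}$, $l_\omega=q^{-\frac12(\omega,\omega)}u_\omega z_\omega$, $e_r=(1-q_r^2)^{-1}b_{\varpi_r}^{-1}(b_{\varpi_r}\lhd E_r)$, where $U_\varpi(\xi,\eta)\lhd X=U_\varpi(X^*\xi,\eta)$, and $f_r=e_r^*l_{\alpha_r}^{-1}$.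 Then $\pi:U_q^0(\mathfrak b_{\mathbb R})\to\mathscr F_q^0(AK)_{\mathrm{ext}}$ is the $*$-homomorphism $K_\omega\mapsto k_\omega$, $L_\omega\mapsto l_\omega$, $E_r\mapsto e_r$, $F_r\mapsto f_r$. TRANSLATION ACTION. Let $\pi_{\mathfrak k}:U_q^+(\mathfrak b_{\mathbb R})\to U_q(\mathfrak k)$, $E_r,F_r,K_\omega,L_\omega\mapsto E_r,F_r,K_\omega,K_\omega$, and $\pi_{\mathfrak a}:U_q^+(\mathfrak b_{\mathbb R})\to\mathbb C[P]$ (group algebra with generators $U_\omega$), $E_r,F_r\mapsto0$, $K_\omega\mapsto U_\omega$, $L_\omega\mapsto U_{-\omega}$. $X\in U_q^+(\mathfrak b_{\mathbb R})$ is viewed as the functional $(X,xf)=(\pi_{\mathfrak k}(X_{(1)}),x)(\pi_{\mathfrak a}(X_{(2)}),f)$, $(U_\omega,f)=f(\omega)$, on $\mathscr F_q^+(AK)$, and $\pi_\rhd(X)x=(\mathrm{id}\otimes X)\Delta(x)$ for $x\in\mathscr F^+_{q,c}(AK)$; explicitly, if $\pi_{\mathfrak k}(X_{(1)})\otimes\pi_{\mathfrak a}(X_{(2)})=\sum_iY_i\otimes U_{\omega_i}$, then $\pi_\rhd(X)(xf)=\sum_ix_{(1)}(Y_i,x_{(2)})f_{-\omega_i}$. *)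

(* Defs.v *)
From HB Require Import structures.
From mathcomp Require Import all_boot all_order all_algebra.
From mathcomp Require Import boolp reals exp complex generic_quotient.

Set Implicit Arguments.
Unset Strict Implicit.
Unset Printing Implicit Defensive.

Import Order.TTheory GRing.Theory Num.Theory.
Local Open Scope ring_scope.
Local Open Scope quotient_scope.

(* [GRing.Algebra] requires [1 != 0], which an algebra given by a presentation
   does not have for free, and a join of [pzRingType] and [lmodType] cannot be
   added to the hierarchy afterwards; hence this structure of unital associative
   algebra on [lmodType], with its own product and unit. *)
HB.mixin Record isUnitalAlg (C : comNzRingType) A of GRing.Lmodule C A := {
  aone : A;
  amul : A -> A -> A;
  amulA : forall x y z : A, amul x (amul y z) = amul (amul x y) z;
  amul1l : forall x : A, amul aone x = x;
  amul1r : forall x : A, amul x aone = x;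
  amulDl : forall x y z : A, amul (x + y) z = amul x z + amul y z;
  amulDr : forall x y z : A, amul x (y + z) = amul x y + amul x z;
  amulZl : forall (c : C) (x y : A), amul (c *: x) y = c *: amul x y;
  amulZr : forall (c : C) (x y : A), amul x (c *: y) = c *: amul x y }.

#[short(type="ualgType")]
HB.structure Definition UnitalAlg (C : comNzRingType) :=
  {A of isUnitalAlg C A & GRing.Lmodule C A}.

Notation "x ** y" := (amul x y) (at level 40, left associativity) : ring_scope.
Notation "\1" := aone : ring_scope.

Definition apow (C : comNzRingType) (A : ualgType C) (x : A) (n : nat) : A :=
  iter n (amul x) \1.

HB.mixin Record hasStar (C : numClosedFieldType) A of UnitalAlg C A := {
  star : A -> A;
  starD : forall x y : A, star (x + y) = star x + star y;
  starZ : forall (c : C) (x : A), star (c *: x) = c^* *: star x;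
  starM : forall x y : A, star (x ** y) = star y ** star x;
  starK : forall x : A, star (star x) = x }.

#[short(type="staralgType")]
HB.structure Definition StarAlg (C : numClosedFieldType) :=
  {A of hasStar C A & UnitalAlg C A}.

Section Homs.
Variable C : numClosedFieldType.

Definition is_linear (V W : lmodType C) (f : V -> W) : Prop :=
  forall (c : C) x y, f (c *: x + y) = c *: f x + f y.

Record is_alg_hom (A B : ualgType C) (f : A -> B) : Prop := {
  ah_linear : is_linear f;
  ah_one : f \1 = \1;
  ah_mul : forall x y, f (x ** y) = f x ** f y }.

Record is_star_hom (A B : staralgType C) (f : A -> B) : Prop := {
  sh_hom : is_alg_hom f;
  sh_star : forall x, f (star x) = star (f x) }.

Record is_module (A : ualgType C) (M : lmodType C) (act : A -> M -> M) : Prop := {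
  mod_linl : forall v, is_linear (act^~ v);
  mod_linr : forall a, is_linear (act a);
  mod_one : forall v, act \1 v = v;
  mod_mul : forall a b v, act (a ** b) v = act a (act b v) }.

End Homs.

Inductive sterm (C G : Type) : Type :=
| SGen of G
| SZero
| SOne
| SAdd of sterm C G & sterm C G
| SOpp of sterm C G
| SScale of C & sterm C G
| SMul of sterm C G & sterm C G
| SStar of sterm C G.
Arguments SZero {C G}.
Arguments SOne {C G}.

HB.instance Definition _ (C G : Type) := gen_eqMixin (sterm C G).
HB.instance Definition _ (C G : Type) := gen_choiceMixin (sterm C G).

Section Presented.
Variable C : numClosedFieldType.

Fixpoint seval (G : Type) (B : staralgType C) (g : G -> B) (t : sterm C G) : B :=
  match t with
  | SGen x => g x
  | SZero => 0
  | SOne => \1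
  | SAdd a b => seval g a + seval g b
  | SOpp a => - seval g a
  | SScale c a => c *: seval g a
  | SMul a b => seval g a ** seval g b
  | SStar a => star (seval g a)
  end.

Fixpoint starfree (G : Type) (t : sterm C G) : bool :=
  match t with
  | SAdd a b | SMul a b => starfree a && starfree b
  | SOpp a | SScale _ a => starfree a
  | SStar _ => false
  | _ => true
  end.

(* [y] satisfies all the polynomial relations satisfied by [x]: the assignment
   [x i |-> y i] extends to an algebra homomorphism on the subalgebra of [A]
   generated by the [x i] (which need not be stable under [star]). *)
Definition copies (X : Type) (A B : staralgType C) (x : X -> A) (y : X -> B) :=
  forall t t' : sterm C X, starfree t -> starfree t' ->
    seval x t = seval x t' -> seval y t = seval y t'.

(* A system of relations is given by what it means for generators [g] of an
   arbitrary *-algebra [B] to satisfy it.  Two expressions in the generators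
   are identified when the relations force them to be equal. *)
Variables (G : Type) (rel : forall B : staralgType C, (G -> B) -> Prop).

Definition forced_eq (t t' : sterm C G) : bool :=
  `[< forall (B : staralgType C) (g : G -> B), rel g -> seval g t = seval g t' >].

Lemma forced_eq_refl : reflexive forced_eq.
Proof. by move=> t; apply/asboolP. Qed.
Lemma forced_eq_sym : symmetric forced_eq.
Proof. by move=> t t'; apply/asboolP/asboolP => h B g r; rewrite (h B g r). Qed.
Lemma forced_eq_trans : transitive forced_eq.
Proof.
move=> t2 t1 t3 /asboolP h12 /asboolP h23; apply/asboolP => B g r.
by rewrite (h12 B g r) (h23 B g r).
Qed.
Canonical forced_equiv :=
  EquivRel forced_eq forced_eq_refl forced_eq_sym forced_eq_trans.

Definition presented := {eq_quot forced_equiv}.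
HB.instance Definition _ := Choice.on presented.

Definition pres (t : sterm C G) : presented := \pi_presented t.
Definition pgen (x : G) : presented := pres (SGen C x).

(* [plift g] is meaningful only when [g] satisfies the relations. *)
Definition plift (B : staralgType C) (g : G -> B) (x : presented) : B :=
  seval g (repr x).

Lemma plift_pres (B : staralgType C) (g : G -> B) t :
  rel g -> plift g (pres t) = seval g t.
Proof.
move=> r; rewrite /plift /pres; case: piP => t' /eqmodP /asboolP h.
by rewrite (h B g r).
Qed.

Lemma pres_ext (x y : presented) :
  (forall (B : staralgType C) (g : G -> B), rel g -> plift g x = plift g y) ->
  x = y.
Proof.
move=> h; rewrite -[x]reprK -[y]reprK; apply/eqmodP/asboolP => B g r.
exact: h.
Qed.

Definition p_zero := pres SZero.
Definition p_one := pres SOne.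
Definition p_add (x y : presented) := pres (SAdd (repr x) (repr y)).
Definition p_opp (x : presented) := pres (SOpp (repr x)).
Definition p_scale (c : C) (x : presented) := pres (SScale c (repr x)).
Definition p_mul (x y : presented) := pres (SMul (repr x) (repr y)).
Definition p_star (x : presented) := pres (SStar (repr x)).

Lemma plift_zero (B : staralgType C) (g : G -> B) : rel g -> plift g p_zero = 0.
Proof. exact: plift_pres. Qed.
Lemma plift_one (B : staralgType C) (g : G -> B) : rel g -> plift g p_one = \1.
Proof. exact: plift_pres. Qed.
Lemma plift_add (B : staralgType C) (g : G -> B) x y :
  rel g -> plift g (p_add x y) = plift g x + plift g y.
Proof. exact: plift_pres. Qed.
Lemma plift_opp (B : staralgType C) (g : G -> B) x :
  rel g -> plift g (p_opp x) = - plift g x.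
Proof. exact: plift_pres. Qed.
Lemma plift_scale (B : staralgType C) (g : G -> B) c x :
  rel g -> plift g (p_scale c x) = c *: plift g x.
Proof. exact: plift_pres. Qed.
Lemma plift_mul (B : staralgType C) (g : G -> B) x y :
  rel g -> plift g (p_mul x y) = plift g x ** plift g y.
Proof. exact: plift_pres. Qed.
Lemma plift_star (B : staralgType C) (g : G -> B) x :
  rel g -> plift g (p_star x) = star (plift g x).
Proof. exact: plift_pres. Qed.
Let pE := (plift_zero, plift_one, plift_add, plift_opp, plift_scale, plift_mul,
  plift_star).

Lemma p_addA : associative p_add.
Proof. by move=> x y z; apply: pres_ext => B g r; rewrite !pE // addrA. Qed.
Lemma p_addC : commutative p_add.
Proof. by move=> x y; apply: pres_ext => B g r; rewrite !pE // addrC. Qed.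
Lemma p_add0 : left_id p_zero p_add.
Proof. by move=> x; apply: pres_ext => B g r; rewrite !pE // add0r. Qed.
Lemma p_addN : left_inverse p_zero p_opp p_add.
Proof. by move=> x; apply: pres_ext => B g r; rewrite !pE // addNr. Qed.

HB.instance Definition _ :=
  GRing.isZmodule.Build presented p_addA p_addC p_add0 p_addN.

Lemma p_scaleA a b v : p_scale a (p_scale b v) = p_scale (a * b) v.
Proof. by apply: pres_ext => B g r; rewrite !pE // scalerA. Qed.
Lemma p_scale1 : left_id 1 p_scale.
Proof. by move=> x; apply: pres_ext => B g r; rewrite !pE // scale1r. Qed.
Lemma p_scaleDr : right_distributive p_scale p_add.
Proof. by move=> c x y; apply: pres_ext => B g r; rewrite !pE // scalerDr. Qed.
Lemma p_scaleDl v a b : p_scale (a + b) v = p_add (p_scale a v) (p_scale b v).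
Proof. by apply: pres_ext => B g r; rewrite !pE // scalerDl. Qed.

HB.instance Definition _ := GRing.Zmodule_isLmodule.Build C presented
  p_scaleA p_scale1 p_scaleDr p_scaleDl.

Lemma p_mulA x y z : p_mul x (p_mul y z) = p_mul (p_mul x y) z.
Proof. by apply: pres_ext => B g r; rewrite !pE // amulA. Qed.
Lemma p_mul1l x : p_mul p_one x = x.
Proof. by apply: pres_ext => B g r; rewrite !pE // amul1l. Qed.
Lemma p_mul1r x : p_mul x p_one = x.
Proof. by apply: pres_ext => B g r; rewrite !pE // amul1r. Qed.
Lemma p_mulDl x y z : p_mul (p_add x y) z = p_add (p_mul x z) (p_mul y z).
Proof. by apply: pres_ext => B g r; rewrite !pE // amulDl. Qed.
Lemma p_mulDr x y z : p_mul x (p_add y z) = p_add (p_mul x y) (p_mul x z).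
Proof. by apply: pres_ext => B g r; rewrite !pE // amulDr. Qed.
Lemma p_mulZl c x y : p_mul (p_scale c x) y = p_scale c (p_mul x y).
Proof. by apply: pres_ext => B g r; rewrite !pE // amulZl. Qed.
Lemma p_mulZr c x y : p_mul x (p_scale c y) = p_scale c (p_mul x y).
Proof. by apply: pres_ext => B g r; rewrite !pE // amulZr. Qed.

HB.instance Definition _ := isUnitalAlg.Build C presented
  p_mulA p_mul1l p_mul1r p_mulDl p_mulDr p_mulZl p_mulZr.

Lemma p_starD x y : p_star (p_add x y) = p_add (p_star x) (p_star y).
Proof. by apply: pres_ext => B g r; rewrite !pE // starD. Qed.
Lemma p_starZ c x : p_star (p_scale c x) = p_scale c^* (p_star x).
Proof. by apply: pres_ext => B g r; rewrite !pE // starZ. Qed.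
Lemma p_starM x y : p_star (p_mul x y) = p_mul (p_star y) (p_star x).
Proof. by apply: pres_ext => B g r; rewrite !pE // starM. Qed.
Lemma p_starK x : p_star (p_star x) = x.
Proof. by apply: pres_ext => B g r; rewrite !pE // starK. Qed.

HB.instance Definition _ :=
  hasStar.Build C presented p_starD p_starZ p_starM p_starK.

Lemma plift_hom (B : staralgType C) (g : G -> B) :
  rel g -> is_star_hom (plift g).
Proof.
move=> r; split; first split.
- by move=> c x y; rewrite !pE.
- by rewrite !pE.
- by move=> x y; rewrite !pE.
- by move=> x; rewrite !pE.
Qed.

Lemma plift_gen (B : staralgType C) (g : G -> B) x :
  rel g -> plift g (pgen x) = g x.
Proof. by move=> r; rewrite plift_pres. Qed.

End Presented.

Section Bilin.
Variable C : numClosedFieldType.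

Definition bilin (V W U : lmodType C) (f : V -> W -> U) : Prop :=
  (forall w, is_linear (f^~ w)) /\ (forall v, is_linear (f v)).

Definition fsum (V W : Type) (U : nmodType) (f : V -> W -> U)
    (s : seq (V * W)) : U :=
  \sum_(p <- s) f p.1 p.2.

End Bilin.

Section Tensor.
Variable C : numClosedFieldType.
Variables V W : lmodType C.

(* The formal sum [s] stands for the sum of the [p.1 (x) p.2], [p] in [s]; two
   formal sums define the same tensor iff no bilinear map separates them. *)
Definition tens_eq (s t : seq (V * W)) : bool :=
  `[< forall (U : lmodType C) (f : V -> W -> U), bilin f ->
        fsum f s = fsum f t >].

Lemma tens_eq_refl : reflexive tens_eq.
Proof. by move=> t; apply/asboolP. Qed.
Lemma tens_eq_sym : symmetric tens_eq.
Proof. by move=> t t'; apply/asboolP/asboolP => h U f r; rewrite (h U f r). Qed.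
Lemma tens_eq_trans : transitive tens_eq.
Proof.
move=> t2 t1 t3 /asboolP h12 /asboolP h23; apply/asboolP => U f r.
by rewrite (h12 U f r) (h23 U f r).
Qed.
Canonical tens_equiv :=
  EquivRel tens_eq tens_eq_refl tens_eq_sym tens_eq_trans.

Definition tens := {eq_quot tens_equiv}.
HB.instance Definition _ := Choice.on tens.

Definition tsum (s : seq (V * W)) : tens := \pi_tens s.
Definition pure (v : V) (w : W) : tens := tsum [:: (v, w)].

(* The linear map [tens -> U] with [pure v w |-> f v w]; it is meaningful only
   when [f] is bilinear. *)
Definition tlift (U : nmodType) (f : V -> W -> U) (t : tens) : U :=
  fsum f (repr t).

Lemma tlift_tsum (U : lmodType C) (f : V -> W -> U) s :
  bilin f -> tlift f (tsum s) = fsum f s.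
Proof.
move=> r; rewrite /tlift /tsum; case: piP => t /eqmodP /asboolP h.
by rewrite (h U f r).
Qed.

Lemma tens_ext (x y : tens) :
  (forall (U : lmodType C) (f : V -> W -> U), bilin f -> tlift f x = tlift f y) ->
  x = y.
Proof.
move=> h; rewrite -[x]reprK -[y]reprK; apply/eqmodP/asboolP => U f r.
exact: h.
Qed.

Definition t_zero : tens := tsum [::].
Definition t_add (x y : tens) : tens := tsum (repr x ++ repr y).
Definition t_scale (c : C) (x : tens) : tens :=
  tsum [seq (c *: p.1, p.2) | p <- repr x].
Definition t_opp (x : tens) : tens := t_scale (-1) x.

Lemma tlift_zero (U : lmodType C) (f : V -> W -> U) :
  bilin f -> tlift f t_zero = 0.
Proof. by move=> r; rewrite tlift_tsum // /fsum big_nil. Qed.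
Lemma tlift_add (U : lmodType C) (f : V -> W -> U) x y :
  bilin f -> tlift f (t_add x y) = tlift f x + tlift f y.
Proof. by move=> r; rewrite tlift_tsum // /fsum big_cat. Qed.
Lemma bilinZl (U : lmodType C) (f : V -> W -> U) c v w :
  bilin f -> f (c *: v) w = c *: f v w.
Proof.
case=> h _; have h0 : f 0 w = 0.
  by have := h w (-1) 0 0; rewrite scaler0 addr0 scaleN1r addNr.
by have := h w c v 0; rewrite h0 !addr0.
Qed.
Lemma tlift_scale (U : lmodType C) (f : V -> W -> U) c x :
  bilin f -> tlift f (t_scale c x) = c *: tlift f x.
Proof.
move=> r; rewrite tlift_tsum // /fsum big_map /tlift /fsum scaler_sumr.
by apply: eq_bigr => p _; rewrite /= bilinZl.
Qed.
Lemma tlift_opp (U : lmodType C) (f : V -> W -> U) x :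
  bilin f -> tlift f (t_opp x) = - tlift f x.
Proof. by move=> r; rewrite tlift_scale // scaleN1r. Qed.
Let tE := (tlift_zero, tlift_add, tlift_opp, tlift_scale).

Lemma t_addA : associative t_add.
Proof. by move=> x y z; apply: tens_ext => U f r; rewrite !tE // addrA. Qed.
Lemma t_addC : commutative t_add.
Proof. by move=> x y; apply: tens_ext => U f r; rewrite !tE // addrC. Qed.
Lemma t_add0 : left_id t_zero t_add.
Proof. by move=> x; apply: tens_ext => U f r; rewrite !tE // add0r. Qed.
Lemma t_addN : left_inverse t_zero t_opp t_add.
Proof. by move=> x; apply: tens_ext => U f r; rewrite !tE // addNr. Qed.

HB.instance Definition _ :=
  GRing.isZmodule.Build tens t_addA t_addC t_add0 t_addN.

Lemma t_scaleA a b v : t_scale a (t_scale b v) = t_scale (a * b) v.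
Proof. by apply: tens_ext => U f r; rewrite !tE // scalerA. Qed.
Lemma t_scale1 : left_id 1 t_scale.
Proof. by move=> x; apply: tens_ext => U f r; rewrite !tE // scale1r. Qed.
Lemma t_scaleDr : right_distributive t_scale t_add.
Proof. by move=> c x y; apply: tens_ext => U f r; rewrite !tE // scalerDr. Qed.
Lemma t_scaleDl v a b : t_scale (a + b) v = t_add (t_scale a v) (t_scale b v).
Proof. by apply: tens_ext => U f r; rewrite !tE // scalerDl. Qed.

HB.instance Definition _ := GRing.Zmodule_isLmodule.Build C tens
  t_scaleA t_scale1 t_scaleDr t_scaleDl.

Lemma tlift_linear (U : lmodType C) (f : V -> W -> U) :
  bilin f -> is_linear (tlift f).
Proof. by move=> r c x y; rewrite !tE. Qed.

Lemma tlift_pure (U : lmodType C) (f : V -> W -> U) v w :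
  bilin f -> tlift f (pure v w) = f v w.
Proof. by move=> r; rewrite tlift_tsum // /fsum big_seq1. Qed.

Lemma bilin_pure : bilin pure.
Proof.
split=> [w c x y | v c x y]; apply: tens_ext => U f r; rewrite !tE //.
  by rewrite !tlift_pure //; case: r => h _; apply: h.
by rewrite !tlift_pure //; case: r => _ h; apply: h.
Qed.

Lemma tlift_sum (U : lmodType C) (f : V -> W -> U) (I : Type) (s : seq I)
    (F : I -> tens) :
  bilin f -> tlift f (\sum_(i <- s) F i) = \sum_(i <- s) tlift f (F i).
Proof.
move=> r; elim: s => [|i s IH]; first by rewrite !big_nil tlift_zero.
by rewrite !big_cons -IH tlift_add.
Qed.

Lemma tens_repr (t : tens) : t = \sum_(p <- repr t) pure p.1 p.2.
Proof.
apply: tens_ext => U f r; rewrite tlift_sum // /tlift.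
by apply: eq_bigr => p _; rewrite -/(tlift f _) tlift_pure.
Qed.

Lemma tens_lin_ext (U : lmodType C) (f g : tens -> U) :
  is_linear f -> is_linear g -> (forall v w, f (pure v w) = g (pure v w)) ->
  f =1 g.
Proof.
move=> lf lg e t.
have l0 (h : tens -> U) : is_linear h -> h 0 = 0.
  by move=> lh; have := lh (-1) 0 0; rewrite scaler0 addr0 scaleN1r addNr.
rewrite [t]tens_repr; elim: (repr t : seq _) => [|p s IH].
  by rewrite big_nil !l0.
rewrite big_cons -[pure _ _]scale1r lf lg IH e //.
Qed.

End Tensor.

Section TensorMaps.
Variable C : numClosedFieldType.

Definition tmap (V W V' W' : lmodType C) (f : V -> V') (g : W -> W') :
    tens V W -> tens V' W' :=
  tlift (fun v w => pure (f v) (g w)).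

Definition tflip (V W : lmodType C) : tens V W -> tens W V :=
  tlift (fun v w => pure w v).

Lemma bilin_tmap (V W V' W' : lmodType C) (f : V -> V') (g : W -> W') :
  is_linear f -> is_linear g -> bilin (fun v w => pure (f v) (g w)).
Proof.
move=> lf lg; have [h1 h2] := bilin_pure V' W'.
by split=> [w c x y|v c x y]; rewrite ?lf ?lg; [apply: h1 | apply: h2].
Qed.

End TensorMaps.

Section TensorAlg.
Variable C : numClosedFieldType.
Variables A B : ualgType C.
Notation T := (tens A B).

Definition t_one : T := pure \1 \1.
Definition t_mul (x y : T) : T :=
  tlift (fun a b => tlift (fun a' b' => pure (a ** a') (b ** b')) y) x.

Lemma bilin_mul_in a b :
  bilin (fun a' b' => pure (a ** a') (b ** b') : T).
Proof.
by apply: bilin_tmap => c x y; rewrite amulDr amulZr.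
Qed.

Lemma bilin_mul_out (y : T) :
  bilin (fun a b => tlift (fun a' b' => pure (a ** a') (b ** b') : T) y).
Proof.
have [h1 h2] := bilin_pure A B.
split=> [b c x z|a c x z]; rewrite /tlift /fsum scaler_sumr -big_split /=;
  apply: eq_bigr => p _; rewrite amulDl amulZl.
  exact: h1.
exact: h2.
Qed.

Lemma t_mul_linl y : is_linear (t_mul^~ y).
Proof. exact/tlift_linear/bilin_mul_out. Qed.

Lemma t_mul_linr x : is_linear (t_mul x).
Proof.
move=> c y z; rewrite /t_mul /tlift /fsum scaler_sumr -big_split /=.
apply: eq_bigr => p _; exact: (tlift_linear (bilin_mul_in _ _)).
Qed.

Lemma t_mul_pure a b a' b' :
  t_mul (pure a b) (pure a' b') = pure (a ** a') (b ** b').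
Proof.
rewrite /t_mul tlift_pure; last exact: bilin_mul_out.
by rewrite tlift_pure //; apply: bilin_mul_in.
Qed.

Lemma t_mulDl x y z : t_mul (x + y) z = t_mul x z + t_mul y z.
Proof. by have := t_mul_linl z 1 x y; rewrite !scale1r. Qed.
Lemma t_mulDr x y z : t_mul x (y + z) = t_mul x y + t_mul x z.
Proof. by have := t_mul_linr x 1 y z; rewrite !scale1r. Qed.
Lemma t_mul0l y : t_mul 0 y = 0.
Proof. by apply: (@addrI _ (t_mul 0 y)); rewrite -t_mulDl !addr0. Qed.
Lemma t_mul0r x : t_mul x 0 = 0.
Proof. by apply: (@addrI _ (t_mul x 0)); rewrite -t_mulDr !addr0. Qed.
Lemma t_mulZl c x y : t_mul (c *: x) y = c *: t_mul x y.
Proof. by have := t_mul_linl y c x 0; rewrite t_mul0l !addr0. Qed.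
Lemma t_mulZr c x y : t_mul x (c *: y) = c *: t_mul x y.
Proof. by have := t_mul_linr x c y 0; rewrite t_mul0r !addr0. Qed.

Lemma t_mul1l x : t_mul t_one x = x.
Proof.
apply: (tens_lin_ext (f := t_mul t_one) (g := id)) => //.
  exact: t_mul_linr.
by move=> v w; rewrite t_mul_pure !amul1l.
Qed.
Lemma t_mul1r x : t_mul x t_one = x.
Proof.
apply: (tens_lin_ext (f := t_mul^~ t_one) (g := id)) => //.
  exact: t_mul_linl.
by move=> v w; rewrite t_mul_pure !amul1r.
Qed.
Lemma t_mulA x y z : t_mul x (t_mul y z) = t_mul (t_mul x y) z.
Proof.
apply: (tens_lin_ext (f := fun u => t_mul u (t_mul y z))
                     (g := fun u => t_mul (t_mul u y) z)) => [| |a b].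
- exact: t_mul_linl.
- by move=> c u v; rewrite !t_mul_linl.
apply: (tens_lin_ext (f := fun u => t_mul (pure a b) (t_mul u z))
                     (g := fun u => t_mul (t_mul (pure a b) u) z)) => [| |a' b'].
- by move=> c u v; rewrite t_mul_linl t_mul_linr.
- by move=> c u v; rewrite t_mul_linr t_mul_linl.
apply: (tens_lin_ext (f := fun u => t_mul (pure a b) (t_mul (pure a' b') u))
            (g := fun u => t_mul (t_mul (pure a b) (pure a' b')) u)) => [| |c d].
- by move=> e u v; rewrite !t_mul_linr.
- by move=> e u v; rewrite !t_mul_linr.
by rewrite !t_mul_pure !amulA.
Qed.

HB.instance Definition _ := isUnitalAlg.Build C (tens A B)
  t_mulA t_mul1l t_mul1r t_mulDl t_mulDr t_mulZl t_mulZr.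

End TensorAlg.

Section SpannedSpace.
Variables (C : numClosedFieldType) (V : lmodType C) (S : V -> Prop).

Definition in_span (v : V) : Prop :=
  exists2 s : seq (C * V),
    {in s, forall p, S p.2} & v = \sum_(p <- s) p.1 *: p.2.

Definition span_pred : pred V := fun v => `[< in_span v >].

Record spanned := Spanned { spval : V; _ : span_pred spval }.
HB.instance Definition _ := [isSub for spval].
HB.instance Definition _ := [Choice of spanned by <:].

Lemma span_closed : GRing.subsemimod_closed span_pred.
Proof.
split; first split.
- by apply/asboolP; exists [::]; rewrite ?big_nil.
- move=> u v /asboolP [s hs ->] /asboolP [t ht ->]; apply/asboolP.
  exists (s ++ t); last by rewrite big_cat.
  by move=> p; rewrite mem_cat => /orP [/hs | /ht].
- move=> c v /asboolP [s hs ->]; apply/asboolP.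
  exists [seq (c * p.1, p.2) | p <- s].
    by move=> _ /mapP [p /hs h ->].
  rewrite big_map scaler_sumr; apply: eq_bigr => p _.
  by rewrite scalerA.
Qed.

HB.instance Definition _ :=
  GRing.SubChoice_isSubLmodule.Build C V span_pred spanned span_closed.

End SpannedSpace.

(* Multipliers of a non-unital algebra [S], given with its embedding [j] into a
   unital algebra [B]: the product of [S] is that of [B]. *)

Section Multipliers.
Variables (C : numClosedFieldType) (S : lmodType C) (B : ualgType C) (j : S -> B).

Record multiplier := Multiplier {
  ml : {linear S -> S};
  mr : {linear S -> S};
  mlr : forall a b, j a ** j (ml b) = j (mr a) ** j b }.

Definition mult_is_prod (m m1 m2 : multiplier) : Prop :=
  ml m =1 ml m1 \o ml m2 /\ mr m =1 mr m2 \o mr m1.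

(* [m] is the multiplier given by multiplication with [b] *)
Definition mult_is_elt (m : multiplier) (b : B) : Prop :=
  forall s, j (ml m s) = b ** j s /\ j (mr m s) = j s ** b.

(* [m b = t] as multipliers, for [b] in [B] and [t] in [S] *)
Definition mult_times_elt (m : multiplier) (b : B) (t : S) : Prop :=
  (forall s s', j s' = b ** j s -> j (ml m s') = j t ** j s) /\
  (forall s, j (mr m s) ** b = j s ** j t).

Definition mult_linear (V : lmodType C) (g : V -> multiplier) : Prop :=
  forall s, is_linear (fun v => ml (g v) s) /\ is_linear (fun v => mr (g v) s).

End Multipliers.

(* Weights are given by their coordinates in the basis of fundamental weights. *)
Notation wlat I := {ffun I -> int}.

Definition is_root (I : finType) (pos : seq (wlat I)) (b : wlat I) : bool :=
  (b \in pos) || (- b \in pos).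

(* The data attached to a complex semisimple Lie algebra with a Cartan
   subalgebra and a choice of simple roots: a reduced crystallographic root
   system with a base and an invariant inner product.  The weight lattice is
   [wlat ld_I]; by [ld_coroot] the coordinate [w r] is the pairing of [w] with
   the simple coroot of [r], so [alpha s r] is a Cartan integer.  The form is
   only required to be a multiple of the Killing-induced form on each simple
   ideal, and a shortest root has squared length 2. *)
Record lie_datum (R : realType) := LieDatum {
  ld_I : finType;
  alpha : ld_I -> wlat ld_I;
  ld_pos : seq (wlat ld_I);
  form : wlat ld_I -> wlat ld_I -> R;
  form_sym : forall x y, form x y = form y x;
  form_add : forall x y z, form (x + y) z = form x z + form y z;
  form_pos : forall x, x != 0 -> 0 < form x x;
  ld_uniq : uniq ld_pos;
  ld_nonzero : 0 \notin ld_pos;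
  ld_simple : forall r, alpha r \in ld_pos;
  ld_base : forall b, b \in ld_pos ->
    exists n : ld_I -> nat, b = \sum_r alpha r *+ n r;
  ld_reflection : forall b c, is_root ld_pos b -> is_root ld_pos c ->
    exists n : int, n%:~R * form b b = 2 * form c b /\
                    is_root ld_pos (c - b *~ n);
  ld_reduced : forall b c (m n : nat), b \in ld_pos -> c \in ld_pos ->
    (0 < m)%N -> b *+ m = c *+ n -> b = c;
  ld_coroot : forall x r,
    2 * form x (alpha r) = (x r)%:~R * form (alpha r) (alpha r);
  (* the sum over all roots is twice the sum over positive roots *)
  ld_killing : exists2 c : ld_I -> R, forall r, 0 < c r &
    forall r x, c r * form (alpha r) x =
      2 * \sum_(b <- ld_pos) form (alpha r) b * form b x;
  ld_short_ge : forall b, b \in ld_pos -> 2 <= form b b;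
  ld_short_eq : ld_pos != [::] -> exists2 b, b \in ld_pos & form b b = 2 }.

Section LieData.
Variables (R : realType) (L : lie_datum R).
Notation P := (wlat (ld_I L)).

Definition fundw (r : ld_I L) : P := [ffun s => (s == r)%:Z].

Definition dominant (w : P) : bool := [forall r, 0 <= w r].

Record domw := DomW { dw :> P; _ : dominant dw }.

Lemma fundw_dominant r : dominant (fundw r).
Proof. by apply/forallP => s; rewrite ffunE. Qed.
Definition fundd (r : ld_I L) : domw := DomW (fundw_dominant r).

Definition srefl (r : ld_I L) (w : P) : P := w - alpha r *~ w r.
Definition wact (s : seq (ld_I L)) (w : P) : P := foldr srefl w s.

Definition reduced_word (s : seq (ld_I L)) : Prop :=
  forall t, wact t =1 wact s -> (size s <= size t)%N.
Definition longest_word (s : seq (ld_I L)) : Prop :=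
  reduced_word s /\ forall t, reduced_word t -> (size t <= size s)%N.

Definition form_rho (w : P) : R := 2^-1 * \sum_(b <- ld_pos L) form b w.

End LieData.
Arguments srefl {R} L r w.
Arguments wact {R} L s w.
Arguments dominant {R} L w.
Arguments fundw {R} L r.
Arguments fundd {R} L r.

Section QNumbers.
Variables (R : realType) (q : R).

Definition qpow (x : R) : R[i] := (q `^ x)%:C%C.

Definition qint (n : nat) : R[i] := ((q ^- n - q ^+ n) / (q^-1 - q))%:C%C.
Definition qfact (n : nat) : R[i] := \prod_(1 <= k < n.+1) qint k.
Definition qbin (n k : nat) : R[i] := qfact n / (qfact k * qfact (n - k)).

End QNumbers.

Section QuantumGroups.
Variables (R : realType) (q : R) (L : lie_datum R).
Notation C := R[i].
Notation I := (ld_I L).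
Notation P := (wlat (ld_I L)).

Definition q_ (r : I) : R := q `^ (form (alpha r) (alpha r) / 2).
Definition qr (r : I) : C := (q_ r)%:C%C.

Definition serre (B : ualgType C) (X : I -> B) : Prop :=
  forall r s, r != s ->
    let N := `|1 - (alpha s : P) r|%N in
    \sum_(k < N.+1) ((-1) ^+ k * qbin (q_ r) N k) *:
       (apow (X r) (N - k) ** X s ** apow (X r) k) = 0.

Definition weight_rep (B : ualgType C) (K : P -> B) : Prop :=
  K 0 = \1 /\ forall w x, K w ** K x = K (w + x).

Inductive uq_gen := gK of P | gE of I | gF of I.

Record uqk_rel (B : staralgType C) (g : uq_gen -> B) : Prop := {
  uq_K : weight_rep (fun w => g (gK w));
  uq_KE : forall w r,
    g (gK w) ** g (gE r) = qpow q (form w (alpha r)) *: (g (gE r) ** g (gK w));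
  uq_KF : forall w r,
    g (gK w) ** g (gF r) = qpow q (- form w (alpha r)) *: (g (gF r) ** g (gK w));
  uq_serreE : serre (fun r => g (gE r));
  uq_serreF : serre (fun r => g (gF r));
  uq_EF : forall r s, g (gE r) ** g (gF s) - g (gF s) ** g (gE r) =
    ((r == s)%:R / (qr r - (qr r)^-1)) *: (g (gK (alpha r)) - g (gK (- alpha r)));
  uq_starK : forall w, star (g (gK w)) = g (gK w);
  uq_starE : forall r, star (g (gE r)) = g (gF r) ** g (gK (alpha r)) }.

(* U_q(g) with the *-structure of U_q(k) *)
Definition Uqk := presented uqk_rel.

Definition uK (w : P) : Uqk := pgen uqk_rel (gK w).
Definition uE (r : I) : Uqk := pgen uqk_rel (gE r).
Definition uF (r : I) : Uqk := pgen uqk_rel (gF r).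

(* K_w, L_w, E_r, F_r: generators of a copy of U_q(b) and of U_q(b^-) *)
Record quad (B : Type) := Quad { cK : P -> B; cL : P -> B; cE : I -> B; cF : I -> B }.

Inductive bor_gen := dK of P | dL of P | dE of I | dF of I.
Definition quad_of (B : Type) (g : bor_gen -> B) : quad B :=
  Quad (fun w => g (dK w)) (fun w => g (dL w)) (fun r => g (dE r)) (fun r => g (dF r)).

Definition upper_gen (B : Type) (K : P -> B) (E : I -> B) (x : P + I) : B :=
  match x with inl w => K w | inr r => E r end.

Definition borel_copies (B : staralgType C) (g : quad B) : Prop :=
  copies (upper_gen uK uE) (upper_gen (cK g) (cE g)) /\
  copies (upper_gen uK uF) (upper_gen (cL g) (cF g)).

Definition borel_star (B : staralgType C) (g : quad B) : Prop :=
  (forall w, star (cK g w) = cL g w) /\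
  (forall r, star (cE g r) = cF g r ** cL g (alpha r)).

Record uplus_rel_quad (B : staralgType C) (g : quad B) : Prop := {
  up_copies : borel_copies g;
  up_star : borel_star g;
  up_KL : forall w x, cK g w ** cL g x = cL g x ** cK g w;
  up_KF : forall w r,
    cK g w ** cF g r = qpow q (- form w (alpha r)) *: (cF g r ** cK g w);
  up_LE : forall w r,
    cL g w ** cE g r = qpow q (form w (alpha r)) *: (cE g r ** cL g w);
  up_EF : forall r s, cE g r ** cF g s - cF g s ** cE g r =
    ((r == s)%:R / (qr r - (qr r)^-1)) *: (cK g (alpha r) - cL g (- alpha r)) }.

Record uzero_rel_quad (B : staralgType C) (g : quad B) : Prop := {
  uz_copies : borel_copies g;
  uz_star : borel_star g;
  uz_KL : forall w x, cK g w ** cL g x = qpow q (- 2 * form w x) *: (cL g x ** cK g w);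
  uz_LE : forall w r,
    cL g w ** cE g r = qpow q (form w (alpha r)) *: (cE g r ** cL g w);
  uz_KF : forall w r,
    cK g w ** cF g r = qpow q (form w (alpha r)) *: (cF g r ** cK g w);
  uz_EF : forall r s, cE g r ** cF g s - cF g s ** cE g r =
    - ((r == s)%:R / (qr r - (qr r)^-1)) *: cL g (- alpha r) }.

Definition uplus_rel (B : staralgType C) (g : bor_gen -> B) := uplus_rel_quad (quad_of g).
Definition uzero_rel (B : staralgType C) (g : bor_gen -> B) := uzero_rel_quad (quad_of g).

Definition Uplus := presented uplus_rel.
Definition Uzero := presented uzero_rel.

Definition qd_k : quad Uqk := Quad uK uK uE uF.
Definition qd_plus : quad Uplus := quad_of (pgen uplus_rel).
Definition qd_zero : quad Uzero := quad_of (pgen uzero_rel).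

(* The first legs are generators [g1] of [A], the second legs generators [g2] of
   [B]; the same formulas thus cover the coproducts and the coaction alpha. *)
Record is_coproduct (X A B : ualgType C) (g : quad X) (g1 : quad A) (g2 : quad B)
    (D : X -> tens A B) : Prop := {
  cop_hom : is_alg_hom D;
  cop_K : forall w, D (cK g w) = pure (cK g1 w) (cK g2 w);
  cop_L : forall w, D (cL g w) = pure (cL g1 w) (cL g2 w);
  cop_E : forall r, D (cE g r) = pure (cE g1 r) (cK g2 (alpha r)) + pure \1 (cE g2 r);
  cop_F : forall r, D (cF g r) = pure (cF g1 r) \1 + pure (cL g1 (- alpha r)) (cF g2 r) }.

Record uqk_hopf := UqkHopf {
  hp_D : Uqk -> tens Uqk Uqk;
  hp_eps : Uqk -> C;
  hp_S : Uqk -> Uqk;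
  hp_coproduct : is_coproduct qd_k qd_k qd_k hp_D;
  hp_eps_linear : forall (c : C) x y, hp_eps (c *: x + y) = c * hp_eps x + hp_eps y;
  hp_eps1 : hp_eps \1 = 1;
  hp_epsM : forall x y, hp_eps (x ** y) = hp_eps x * hp_eps y;
  hp_epsK : forall w, hp_eps (uK w) = 1;
  hp_epsE : forall r, hp_eps (uE r) = 0;
  hp_epsF : forall r, hp_eps (uF r) = 0;
  hp_S_linear : is_linear hp_S;
  hp_antipodel : forall x, tlift (fun a b => hp_S a ** b) (hp_D x) = hp_eps x *: \1;
  hp_antipoder : forall x, tlift (fun a b => a ** hp_S b) (hp_D x) = hp_eps x *: \1 }.

Record grp_rel (B : staralgType C) (g : P -> B) : Prop := {
  gr_mul : weight_rep g;
  gr_star : forall w, star (g w) = g (- w) }.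
Definition grpP := presented grp_rel.
Definition gU (w : P) : grpP := pgen grp_rel w.

Record is_pi_k (f : Uplus -> Uqk) : Prop := {
  pk_hom : is_alg_hom f;
  pk_K : forall w, f (cK qd_plus w) = uK w;
  pk_L : forall w, f (cL qd_plus w) = uK w;
  pk_E : forall r, f (cE qd_plus r) = uE r;
  pk_F : forall r, f (cF qd_plus r) = uF r }.

Record is_pi_a (f : Uplus -> grpP) : Prop := {
  pa_hom : is_alg_hom f;
  pa_K : forall w, f (cK qd_plus w) = gU w;
  pa_L : forall w, f (cL qd_plus w) = gU (- w);
  pa_E : forall r, f (cE qd_plus r) = 0;
  pa_F : forall r, f (cF qd_plus r) = 0 }.

Definition adjmx m n (A : 'M[C]_(m, n)) : 'M[C]_(n, m) := map_mx Num.conj A^T.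

Definition inner n (x y : 'cV[C]_n) : C := (adjmx x *m y) 0 0.

(* An irreducible *-representation on a Hilbert space, identified with C^d by
   the choice of an orthonormal basis, with highest weight [w]. *)
Record irrep (w : P) := Irrep {
  ir_dim : nat;
  ir_rho : Uqk -> 'M[C]_ir_dim;
  ir_linear : is_linear ir_rho;
  ir_one : ir_rho \1 = 1%:M;
  ir_mul : forall x y, ir_rho (x ** y) = ir_rho x *m ir_rho y;
  ir_star : forall x, ir_rho (star x) = adjmx (ir_rho x);
  ir_irred : forall S : 'cV[C]_ir_dim -> Prop,
    (forall (c : C) v v', S v -> S v' -> S (c *: v + v')) ->
    (forall x v, S v -> S (ir_rho x *m v)) ->
    (exists2 v, v != 0 & S v) -> forall v, S v;
  ir_xi : 'cV[C]_ir_dim;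
  ir_unit : inner ir_xi ir_xi = 1;
  ir_wt : forall x, ir_rho (uK x) *m ir_xi = qpow q (form x w) *: ir_xi;
  ir_high : forall r, ir_rho (uE r) *m ir_xi = 0 }.

Section Irrep.
Variables (w : P) (V : irrep w).
Notation H := 'cV[C]_(ir_dim V).

Definition has_wt (v : H) (x : P) : Prop :=
  forall y, ir_rho V (uK y) *m v = qpow q (form y x) *: v.

(* Lusztig's operator T_r on a vector [v] of weight [x].  E_r and F_r are
   nilpotent on the representation, so that terms with an exponent not less than
   its dimension vanish. *)
Definition lusztig (r : I) (x : P) (v : H) : H :=
  let n := (ir_dim V).+1 in
  \sum_(a < n) \sum_(b < n) \sum_(c < n | - a%:Z + b%:Z - c%:Z == x r)
    ((-1) ^+ b * (q_ r ^ (b%:Z - a%:Z * c%:Z))%:C%C /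
       (qfact (q_ r) a * qfact (q_ r) b * qfact (q_ r) c)) *:
    (ir_rho V (apow (uE r) a ** apow (uF r) b ** apow (uE r) c) *m v).

(* T_(r_1) ... T_(r_M) applied to the highest weight vector; the vector
   obtained from a word [t] has weight [wact t w]. *)
Fixpoint lusztig_word (s : seq I) : H :=
  match s with
  | [::] => ir_xi V
  | r :: t => lusztig r (wact L t w) (lusztig_word t)
  end.

Definition low_vec (w0 : seq I) : H :=
  qpow q (- form_rho w) *: lusztig_word w0.

End Irrep.

(* Pol_q(K), the Hopf *-algebra of matrix coefficients, as a space of
   functionals on U_q(k): [pol_ev x X] is the value of [x] at [X]. *)
Record polK (Hf : uqk_hopf) (V : forall w : domw L, irrep w) := PolK {
  pol_alg :> staralgType C;
  pol_ev : pol_alg -> Uqk -> C;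
  mcoef : forall w : domw L, 'cV[C]_(ir_dim (V w)) -> 'cV[C]_(ir_dim (V w)) -> pol_alg;
  pol_D : pol_alg -> tens pol_alg pol_alg;
  pol_ev_linear : forall (c : C) x y X,
    pol_ev (c *: x + y) X = c * pol_ev x X + pol_ev y X;
  pol_ev_inj : forall x, (forall X, pol_ev x X = 0) -> x = 0;
  pol_ev_mcoef : forall w xi eta X,
    pol_ev (@mcoef w xi eta) X = inner xi (ir_rho (V w) X *m eta);
  pol_span : forall x, in_span (fun y => exists w xi eta, y = @mcoef w xi eta) x;
  pol_ev_one : forall X, pol_ev \1 X = hp_eps Hf X;
  pol_ev_mul : forall x y X,
    pol_ev (x ** y) X = tlift (fun a b => pol_ev x a * pol_ev y b) (hp_D Hf X);
  pol_ev_star : forall w xi eta X,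
    pol_ev (star (@mcoef w xi eta)) X = inner eta (ir_rho (V w) (hp_S Hf X) *m xi);
  pol_D_linear : is_linear pol_D;
  pol_D_mcoef : forall w xi eta, pol_D (@mcoef w xi eta) =
    \sum_(i < ir_dim (V w))
       pure (@mcoef w xi (delta_mx i 0)) (@mcoef w (delta_mx i 0) eta) }.

Section Functions.
Variables (Hf : uqk_hopf) (V : forall w : domw L, irrep w) (A : polK Hf V).
Variable w0 : seq I.

(* [bideg l m x]: [x] is homogeneous with lwt(x) = l and rwt(x) = m *)
Inductive bideg (l m : P) : A -> Prop :=
| bideg_mcoef w xi eta :
    has_wt (V := V w) xi l -> has_wt (V := V w) eta m -> bideg l m (mcoef A xi eta)
| bideg_lin (c : C) x y : bideg l m x -> bideg l m y -> bideg l m (c *: x + y).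

Definition b_ (w : domw L) : A := mcoef A (ir_xi (V w)) (low_vec (V w) w0).

(* b_(varpi_r) <| E_r *)
Definition bE (r : I) : A :=
  let w := fundd L r in
  mcoef A (ir_rho (V w) (star (uE r)) *m ir_xi (V w)) (low_vec (V w) w0).

Inductive ext_gen := eX of A | eU of P | eB of P.

Record polext_rel (B : staralgType C) (g : ext_gen -> B) : Prop := {
  ex_hom : is_star_hom (fun x => g (eX x));
  ex_U : weight_rep (fun w => g (eU w));
  ex_Ustar : forall w, star (g (eU w)) = g (eU (- w));
  ex_UX : forall w x, g (eU w) ** g (eX x) = g (eX x) ** g (eU w);
  ex_UB : forall w x, g (eU w) ** g (eB x) = g (eB x) ** g (eU w);
  ex_B : weight_rep (fun w => g (eB w));
  ex_Bstar : forall w, star (g (eB w)) = g (eB w);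
  ex_BX : forall w l m x, bideg l m x ->
    g (eB w) ** g (eX x) = qpow q (form w (l - wact L w0 m)) *: (g (eX x) ** g (eB w));
  ex_b : forall w : domw L, g (eX (b_ w)) = g (eU w) ** g (eB w) }.

Definition polext := presented polext_rel.
Definition xX (x : A) : polext := pgen polext_rel (eX x).
Definition xU (w : P) : polext := pgen polext_rel (eU w).
Definition xB (w : P) : polext := pgen polext_rel (eB w).

Definition binv (w : domw L) : polext := xB (- dw w) ** xU (- dw w).

Lemma binvE w : binv w ** xX (b_ w) = \1 /\ xX (b_ w) ** binv w = \1.
Proof.
split; apply: pres_ext => B g r; have [[_ h1 hM] _] := plift_hom r;
  rewrite h1 !hM !plift_gen // (ex_b r); have [U0 UM] := ex_U r;
  have [B0 BM] := ex_B r.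
- by rewrite amulA -(amulA (g (eB _))) UM addNr U0 amul1r BM addNr B0.
- by rewrite amulA -(amulA (g (eU _))) BM subrr B0 amul1r UM subrr U0.
Qed.

Lemma xX_hom : is_star_hom xX.
Proof.
split; first split.
- move=> c x y; apply: pres_ext => B g r; have [[pl _ _] _] := plift_hom r.
  by rewrite pl !plift_gen // (ah_linear (sh_hom (ex_hom r))).
- apply: pres_ext => B g r; have [[_ p1 _] _] := plift_hom r.
  by rewrite p1 plift_gen // (ah_one (sh_hom (ex_hom r))).
- move=> x y; apply: pres_ext => B g r; have [[_ _ pM] _] := plift_hom r.
  by rewrite pM !plift_gen // (ah_mul (sh_hom (ex_hom r))).
- move=> x; apply: pres_ext => B g r; have [_ ps] := plift_hom r.
  by rewrite ps !plift_gen // (sh_star (ex_hom r)).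
Qed.

Lemma xUM v w : xU v ** xU w = xU (v + w).
Proof.
apply: pres_ext => B g r; have [[_ _ pM] _] := plift_hom r.
by rewrite pM !plift_gen //; have [_ ->] := ex_U r.
Qed.

Lemma xU0 : xU 0 = \1.
Proof.
apply: pres_ext => B g r; have [[_ p1 _] _] := plift_hom r.
by rewrite p1 !plift_gen //; have [-> _] := ex_U r.
Qed.

(* [lwt_ext x l]: [x] is homogeneous with lwt(x) = l *)
Inductive lwt_ext : P -> polext -> Prop :=
| lwt_X l m x : bideg l m x -> lwt_ext l (xX x)
| lwt_U w : lwt_ext w (xU w)
| lwt_B w : lwt_ext 0 (xB w)
| lwt_lin l (c : C) x y : lwt_ext l x -> lwt_ext l y -> lwt_ext l (c *: x + y)
| lwt_one : lwt_ext 0 \1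
| lwt_mul l l' x y : lwt_ext l x -> lwt_ext l' y -> lwt_ext (l + l') (x ** y)
| lwt_star l x : lwt_ext l x -> lwt_ext (- l) (star x).

End Functions.

Definition fshift (w : P) (f : P -> C) : P -> C := fun x => f (x - w).

Definition finsupp_fun (f : P -> C) : Prop :=
  exists s : seq P, forall x, x \notin s -> f x = 0.

Definition fdirac (w : P) : P -> C := fun x => (x == w)%:R.

(* [amp] is used for F_q^+(AK), F_q^0(AK) and F_q^0(AK)_ext; [deg l x] says that
   f x = x f_l is imposed. *)
Section Amplification.
Variables (A : staralgType C) (deg : P -> A -> Prop).

Inductive amp_gen := aX of A | aF of (P -> C).

Record amp_rel (B : staralgType C) (g : amp_gen -> B) : Prop := {
  am_X : is_star_hom (fun x => g (aX x));
  am_F1 : g (aF (fun => 1)) = \1;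
  am_Flin : forall (c : C) f f',
    g (aF (fun x => c * f x + f' x)) = c *: g (aF f) + g (aF f');
  am_FM : forall f f', g (aF (fun x => f x * f' x)) = g (aF f) ** g (aF f');
  am_Fstar : forall f, g (aF (fun x => (f x)^*)) = star (g (aF f));
  am_FX : forall f l x, deg l x ->
    g (aF f) ** g (aX x) = g (aX x) ** g (aF (fshift l f)) }.

Definition amp := presented amp_rel.
Definition mX (x : A) : amp := pgen amp_rel (aX x).
Definition mF (f : P -> C) : amp := pgen amp_rel (aF f).

Lemma amp_rel_gen : amp_rel (pgen amp_rel).
Proof.
split=> [|| c f f'| f f' | f | f l x h].
- split; first split.
  + move=> c x y; apply: pres_ext => B g r; have [[pl _ _] _] := plift_hom r.
    by rewrite pl !plift_gen // (ah_linear (sh_hom (am_X r))).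
  + apply: pres_ext => B g r; have [[_ p1 _] _] := plift_hom r.
    by rewrite p1 plift_gen // (ah_one (sh_hom (am_X r))).
  + move=> x y; apply: pres_ext => B g r; have [[_ _ pM] _] := plift_hom r.
    by rewrite pM !plift_gen // (ah_mul (sh_hom (am_X r))).
  + move=> x; apply: pres_ext => B g r; have [_ ps] := plift_hom r.
    by rewrite ps !plift_gen // (sh_star (am_X r)).
- apply: pres_ext => B g r; have [[_ p1 _] _] := plift_hom r.
  by rewrite p1 plift_gen // (am_F1 r).
- apply: pres_ext => B g r; have [[pl _ _] _] := plift_hom r.
  by rewrite pl !plift_gen // (am_Flin r).
- apply: pres_ext => B g r; have [[_ _ pM] _] := plift_hom r.
  by rewrite pM !plift_gen // (am_FM r).
- apply: pres_ext => B g r; have [_ ps] := plift_hom r.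
  by rewrite ps !plift_gen // (am_Fstar r).
- apply: pres_ext => B g r; have [[_ _ pM] _] := plift_hom r.
  by rewrite !pM !plift_gen // (am_FX r f h).
Qed.

Definition amp_c :=
  spanned (fun y : amp => exists x f, finsupp_fun f /\ y = mX x ** mF f).

End Amplification.

End QuantumGroups.

Section Main.
Variables (R : realType) (q : R) (L : lie_datum R).
Notation C := R[i].
Notation I := (ld_I L).
Notation P := (wlat (ld_I L)).
Variables (Hf : uqk_hopf q L) (V : forall w : domw L, irrep q w).
Variables (A : polK Hf V) (w0 : seq I).

Definition deg_plus (d : P) (x : A) : Prop :=
  exists l m, bideg l m x /\ d = l - m.
Definition deg_zero (d : P) (x : A) : Prop := exists m, bideg d m x.

Definition Fplus := amp deg_plus.
Definition Fzero := amp deg_zero.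
Definition Fext := amp (@lwt_ext R q L Hf V A w0).
Definition Fplus_c := amp_c deg_plus.
Definition Fzero_c := amp_c deg_zero.

Definition Fzero_ext : Fzero -> Fext :=
  plift (fun z => match z with
                  | aX x => mX _ (xX w0 x)
                  | aF f => mF _ f
                  end).

Lemma Fzero_ext_hom : is_star_hom Fzero_ext.
Proof.
apply: plift_hom; have [[[Xl X1 XM] Xs] F1 Fl FM Fs FX] :=
  amp_rel_gen (@lwt_ext R q L Hf V A w0).
have [[xl x1 xM] xs] := xX_hom A w0.
split=> //; last by move=> f l x [m h]; apply: FX; apply: lwt_X h.
rewrite /mX; split; first split.
- by move=> c x y /=; rewrite xl Xl.
- by rewrite /= x1 X1.
- by move=> x y /=; rewrite xM XM.
- by move=> x /=; rewrite xs Xs.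
Qed.

Definition zfun (w : P) : P -> C := fun x => qpow q (form w x).

Definition kk (w : P) : Fext :=
  qpow q (- (form w w / 2)) *: (mF _ (zfun w) ** mX _ (xU A w0 (- w))).
Definition ll (w : P) : Fext :=
  qpow q (- (form w w / 2)) *: (mX _ (xU A w0 w) ** mF _ (zfun w)).
Definition ee (r : I) : Fext :=
  (1 - qr q r ^+ 2)^-1 *: mX _ (binv A w0 (fundd L r) ** xX w0 (bE A w0 r)).

Lemma llV w : 0 < q -> ll (- w) ** ll w = \1 /\ ll w ** ll (- w) = \1.
Proof.
move=> q0; suff h v : ll (- v) ** ll v = \1.
  by split=> //; have := h (- w); rewrite opprK.
have [[[Xl X1 XM] Xs] F1 Fl FM Fs FX] :=
  amp_rel_gen (@lwt_ext R q L Hf V A w0).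
have formN x y : form (- x) y = - form x y :> R.
  have h0 : form 0 y = 0 :> R.
    by apply: (@addrI _ (form 0 y)); rewrite -form_add !addr0.
  by apply/eqP; rewrite -addr_eq0 -form_add addNr h0.
have formNN : form (- v) (- v) = form v v :> R.
  by rewrite formN form_sym formN opprK.
have qD a b : qpow q (a + b) = qpow q a * qpow q b :> C.
  by rewrite /qpow powRD ?rmorphM // (gt_eqF q0) implybT.
have zE : (fun x => fshift v (zfun (- v)) x * zfun v x)
    = (fun x => qpow q (form v v) * 1 + 0 : C).
  apply: functional_extensionality_dep => x.
  rewrite /fshift /zfun -qD mulr1 addr0; congr qpow.
  rewrite formN (form_sym v (x - v)) form_add formN (form_sym x).
  by rewrite opprD opprK addrAC addNr add0r.
have F0 : pgen (amp_rel (@lwt_ext R q L Hf V A w0)) (aF _ (fun => 0 : C)) = 0.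
  have := Fl (-1) (fun => 0) (fun => 0); rewrite scaleN1r addNr => <-.
  congr pgen; congr aF.
  by apply: functional_extensionality_dep => x; rewrite mulr0 addr0.
rewrite /ll formNN amulZl amulZr scalerA -qD -opprD -splitr.
rewrite -amulA (amulA (mF _ _) (mX _ _)) {1}/mF {1}/mX (FX _ v); last exact: lwt_U.
rewrite -amulA -FM zE (Fl _ (fun=> 1) (fun=> 0)) F1 F0 addr0 amulA.
rewrite /mX -XM xUM addNr xU0 X1 amul1l scalerA -qD addNr /qpow powRr0.
by rewrite rmorph1 scale1r.
Qed.

Definition ff (r : I) : Fext := star (ee r) ** ll (- alpha r).

Record is_pi (f : Uzero q L -> Fext) : Prop := {
  pi_hom : is_star_hom f;
  pi_K : forall w, f (cK (qd_zero q L) w) = kk w;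
  pi_L : forall w, f (cL (qd_zero q L) w) = ll w;
  pi_E : forall r, f (cE (qd_zero q L) r) = ee r;
  pi_F : forall r, f (cF (qd_zero q L) r) = ff r }.

Notation S := (tens Fplus_c Fzero_c).
Notation B := (tens Fplus Fzero).

Definition emb : S -> B :=
  tmap (fun a : Fplus_c => spval a) (fun a : Fzero_c => spval a).

Definition point (w x : P) : B := pure (mF _ (fdirac w)) (mF _ (fdirac x)).

(* [m] is multiplication by the function [h] on P x P *)
Definition mult_is_fun (m : multiplier emb) (h : P -> P -> C) : Prop :=
  forall w x s,
    point w x ** emb (ml m s) = h w x *: (point w x ** emb s) /\
    emb (mr m s) ** point w x = h w x *: (emb s ** point w x).

(* gamma(x f) = Delta(x) Delta(f) *)
Definition is_gamma (g : Fzero_c -> multiplier emb) : Prop :=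
  mult_linear g /\
  forall (a : Fzero_c) (x : A) (f : P -> C), finsupp_fun f ->
    spval a = mX _ x ** mF _ f ->
    exists mx mf,
      [/\ mult_is_elt mx (tmap (mX deg_plus) (mX deg_zero) (pol_D x) : B),
          mult_is_fun mf (fun w x => f (w + x)) & mult_is_prod (g a) mx mf].

(* x_(1) (Y, x_(2)) *)
Definition right_act (Y : Uqk q L) (x : A) : A :=
  tlift (fun a b => pol_ev b Y *: a) (pol_D x).

Record is_translation (Dp : Uplus q L -> tens (Uplus q L) (Uplus q L))
    (pk : Uplus q L -> Uqk q L) (pa : Uplus q L -> grpP L)
    (act : Uplus q L -> Fplus_c -> Fplus_c) : Prop := {
  tr_linear : forall X, is_linear (act X);
  tr_act : forall X (s : seq (Uqk q L * P)),
    tmap pk pa (Dp X) = \sum_(p <- s) pure p.1 (gU p.2) ->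
    forall (a : Fplus_c) (x : A) (f : P -> C), finsupp_fun f ->
      spval a = mX _ x ** mF _ f ->
      spval (act X a) =
        \sum_(p <- s) mX _ (right_act p.1 x) ** mF _ (fshift (- p.2) f) }.

Section Module.
Variables (M : lmodType C) (act : Fext -> M -> M).

Definition act_c (y : Fzero_c) (v : M) : M := act (Fzero_ext (spval y)) v.

Definition nondegenerate_act : Prop :=
  forall v : M, in_span (fun u => exists y w, u = act_c y w) v.

(* V_0(x (x) y v) = (id (x) (- v)) (gamma(x) (1 (x) y)) *)
Definition is_V0 (g : Fzero_c -> multiplier emb)
    (V0 : tens Fzero_c M -> tens Fplus_c M) : Prop :=
  is_linear V0 /\
  forall (x y : Fzero_c) (t : S) (v : M),
    mult_times_elt (g x) (pure \1 (spval y)) t ->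
    V0 (pure x (act_c y v)) = tlift (fun a b => pure a (act_c b v)) t.

(* The operator on M (x) F_q,c^+(AK) given by (pi (x) pi_rhd)(T) *)
Definition tens_act (pi : Uzero q L -> Fext) (rhd : Uplus q L -> Fplus_c -> Fplus_c)
    (T : tens (Uzero q L) (Uplus q L)) (u : tens M Fplus_c) : tens M Fplus_c :=
  tlift (fun X Y => tmap (act (pi X)) (rhd Y) u) T.

End Module.
End Main.

(* Main.v *)
(* The set of X for which the identity holds is a subalgebra, so it suffices to
   treat the generators.  For v in a weight space M_chi of the functions on P, the
   map V_0 is (x f) (x) v |-> x_(1) f(. + chi) (x) x_(2) v, and the identity for X
   reduces to a commutation rule between pi(X) and Pol_q(K): with
   x <| Y = Y(x_(1)) x_(2),
     x k_w = k_w (x <| K_w),      x e_r = e_r (x <| K_(alpha_r)) + x <| E_r,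
     x l_w = l_w (x <| K_w),      x f_r = f_r x + l_(-alpha_r) (x <| F_r).
   The rule for f_r is the adjoint of the one for e_r.  The rule for e_r results from
   acting by E_r on the relation b_w x = q^(w, lwt x - w_0 rwt x) x b_w, which thus
   has to be known in Pol_q(K) itself, and not only in Pol_q(K)_ext where it is
   imposed.

   That relation is usually read off the universal R-matrix.  Here it is replaced by
   a U_q(k)-linear map V_w (x) W <- W (x) V_w with the triangularity of the R-matrix:
   the map eta |-> q^(w_0 w, wt eta) eta_(w_0 w) (x) eta is a lowest weight vector
   of Hom(W, V_w (x) W), which carries an invariant positive definite form twisted
   by K_(-2 rho), and so it generates a copy of V_w. *)

(* The algebras are quotients by whatever their relations force, without a basis theorem, and
   Pol_q(K) is seen only through its values on U_q(k). Equalities in Pol_q(K) are therefore tested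
   on elements of U_q(k), where matrix coefficients turn them into identities between
   representations; this is how the relation for b_w becomes a statement about an intertwiner.

   The copy of V_w is found without decomposing Hom(W, V_w (x) W): in the product of V_w with this
   space, the submodule generated by the pair of lowest weight vectors is the graph of a map,
   because both factors carry definite contravariant forms. The twist by K_(-2 rho) makes up for the
   square of the antipode, which is not the identity.

   Acting by E_r on the relation for b_(varpi_r) produces the factor q^(alpha_r, varpi_r) twice. Its
   square is q_r^2, whence the constant (1 - q_r^2)^-1 in e_r.

   The coaction gamma takes values in multipliers, and V_0 is prescribed only on x (x) y v.
   Non-degeneracy makes M the span of the M_chi; for v in M_chi one has v = delta_chi v, and gamma(x
   f)(1 (x) delta_chi) is an honest tensor. *)
Require Import Defs.
From mathcomp Require Import all_boot all_order all_algebra.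
From mathcomp Require Import boolp reals complex.
From mathcomp Require Import exp generic_quotient mxtens ring lra.
(* again, since mathcomp redefines some names of [Defs], such as [form] *)
Require Import Defs.

Set Implicit Arguments.
Unset Strict Implicit.
Unset Printing Implicit Defensive.
Import Order.TTheory GRing.Theory Num.Theory.
Local Open Scope ring_scope.

(** * Roots and the longest Weyl group element *)

Section Weyl.
Variables (R : realType) (L : lie_datum R).
Notation I := (ld_I L).
Notation P := (wlat (ld_I L)).
Notation pos := (ld_pos L).
Notation frm := (@form R L).
Implicit Types (x y z b : P) (r : I).

Lemma form_addr x y z : frm x (y + z) = frm x y + frm x z.
Proof. by rewrite form_sym form_add !(form_sym x). Qed.
Lemma form0l x : frm 0 x = 0.
Proof. by apply: (@addrI _ (frm 0 x)); rewrite -form_add !addr0. Qed.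
Lemma form0r x : frm x 0 = 0.
Proof. by rewrite form_sym form0l. Qed.
Lemma formNl x y : frm (- x) y = - frm x y.
Proof. by apply/eqP; rewrite -addr_eq0 -form_add addNr form0l. Qed.
Lemma formNr x y : frm x (- y) = - frm x y.
Proof. by rewrite form_sym formNl form_sym. Qed.
Lemma formBl x y z : frm (x - y) z = frm x z - frm y z.
Proof. by rewrite form_add formNl. Qed.
Lemma formBr x y z : frm x (y - z) = frm x y - frm x z.
Proof. by rewrite form_addr formNr. Qed.
Lemma form_mulrnl x y n : frm (x *+ n) y = frm x y *+ n.
Proof. by elim: n => [|n IH]; rewrite ?mulr0n ?form0l // !mulrS form_add IH. Qed.
Lemma form_mulrzl x y (n : int) : frm (x *~ n) y = n%:~R * frm x y.
Proof. by rewrite mulrzl; case: n => n; rewrite /intmul ?formNl form_mulrnl. Qed.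
Lemma form_mulrzr x y (n : int) : frm x (y *~ n) = n%:~R * frm x y.
Proof. by rewrite form_sym form_mulrzl form_sym. Qed.
Lemma form_suml (T : finType) (F : T -> P) x :
  frm (\sum_i F i) x = \sum_i frm (F i) x.
Proof.
by apply: (big_morph (fun u => frm u x)) => [u v|]; rewrite ?form_add ?form0l.
Qed.
Lemma form_eq0 x : frm x x = 0 -> x = 0.
Proof.
by move=> h; apply/eqP/negP => /negP /form_pos; rewrite h ltxx.
Qed.

Lemma alpha_neq0 r : alpha r != 0 :> P.
Proof.
by apply/eqP => h; have := ld_simple r; rewrite h; apply/negP/ld_nonzero.
Qed.
Lemma alpha_gt0 r : 0 < frm (alpha r) (alpha r).
Proof. exact/form_pos/alpha_neq0. Qed.

Lemma form_coroot x r :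
  frm x (alpha r) = (x r)%:~R * (frm (alpha r) (alpha r) / 2).
Proof. by have := ld_coroot x r; lra. Qed.

Lemma form_fundw (r s : I) :
  frm (fundw L r) (alpha s) = (r == s)%:R * (frm (alpha s) (alpha s) / 2).
Proof. by rewrite form_coroot ffunE eq_sym; case: eqP. Qed.

(** The weight rho in fundamental coordinates. Pairing with it is positive on positive roots and
    serves below as the height by which weights are compared. *)
Definition wrho : P := [ffun=> 1].

Lemma form_wrho r : frm wrho (alpha r) = frm (alpha r) (alpha r) / 2.
Proof. by rewrite form_coroot ffunE mul1r. Qed.

Lemma form_fundw_pos b r : b \in pos -> 0 <= frm (fundw L r) b.
Proof.
move=> /ld_base [n ->]; rewrite form_sym form_suml; apply: sumr_ge0 => s _.
rewrite form_mulrnl form_sym form_fundw mulrn_wge0 //.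
by rewrite mulr_ge0 // divr_ge0 // ltW // alpha_gt0.
Qed.

Lemma wrho_pos b : b \in pos -> 0 < frm wrho b.
Proof.
move=> bp; have b0 : b != 0.
  by apply/eqP => h; move: bp; rewrite h; apply/negP/ld_nonzero.
have [n bE] := ld_base bp.
have nn s : 0 <= frm wrho (alpha s) *+ n s.
  by rewrite mulrn_wge0 // form_wrho divr_ge0 // ltW // alpha_gt0.
have bE' : frm wrho b = \sum_s frm wrho (alpha s) *+ n s.
  rewrite bE form_sym form_suml; apply: eq_bigr => s _.
  by rewrite form_mulrnl form_sym.
rewrite lt_def bE' sumr_ge0 // andbT; apply: contra b0 => /eqP h.
rewrite bE; apply/eqP/big1 => s _.
have /eqP : frm wrho (alpha s) *+ n s = 0 by apply: (psumr_eq0P (fun s _ => nn s) h).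
rewrite mulrn_eq0 form_wrho => /orP [/eqP -> //|].
by rewrite mulf_eq0 invr_eq0 (gt_eqF (alpha_gt0 s)) pnatr_eq0.
Qed.

Lemma root_pos b : is_root pos b -> (b \in pos) = (0 < frm wrho b).
Proof.
case/orP => h; first by rewrite h wrho_pos.
have := wrho_pos h; rewrite formNr oppr_gt0 => h'.
by apply/idP/idP => [/wrho_pos|]; rewrite ?(lt_gtF h') //.
Qed.

Lemma root_neg b : is_root pos b -> b \notin pos -> - b \in pos.
Proof. by case/orP => // ->. Qed.

Lemma root_opp b : is_root pos b -> is_root pos (- b).
Proof. by rewrite /is_root opprK orbC. Qed.

Lemma alpha_self r : (alpha r : P) r = 2.
Proof.
have := form_coroot (alpha r) r; set a := frm _ _ => h.
have : (((alpha r : P) r)%:~R : R) = 2%:~R.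
  apply: (@mulIf _ (a / 2)); last by rewrite -h; field.
  by rewrite mulf_neq0 ?invr_eq0 ?pnatr_eq0 // gt_eqF // alpha_gt0.
by move/intr_inj.
Qed.

Lemma form_srefl r x y : frm (srefl L r x) (srefl L r y) = frm x y.
Proof.
rewrite /srefl !formBl !formBr !form_mulrzl !form_mulrzr.
rewrite (form_sym (alpha r) y) (form_coroot x r) (form_coroot y r).
by field.
Qed.

Lemma srefl_add r x y : srefl L r (x + y) = srefl L r x + srefl L r y.
Proof. by rewrite /srefl ffunE mulrzDr opprD addrACA. Qed.

Lemma sreflK r : involutive (srefl L r).
Proof.
move=> x; rewrite /srefl !ffunE.
have -> : (alpha r *~ x r) r = x r *+ 2.
  rewrite -[in RHS]mulr_natr -(alpha_self r).
  have Z (n : int) (v : P) : (v *~ n) r = v r *~ n.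
    by case: n => n; rewrite /intmul ?ffunE ffunMnE.
  by rewrite Z -mulrzr mulrC intz.
by rewrite mulr2n opprD addrA subrr sub0r mulrNz opprK subrK.
Qed.

Lemma srefl_alpha r : srefl L r (alpha r) = - alpha r.
Proof. by rewrite /srefl alpha_self mulrz_nat mulr2n opprD addrA subrr sub0r. Qed.

Implicit Types (s t : seq I).

Lemma wact_add s x y : wact L s (x + y) = wact L s x + wact L s y.
Proof. by elim: s => //= r s ->; rewrite srefl_add. Qed.
Lemma wact0 s : wact L s 0 = 0.
Proof. by apply: (@addrI _ (wact L s 0)); rewrite -wact_add !addr0. Qed.
Lemma wactN s x : wact L s (- x) = - wact L s x.
Proof. by apply/eqP; rewrite -addr_eq0 -wact_add addNr wact0. Qed.
Lemma wactMn s x n : wact L s (x *+ n) = wact L s x *+ n.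
Proof. by elim: n => [|n IH]; rewrite ?mulr0n ?wact0 // !mulrS wact_add IH. Qed.
Lemma wactMz s x (n : int) : wact L s (x *~ n) = wact L s x *~ n.
Proof. by case: n => n; rewrite /intmul ?wactN wactMn. Qed.
Lemma wact_cat s t x : wact L (s ++ t) x = wact L s (wact L t x).
Proof. by rewrite /wact foldr_cat. Qed.
Lemma wact_rcons s r x : wact L (rcons s r) x = wact L s (srefl L r x).
Proof. by rewrite -cats1 wact_cat. Qed.
Lemma form_wact s x y : frm (wact L s x) (wact L s y) = frm x y.
Proof. by elim: s => //= r s IH; rewrite form_srefl. Qed.

Lemma root_srefl r b : is_root pos b -> is_root pos (srefl L r b).
Proof.
move=> br; have ar : is_root pos (alpha r) by rewrite /is_root ld_simple.
have [n [hn]] := ld_reflection ar br; rewrite /srefl.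
suff -> : n = b r by [].
apply: (@intr_inj R); apply: (mulIf (lt0r_neq0 (alpha_gt0 r))).
by rewrite hn form_coroot; field.
Qed.
Lemma root_wact s b : is_root pos b -> is_root pos (wact L s b).
Proof. by move=> br; elim: s => //= r s; apply: root_srefl. Qed.

(** Pairing with a fundamental weight other than that of [r] does not see s_r. If the image of [b]
    were negative, all coefficients of [b] except that at [alpha r] would vanish, and reducedness
    would give [b = alpha r]. *)
Lemma pos_srefl r b : b \in pos -> b != alpha r -> srefl L r b \in pos.
Proof.
move=> bp bn; have br : is_root pos b by rewrite /is_root bp.
apply/negPn/negP => /(root_neg (root_srefl r br)) h.
have [n bE] := ld_base bp.
have fb (s : I) : frm (fundw L s) b = (n s)%:R * (frm (alpha s) (alpha s) / 2).
  rewrite {1}bE form_sym form_suml (bigD1 s) //= big1 => [|t ts].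
    by rewrite addr0 form_mulrnl form_sym form_fundw eqxx mul1r mulr_natl.
  by rewrite form_mulrnl form_sym form_fundw eq_sym (negbTE ts) mul0r mul0rn.
have n0 (s : I) : s != r -> n s = 0%N.
  move=> sr; have := form_fundw_pos s h.
  rewrite formNr oppr_ge0 /srefl formBr form_mulrzr form_fundw (negbTE sr) mul0r.
  rewrite mulr0 subr0 fb => h'; apply/eqP; rewrite -(pnatr_eq0 R).
  rewrite -(mulIr_eq0 _ (mulIf (_ : frm (alpha s) (alpha s) / 2 != 0))).
    by rewrite eq_le h' mulr_ge0 // divr_ge0 // ltW // alpha_gt0.
  by rewrite mulf_neq0 ?invr_eq0 ?pnatr_eq0 // gt_eqF // alpha_gt0.
have bE' : b = alpha r *+ n r.
  by rewrite {1}bE (bigD1 r) //= big1 ?addr0 // => s /n0 ->; rewrite mulr0n.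
have : b = alpha r by apply: (@ld_reduced _ _ _ _ 1 (n r)) => //; apply: ld_simple.
by apply/eqP.
Qed.

(* The length of the Weyl group element given by the word [s] *)
Definition inversions s := count (fun b => wact L s b \notin pos) pos.

Lemma perm_srefl r :
  perm_eq [seq srefl L r b | b <- rem (alpha r) pos] (rem (alpha r) pos).
Proof.
have u := rem_uniq (alpha r) (ld_uniq L).
have inj : injective (srefl L r) := inv_inj (sreflK r).
have mem b : b \in rem (alpha r) pos -> srefl L r b \in rem (alpha r) pos.
  rewrite !mem_rem_uniq ?ld_uniq // !inE => /andP [bn bp].
  rewrite pos_srefl // andbT; apply/eqP => h.
  have := sreflK r b; rewrite h srefl_alpha => hb.
  have := wrho_pos bp; rewrite -hb formNr oppr_gt0.
  by rewrite ltNge ltW // wrho_pos // ld_simple.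
apply: uniq_perm => // [|b]; first by rewrite map_inj_uniq.
apply/mapP/idP => [[c /mem h ->] //|/mem h].
by exists (srefl L r b); rewrite ?sreflK.
Qed.

Lemma inversionsD1 r s :
  inversions s = ((wact L s (alpha r) \notin pos) +
    count (fun b => wact L s b \notin pos) (rem (alpha r) pos))%N.
Proof. by rewrite /inversions (permP (perm_to_rem (ld_simple r))). Qed.

(** Since s_r permutes the positive roots other than [alpha r], only [alpha r] changes the count.
    The two booleans cover both signs at once and keep subtraction out of [nat]. *)
Lemma inversions_rcons s r :
  (inversions (rcons s r) + (wact L s (alpha r) \notin pos) =
   inversions s + (wact L s (alpha r) \in pos))%N.
Proof.
rewrite !(inversionsD1 r) wact_rcons srefl_alpha wactN.
have -> : count (fun b => wact L (rcons s r) b \notin pos) (rem (alpha r) pos) =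
          count (fun b => wact L s b \notin pos) (rem (alpha r) pos).
  rewrite -[in RHS](permP (perm_srefl r)) count_map; apply: eq_count => b /=.
  by rewrite wact_rcons.
have rr : is_root pos (wact L s (alpha r)).
  by apply: root_wact; rewrite /is_root ld_simple.
have -> : (- wact L s (alpha r) \notin pos) = (wact L s (alpha r) \in pos).
  rewrite !root_pos ?root_opp // formNr oppr_gt0 -leNgt.
  have := form_pos; rewrite le_eqVlt; case: eqP => //= h _.
  by case/orP: rr => /wrho_pos; rewrite ?formNr -h ?oppr0 ltxx.
by rewrite addnAC [RHS]addnAC addnC [RHS]addnC; congr (_ + _)%N; rewrite addnC.
Qed.

Lemma inversions_eq s t : wact L s =1 wact L t -> inversions s = inversions t.
Proof. by move=> h; apply: eq_count => b; rewrite h. Qed.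

Lemma inversions_le s : (inversions s <= size s)%N.
Proof.
elim/last_ind: s => [|s r IH].
  by rewrite leqn0; apply/eqP/eqP; rewrite eqn0Ngt -has_count; apply/hasPn => b /= ->.
rewrite size_rcons; apply: leq_trans (_ : (inversions s + 1 <= _)%N); last by rewrite addn1.
rewrite (leq_trans (leq_addr (wact L s (alpha r) \notin pos) _)) // inversions_rcons.
by rewrite leq_add2l; case: (_ \in _).
Qed.

Lemma wact_srefl_comm s r r' x :
  wact L s (alpha r) = alpha r' -> wact L s (srefl L r x) = srefl L r' (wact L s x).
Proof.
move=> h; rewrite /srefl wact_add wactN wactMz h; congr (_ - _ *~ _).
apply: (@intr_inj R); have := form_wact s x (alpha r).
have aE : frm (alpha r') (alpha r') = frm (alpha r) (alpha r) by rewrite -h form_wact.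
rewrite h (form_coroot x) (form_coroot (wact L s x)) aE => /esym; apply: mulIf.
by rewrite mulf_neq0 ?invr_eq0 ?pnatr_eq0 // gt_eqF // alpha_gt0.
Qed.

(** The exchange condition. Applying the letters from the right, [alpha r] turns negative at some
    letter i; just before, it equals [alpha i], so s_i is a conjugate of s_r that cancels it, and
    [t] is [s] without that letter. *)
Lemma exchange s r : wact L s (alpha r) \notin pos ->
  exists2 t, wact L t =1 wact L (rcons s r) & (size t).+1 = size s.
Proof.
elim: s => [|i s IH] /=; first by rewrite ld_simple.
case: (boolP (wact L s (alpha r) \in pos)) => [h|/IH [t tE ts]] hn.
  exists s => // x; rewrite /= wact_rcons.
  have e : wact L s (alpha r) = alpha i.
    by apply/eqP; apply: contraNT hn => hn; apply: pos_srefl.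
  by rewrite (wact_srefl_comm _ e) sreflK.
by exists (i :: t) => [x|]; rewrite /= ?tE ?ts.
Qed.

(** With [inversions_le], this identifies the length with the number of inversions. When a new
    letter lowers this number, the exchange condition deletes another letter. *)
Lemma short_word s : exists2 t, wact L t =1 wact L s & size t = inversions s.
Proof.
elim/last_ind: s => [|s r [t tE ts]].
  exists [::] => //; apply/esym/eqP; rewrite eqn0Ngt -has_count.
  by apply/hasPn => b /= ->.
have E : wact L (rcons t r) =1 wact L (rcons s r).
  by move=> x; rewrite !wact_rcons tE.
have := inversions_rcons s r.
case: (boolP (wact L s (alpha r) \in pos)) => h /=; rewrite ?addn0 ?addn1 => hs.
  by exists (rcons t r) => //; rewrite size_rcons ts hs.
rewrite -tE in h; have [t' tE' ts'] := exchange h.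
exists t' => [x|]; first by rewrite tE' E.
by apply: succn_inj; rewrite ts' ts -hs.
Qed.

Section Longest.
Variables (w0 : seq I) (w0_longest : longest_word w0).

(** Otherwise w_0 s_r has one more inversion than w_0, hence a longer reduced word. *)
Lemma longest_alpha r : wact L w0 (alpha r) \notin pos.
Proof.
have [red lon] := w0_longest; apply/negP => h.
have := inversions_rcons w0 r; rewrite h addn0 addn1 => hs.
have [t0 t0E t0s] := short_word w0; have := red _ t0E; rewrite t0s => le0.
have [t tE ts] := short_word (rcons w0 r).
have : reduced_word t.
  move=> t' t'E; rewrite ts -(inversions_eq tE) -(inversions_eq t'E).
  exact: inversions_le.
by move/lon; rewrite ts hs ltnNge le0.
Qed.

Lemma longest_pos b : b \in pos -> - wact L w0 b \in pos.
Proof.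
move=> bp; apply: root_neg.
  by apply: root_wact; rewrite /is_root bp.
apply/negP => /wrho_pos; have [n ->] := ld_base bp.
rewrite (big_morph (wact L w0) (wact_add w0) (wact0 w0)) form_sym form_suml.
apply/negP; rewrite -leNgt; apply: sumr_le0 => s _.
rewrite wactMn form_mulrnl form_sym mulrn_wle0 // -oppr_ge0 -formNr ltW //.
apply/wrho_pos/root_neg/longest_alpha/root_wact.
by rewrite /is_root ld_simple.
Qed.

(** The square of w_0 sends positive roots to positive roots, so its shortest word is empty. *)
Lemma longestK : involutive (wact L w0).
Proof.
move=> x; rewrite -wact_cat; have [t tE ts] := short_word (w0 ++ w0).
rewrite -tE; suff: size t = 0%N by move/size0nil ->.
rewrite ts; apply/eqP; rewrite eqn0Ngt -has_count; apply/hasPn => b bp /=.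
rewrite negbK wact_cat -[wact L w0 (wact L w0 b)]opprK -wactN.
have h := longest_pos bp; have := longest_pos h.
by rewrite !wactN opprK.
Qed.

Lemma form_longest x y : frm (wact L w0 x) y = frm x (wact L w0 y).
Proof. by rewrite -(form_wact w0) longestK. Qed.

End Longest.
End Weyl.

(** * Linear maps, tensors and presented algebras *)

Section LinearMaps.
Variable C : numClosedFieldType.
Implicit Types V W U : lmodType C.

Lemma lin0 V W (f : V -> W) : is_linear f -> f 0 = 0.
Proof. by move=> lf; have := lf (-1) 0 0; rewrite scaler0 addr0 scaleN1r addNr. Qed.
Lemma linD V W (f : V -> W) x y : is_linear f -> f (x + y) = f x + f y.
Proof. by move=> lf; have := lf 1 x y; rewrite !scale1r. Qed.
Lemma linZ V W (f : V -> W) c x : is_linear f -> f (c *: x) = c *: f x.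
Proof. by move=> lf; have := lf c x 0; rewrite !addr0 (lin0 lf) addr0. Qed.
Lemma linN V W (f : V -> W) x : is_linear f -> f (- x) = - f x.
Proof. by move=> lf; rewrite -scaleN1r linZ // scaleN1r. Qed.
Lemma lin_sum V W (f : V -> W) (J : Type) (s : seq J) (Q : pred J) (F : J -> V) :
  is_linear f -> f (\sum_(i <- s | Q i) F i) = \sum_(i <- s | Q i) f (F i).
Proof.
by move=> lf; apply: (big_morph f) => [x y|]; rewrite ?linD // lin0.
Qed.

Lemma lin_comp V W U (f : W -> U) (g : V -> W) :
  is_linear f -> is_linear g -> is_linear (fun x => f (g x)).
Proof. by move=> lf lg c x y; rewrite lg lf. Qed.
Lemma lin_id V : is_linear (fun x : V => x).
Proof. by []. Qed.
Lemma lin_add V W (f g : V -> W) :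
  is_linear f -> is_linear g -> is_linear (fun x => f x + g x).
Proof. by move=> lf lg c x y; rewrite lf lg scalerDr addrACA. Qed.
Lemma lin_scale V W (f : V -> W) c : is_linear f -> is_linear (fun x => c *: f x).
Proof. by move=> lf a x y; rewrite lf scalerDr !scalerA mulrC. Qed.
Lemma lin_sumf V W (J : Type) (s : seq J) (F : J -> V -> W) :
  (forall j, is_linear (F j)) -> is_linear (fun x => \sum_(j <- s) F j x).
Proof.
move=> lF c x y; rewrite scaler_sumr -big_split /=.
by apply: eq_bigr => j _; apply: lF.
Qed.

Lemma bilin_l V W U (f : V -> W -> U) w : bilin f -> is_linear (f^~ w).
Proof. by case. Qed.
Lemma bilin_r V W U (f : V -> W -> U) v : bilin f -> is_linear (f v).
Proof. by case. Qed.

Lemma bilin_pre V W V' W' U (f : V' -> W' -> U) (g : V -> V') (h : W -> W') :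
  bilin f -> is_linear g -> is_linear h -> bilin (fun v w => f (g v) (h w)).
Proof.
move=> [h1 h2] lg lh; split=> [w|v].
  exact: (lin_comp (h1 _) lg).
exact: (lin_comp (h2 _) lh).
Qed.

(** [tlift] is a finite sum over one chosen representative, so this, [eq_tlift] and the exchange of
    two [tlift]s hold for arbitrary functions of two arguments. *)
Lemma lin_tlift V W U U' (f : V -> W -> U) (g : U -> U') t :
  is_linear g -> g (tlift f t) = tlift (fun v w => g (f v w)) t.
Proof. by move=> lg; rewrite /tlift /fsum lin_sum. Qed.

Lemma eq_tlift V W U (f g : V -> W -> U) t :
  (forall v w, f v w = g v w) -> tlift f t = tlift g t.
Proof. by move=> e; apply: eq_bigr => p _; rewrite e. Qed.

Lemma tlift_bilin_lin V W U U' (f : U' -> V -> W -> U) t :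
  (forall v w, is_linear (fun u => f u v w)) -> is_linear (fun u => tlift (f u) t).
Proof. by move=> lf; apply: lin_sumf => p; apply: lf. Qed.

Lemma tmap_linear V W V' W' (f : V -> V') (g : W -> W') :
  is_linear f -> is_linear g -> is_linear (tmap f g).
Proof. by move=> lf lg; apply/tlift_linear/bilin_tmap. Qed.
Lemma tmap_pure V W V' W' (f : V -> V') (g : W -> W') v w :
  is_linear f -> is_linear g -> tmap f g (pure v w) = pure (f v) (g w).
Proof. by move=> lf lg; rewrite /tmap tlift_pure //; apply: bilin_tmap. Qed.

Lemma bilin_flip V W : bilin (fun (v : V) (w : W) => pure w v).
Proof. by have [h1 h2] := bilin_pure W V; split=> [w|v]; [apply: h2 | apply: h1]. Qed.
Lemma tflip_linear V W : is_linear (@tflip C V W).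
Proof. exact/tlift_linear/bilin_flip. Qed.
Lemma tflip_pure V W (v : V) (w : W) : tflip (pure v w) = pure w v.
Proof. by rewrite /tflip tlift_pure //; apply: bilin_flip. Qed.

Lemma pure_linl V W (w : W) : is_linear (fun v : V => pure v w).
Proof. by case: (bilin_pure V W). Qed.
Lemma pure_linr V W (v : V) : is_linear (fun w : W => pure v w).
Proof. by case: (bilin_pure V W). Qed.

Lemma pureLl V W c (x y : V) (w : W) : pure (c *: x + y) w = c *: pure x w + pure y w.
Proof. exact: (pure_linl w). Qed.
Lemma pureLr V W c (x y : W) (v : V) : pure v (c *: x + y) = c *: pure v x + pure v y.
Proof. exact: (pure_linr v). Qed.
Lemma pure0l V W (w : W) : pure (0 : V) w = 0.
Proof. exact: (lin0 (pure_linl w)). Qed.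
Lemma pure0r V W (v : V) : pure v (0 : W) = 0.
Proof. exact: (lin0 (pure_linr v)). Qed.
Lemma pureZl V W c (v : V) (w : W) : pure (c *: v) w = c *: pure v w.
Proof. exact: (linZ _ _ (pure_linl w)). Qed.
Lemma pureZr V W c (v : V) (w : W) : pure v (c *: w) = c *: pure v w.
Proof. exact: (linZ _ _ (pure_linr v)). Qed.

Lemma in_span_ind V (S Q : V -> Prop) :
  Q 0 -> (forall c x y, Q x -> Q y -> Q (c *: x + y)) ->
  (forall x, S x -> Q x) -> forall v, in_span S v -> Q v.
Proof.
move=> Q0 QL QS v [s hs ->]; elim: s hs => [|p s IH] hs; first by rewrite big_nil.
rewrite big_cons; apply: QL; first by apply/QS/hs; rewrite inE eqxx.
by apply: IH => r rs; apply: hs; rewrite inE rs orbT.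
Qed.

Lemma in_span_lin V (S : V -> Prop) c x y :
  in_span S x -> in_span S y -> in_span S (c *: x + y).
Proof.
move=> /asboolP hx /asboolP hy; apply/asboolP.
have [[h0 hD] hZ] := span_closed S.
by apply: hD => //; apply: hZ.
Qed.
Lemma in_span0 V (S : V -> Prop) : in_span S 0.
Proof. by exists [::]; rewrite ?big_nil. Qed.
Lemma in_span_gen V (S : V -> Prop) x : S x -> in_span S x.
Proof.
move=> Sx; exists [:: (1, x)]; last by rewrite big_seq1 scale1r.
by move=> p; rewrite inE => /eqP ->.
Qed.

Lemma tens_span V W (S : V -> Prop) (S' : W -> Prop) :
  (forall v, in_span S v) -> (forall w, in_span S' w) ->
  forall t : tens V W, in_span (fun u => exists v w, [/\ S v, S' w & u = pure v w]) t.
Proof.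
move=> hV hW t; rewrite [t]tens_repr; elim: (repr t : seq _) => [|p s IH].
  by rewrite big_nil; apply: in_span0.
rewrite big_cons -[pure _ _]scale1r; apply: in_span_lin => //.
elim/in_span_ind: (hV p.1) => [|c x y hx hy|v Sv].
- by rewrite pure0l; apply: in_span0.
- by rewrite pureLl; apply: in_span_lin.
elim/in_span_ind: (hW p.2) => [|c x y hx hy|w Sw].
- by rewrite pure0r; apply: in_span0.
- by rewrite pureLr; apply: in_span_lin.
by apply: in_span_gen; exists v, w.
Qed.

Lemma amul_linl (A : ualgType C) (y : A) : is_linear (fun x : A => x ** y).
Proof. by move=> c u v; rewrite amulDl amulZl. Qed.
Lemma amul_linr (A : ualgType C) (x : A) : is_linear (fun y : A => x ** y).
Proof. by move=> c u v; rewrite amulDr amulZr. Qed.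
Lemma amul0l (A : ualgType C) (y : A) : 0 ** y = 0.
Proof. exact: (lin0 (amul_linl y)). Qed.
Lemma amul0r (A : ualgType C) (x : A) : x ** 0 = 0.
Proof. exact: (lin0 (amul_linr x)). Qed.
Lemma amulNl (A : ualgType C) (x y : A) : (- x) ** y = - (x ** y).
Proof. by rewrite -scaleN1r amulZl scaleN1r. Qed.
Lemma amulBl (A : ualgType C) (x y z : A) : (x - y) ** z = x ** z - y ** z.
Proof. by rewrite amulDl amulNl. Qed.
Lemma amulNr (A : ualgType C) (x y : A) : x ** (- y) = - (x ** y).
Proof. by rewrite -scaleN1r amulZr scaleN1r. Qed.
Lemma amulBr (A : ualgType C) (x y z : A) : x ** (y - z) = x ** y - x ** z.
Proof. by rewrite amulDr amulNr. Qed.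
Lemma amul_suml (A : ualgType C) (J : Type) (s : seq J) (F : J -> A) y :
  (\sum_(j <- s) F j) ** y = \sum_(j <- s) F j ** y.
Proof. exact: (lin_sum _ _ _ (amul_linl y)). Qed.
Lemma amul_sumr (A : ualgType C) (J : Type) (s : seq J) (F : J -> A) x :
  x ** (\sum_(j <- s) F j) = \sum_(j <- s) x ** F j.
Proof. exact: (lin_sum _ _ _ (amul_linr x)). Qed.
Lemma pureM (A B : ualgType C) (a a' : A) (b b' : B) :
  pure a b ** pure a' b' = pure (a ** a') (b ** b').
Proof. exact: t_mul_pure. Qed.

Lemma star1 (A : staralgType C) : star (\1 : A) = \1.
Proof. by rewrite -[star \1]amul1l -{1}(starK \1) -starM amul1l starK. Qed.
Lemma star0 (A : staralgType C) : star (0 : A) = 0.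
Proof. by apply: (@addrI _ (star (0 : A))); rewrite -starD !addr0. Qed.
Lemma starN (A : staralgType C) (x : A) : star (- x) = - star x.
Proof. by apply/eqP; rewrite -addr_eq0 -starD addNr star0. Qed.

End LinearMaps.

(** * Induction over presented algebras *)

Section PresentedTheory.
Variables (C : numClosedFieldType) (G : Type).
Variable rel : forall B : staralgType C, (G -> B) -> Prop.
Notation A := (presented rel).

Lemma pres_add a b : pres rel (SAdd a b) = pres rel a + pres rel b.
Proof.
apply: pres_ext => B g r; have [[pl _ _] _] := plift_hom r.
by rewrite (linD _ _ pl) !plift_pres.
Qed.
Lemma pres_mul a b : pres rel (SMul a b) = pres rel a ** pres rel b.
Proof.
apply: pres_ext => B g r; have [[_ _ pM] _] := plift_hom r.
by rewrite pM !plift_pres.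
Qed.
Lemma pres_scale c a : pres rel (SScale c a) = c *: pres rel a.
Proof.
apply: pres_ext => B g r; have [[pl _ _] _] := plift_hom r.
by rewrite (linZ _ _ pl) !plift_pres.
Qed.
Lemma pres_opp a : pres rel (SOpp a) = - pres rel a.
Proof.
apply: pres_ext => B g r; have [[pl _ _] _] := plift_hom r.
by rewrite (linN _ pl) !plift_pres.
Qed.
Lemma pres_star a : pres rel (SStar a) = star (pres rel a).
Proof.
apply: pres_ext => B g r; have [_ ps] := plift_hom r.
by rewrite ps !plift_pres.
Qed.
Lemma pres_one : pres rel SOne = \1.
Proof.
by apply: pres_ext => B g r; have [[_ p1 _] _] := plift_hom r; rewrite plift_pres ?p1.
Qed.
Lemma pres_zero : pres rel SZero = 0.
Proof.
apply: pres_ext => B g r; have [[pl _ _] _] := plift_hom r.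
by rewrite plift_pres ?(lin0 pl).
Qed.

(** Terms may contain [SStar], so [Q] is proved for an element and its star together; the star then
    has to be handled on generators only. *)
Lemma presented_ind (Q : A -> Prop) :
  Q 0 -> Q \1 -> (forall c x y, Q x -> Q y -> Q (c *: x + y)) ->
  (forall x y, Q x -> Q y -> Q (x ** y)) ->
  (forall g, Q (pgen rel g)) -> (forall g, Q (star (pgen rel g))) ->
  forall x, Q x.
Proof.
move=> Q0 Q1 QL QM Qg Qs x; rewrite -[x]reprK.
have QZ c y : Q y -> Q (c *: y) by move=> h; rewrite -[_ *: _]addr0; apply: QL.
have QD y z : Q y -> Q z -> Q (y + z).
  by move=> hy hz; rewrite -[y]scale1r; apply: QL.
suff [] : Q (pres rel (repr x)) /\ Q (star (pres rel (repr x))) by [].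
elim: (repr x) => [g||| a [a1 a2] b [b1 b2]|a [a1 a2]|c a [a1 a2]|a [a1 a2] b [b1 b2]|a [a1 a2]].
- by split; [apply: Qg | apply: Qs].
- by rewrite pres_zero star0.
- by rewrite pres_one star1.
- by rewrite pres_add starD; split; apply: QD.
- by rewrite pres_opp starN -!scaleN1r; split; apply: QZ.
- by rewrite pres_scale starZ; split; apply: QZ.
- by rewrite pres_mul starM; split; apply: QM.
- by rewrite pres_star starK.
Qed.

End PresentedTheory.

(** * The algebra U_q(k) *)

Section QPow.
Variables (R : realType) (q : R) (q_gt0 : 0 < q).
Notation C := R[i].

Lemma qpowD a b : qpow q (a + b) = qpow q a * qpow q b.
Proof. by rewrite /qpow powRD ?rmorphM // (gt_eqF q_gt0) implybT. Qed.
Lemma qpow0 : qpow q 0 = 1.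
Proof. by rewrite /qpow powRr0 rmorph1. Qed.
Lemma qpow_neq0 a : qpow q a != 0.
Proof.
apply/negP => /eqP h; have := qpowD a (- a).
by rewrite subrr qpow0 h mul0r => /eqP; rewrite oner_eq0.
Qed.
Lemma qpowN a : qpow q (- a) = (qpow q a)^-1.
Proof.
by apply: (mulfI (qpow_neq0 a)); rewrite -qpowD subrr qpow0 mulfV // qpow_neq0.
Qed.
Lemma qpow_conj a : (qpow q a)^* = qpow q a.
Proof. exact: conjc_real. Qed.
Lemma qpowMn a n : qpow q (a *+ n) = qpow q a ^+ n.
Proof. by elim: n => [|n IH]; rewrite ?mulr0n ?qpow0 ?expr0 // mulrS qpowD IH exprS. Qed.
Lemma qpowMz a (n : int) : qpow q (a * n%:~R) = qpow q a ^ n.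
Proof.
case: n => n; first by rewrite -pmulrn mulr_natr qpowMn.
by rewrite NegzE mulrNz mulrN -pmulrn mulr_natr qpowN qpowMn.
Qed.

Hypothesis q_lt1 : q < 1.
Lemma qpow_inj : injective (qpow q).
Proof.
move=> a b /(@complexI R) h; apply/eqP; rewrite -subr_eq0.
have : q `^ (a - b) == 1.
  rewrite powRD ?(gt_eqF q_gt0) ?implybT // h -powRD ?(gt_eqF q_gt0) ?implybT //.
  by rewrite subrr powRr0.
by rewrite powR_eq1 (lt_eqF q_lt1) (lt_gtF q_gt0).
Qed.

End QPow.

Section Inner.
Variable R : realType.
Notation C := R[i].

Lemma cjK (x : C) : x^*^* = x.
Proof. exact: conjCK. Qed.

Lemma adjmxM m n p (X : 'M[C]_(m, n)) (Y : 'M_(n, p)) :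
  adjmx (X *m Y) = adjmx Y *m adjmx X.
Proof. by rewrite /adjmx trmx_mul map_mxM. Qed.
Lemma adjmxK m n (X : 'M[C]_(m, n)) : adjmx (adjmx X) = X.
Proof. by apply/matrixP => i j; rewrite !mxE cjK. Qed.
Lemma adjmxD m n (X Y : 'M[C]_(m, n)) : adjmx (X + Y) = adjmx X + adjmx Y.
Proof. by apply/matrixP => i j; rewrite !mxE rmorphD. Qed.
Lemma adjmxZ m n c (X : 'M[C]_(m, n)) : adjmx (c *: X) = c^* *: adjmx X.
Proof. by apply/matrixP => i j; rewrite !mxE rmorphM. Qed.
Lemma adjmx1 n : adjmx (1%:M : 'M[C]_n) = 1%:M.
Proof. by apply/matrixP => i j; rewrite !mxE eq_sym conjC_nat. Qed.

Lemma inner_lin n (x : 'cV[C]_n) c y z :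
  inner x (c *: y + z) = c * inner x y + inner x z.
Proof. by rewrite /inner mulmxDr -scalemxAr !mxE. Qed.
Lemma inner_conj n (x y : 'cV[C]_n) : inner y x = (inner x y)^*.
Proof.
rewrite /inner !mxE rmorph_sum; apply: eq_bigr => i _.
by rewrite !mxE rmorphM /= cjK mulrC.
Qed.
Lemma inner_adj n m (X : 'M[C]_(n, m)) x y : inner (X *m x) y = inner x (adjmx X *m y).
Proof. by rewrite /inner adjmxM mulmxA. Qed.
Lemma inner0r n (x : 'cV[C]_n) : inner x 0 = 0.
Proof. by rewrite /inner mulmx0 mxE. Qed.
Lemma inner0l n (x : 'cV[C]_n) : inner 0 x = 0.
Proof. by rewrite inner_conj inner0r rmorph0. Qed.
Lemma innerZr n c (x y : 'cV[C]_n) : inner x (c *: y) = c * inner x y.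
Proof. by have := inner_lin x c y 0; rewrite inner0r !addr0. Qed.
Lemma innerZl n c (x y : 'cV[C]_n) : inner (c *: x) y = c^* * inner x y.
Proof. by rewrite inner_conj innerZr rmorphM /= -inner_conj. Qed.
Lemma innerDr n (x y z : 'cV[C]_n) : inner x (y + z) = inner x y + inner x z.
Proof. by have := inner_lin x 1 y z; rewrite scale1r mul1r. Qed.
Lemma innerDl n (x y z : 'cV[C]_n) : inner (y + z) x = inner y x + inner z x.
Proof. by rewrite inner_conj innerDr rmorphD /= -!inner_conj. Qed.
Lemma mx_norm_eq0 m n (X : 'M[C]_(m, n)) : \tr (adjmx X *m X) = 0 -> X = 0.
Proof.
move=> h; have E : \tr (adjmx X *m X) = \sum_j \sum_i `|X i j| ^+ 2.
  apply: eq_bigr => j _; rewrite mxE; apply: eq_bigr => i _.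
  by rewrite !mxE normCKC.
move: h; rewrite E => h; apply/matrixP => i j; rewrite mxE.
have h1 := psumr_eq0P (fun j _ => sumr_ge0 _ (fun i _ => exprn_ge0 2 (normr_ge0 (X i j)))) h.
have h2 : \sum_i `|X i j| ^+ 2 = 0 by apply: h1.
have h3 : `|X i j| ^+ 2 = 0.
  by apply: (psumr_eq0P (fun i _ => exprn_ge0 2 (normr_ge0 (X i j))) h2).
by apply/eqP; move/eqP: h3; rewrite sqrf_eq0 normr_eq0.
Qed.

Lemma inner_eq0 n (x : 'cV[C]_n) : inner x x = 0 -> x = 0.
Proof. by move=> h; apply: mx_norm_eq0; rewrite /mxtrace big_ord1. Qed.

Lemma inner_delta n (x y : 'cV[C]_n) :
  inner x y = \sum_i inner x (delta_mx i 0) * inner (delta_mx i 0) y.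
Proof.
have D (z : 'cV[C]_n) i : inner (delta_mx i 0) z = z i 0.
  rewrite /inner mxE (bigD1 i) //= big1 => [|k ki]; rewrite !mxE.
    by rewrite !eqxx conjC1 mul1r addr0.
  by rewrite (negbTE ki) conjC0 mul0r.
rewrite {1}/inner mxE; apply: eq_bigr => i _.
by rewrite D (inner_conj (delta_mx i 0)) D !mxE.
Qed.

End Inner.

Section UqkTheory.
Variables (R : realType) (q : R) (L : lie_datum R).
Notation C := R[i].
Notation I := (ld_I L).
Notation P := (wlat (ld_I L)).
Notation U := (Uqk q L).
Notation K := (uK q (L := L)).
Notation E := (uE q (L := L)).
Notation F := (uF q (L := L)).

Lemma uK0 : K 0 = \1.
Proof.
rewrite -pres_one; apply: pres_ext => B g r.
by rewrite plift_gen // plift_pres //; have [-> _] := uq_K r.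
Qed.
Lemma uKM w x : K w ** K x = K (w + x).
Proof.
apply: pres_ext => B g r; have [[_ _ pM] _] := plift_hom r.
by rewrite pM !plift_gen //; have [_ ->] := uq_K r.
Qed.
Lemma uKE w r : K w ** E r = qpow q (form w (alpha r)) *: (E r ** K w).
Proof.
apply: pres_ext => B g rl; have [[pl _ pM] _] := plift_hom rl.
by rewrite (linZ _ _ pl) !pM !plift_gen // (uq_KE rl).
Qed.
Lemma uKF w r : K w ** F r = qpow q (- form w (alpha r)) *: (F r ** K w).
Proof.
apply: pres_ext => B g rl; have [[pl _ pM] _] := plift_hom rl.
by rewrite (linZ _ _ pl) !pM !plift_gen // (uq_KF rl).
Qed.
Lemma uEF r s : E r ** F s = F s ** E r +
  ((r == s)%:R / (qr q r - (qr q r)^-1)) *: (K (alpha r) - K (- alpha r)).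
Proof.
apply/eqP; rewrite addrC -subr_eq; apply/eqP.
apply: pres_ext => B g rl; have [[pl _ pM] _] := plift_hom rl.
by rewrite (linD _ _ pl) (linN _ pl) (linZ _ _ pl) (linD _ _ pl) (linN _ pl) !pM
  !plift_gen // (uq_EF rl).
Qed.
Lemma star_uK w : star (K w) = K w.
Proof.
apply: pres_ext => B g r; have [_ ps] := plift_hom r.
by rewrite ps !plift_gen // (uq_starK r).
Qed.
Lemma star_uE r : star (E r) = F r ** K (alpha r).
Proof.
apply: pres_ext => B g rl; have [[_ _ pM] ps] := plift_hom rl.
by rewrite ps pM !plift_gen // (uq_starE rl).
Qed.
Lemma star_uF r : star (F r) = K (- alpha r) ** E r.
Proof.
have -> : F r = star (E r) ** K (- alpha r).
  by rewrite star_uE -amulA uKM subrr uK0 amul1r.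
by rewrite starM star_uK starK.
Qed.

Lemma uqk_ind (Q : U -> Prop) :
  Q \1 -> (forall c x y, Q x -> Q y -> Q (c *: x + y)) ->
  (forall x y, Q x -> Q y -> Q (x ** y)) ->
  (forall w, Q (K w)) -> (forall r, Q (E r)) -> (forall r, Q (F r)) ->
  forall x, Q x.
Proof.
move=> Q1 QL QM QK QE QF; apply: presented_ind => //.
- by rewrite -(addNr \1) -scaleN1r; apply: QL.
- by case=> *; [apply: QK | apply: QE | apply: QF].
by case=> [w|r|r]; rewrite -/(K _) -/(E _) -/(F _) ?star_uK ?star_uE ?star_uF //;
  apply: QM.
Qed.

End UqkTheory.

(** * Irreducible representations *)

Section Strings.
(** In the application [e], [f], [A], [a] are E_r, F_r, K_(alpha_r), q_r, and [Q j] holds for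
    vectors of weight mu + j alpha_r, where [n] is the coordinate [mu r]. If this coordinate is
    negative, E_r and F_r change roles, j becomes -j and [n] is its absolute value. *)
Variables (C : fieldType) (d : nat) (e f A : 'M[C]_d) (Q : int -> 'cV[C]_d -> Prop).
Variables (a k : C) (b : int -> C) (n : nat).
Hypothesis a0 : a != 0.
Hypothesis aX : forall m : nat, (0 < m)%N -> a ^+ m != 1.
Hypothesis k0 : k != 0.
Hypothesis binj : injective b.
Hypothesis QA : forall j v, Q j v -> A *m v = b j *: v.
Hypothesis Qe : forall j v, Q j v -> Q (j + 1) (e *m v).
Hypothesis Qf : forall j v, Q j v -> Q (j - 1) (f *m v).
Hypothesis Qef : forall j v, Q j v -> e *m (f *m v) - f *m (e *m v) =
  (k * (a ^ (n%:Z + 2 * j) - a ^ (- (n%:Z + 2 * j)))) *: v.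

(** If no [u i] vanished, the characteristic polynomial would have more than d roots. The transpose
    appears because eigenvectors are row vectors in [eigenvalue]. *)
Lemma eigen_seq_zero (u : nat -> 'cV[C]_d) (c : nat -> C) :
  injective c -> (forall i, A *m u i = c i *: u i) -> exists i, u i = 0.
Proof.
move=> cinj h; apply/not_existsP => u0.
pose p := char_poly A^T.
have p0 : p != 0 by rewrite monic_neq0 // char_poly_monic.
have := @max_poly_roots _ p [seq c i | i <- iota 0 d.+1] p0.
rewrite map_inj_uniq // iota_uniq => /(_ _ isT).
rewrite size_map size_iota size_char_poly ltnn => /(_ _)/notF; apply.
apply/allP => _ /mapP [i _ ->]; rewrite -eigenvalue_root_char.
apply/eigenvalueP; exists (u i)^T; first by rewrite -trmx_mul h linearZ.
by apply/negP => /eqP h0; apply: (u0 i); rewrite -[u i]trmxK h0 trmx0.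
Qed.

(* Climb to a vector [u = e^m v] killed by [e]; then [e f^(j+1) u] is a nonzero
   multiple of [f^j u] as long as [j < n + 2 m]. *)
Lemma string_reflect v : Q 0 v -> v != 0 -> exists2 v', v' != 0 & Q (- n%:Z) v'.
Proof.
move=> Qv v0.
have Qei i : Q i%:Z (iter i (mulmx e) v).
  by elim: i => [|i IH] //=; rewrite -addn1 PoszD; apply: Qe.
have [i0 hi0] : exists i, iter i (mulmx e) v = 0.
  apply: (@eigen_seq_zero _ (fun i => b i)) => [x y /binj [] //|i].
  exact: QA.
have [m [um0 um1]] : exists m, iter m (mulmx e) v != 0 /\ iter m.+1 (mulmx e) v = 0.
  elim: i0 hi0 => [/= h|i IH h]; first by rewrite h eqxx in v0.
  by case: (eqVneq (iter i (mulmx e) v) 0) => [/IH //|h']; exists i.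
set u := iter m (mulmx e) v in um0; rewrite iterS -/u in um1.
pose N := (n + 2 * m)%N.
have Qfj j : Q (m%:Z - j%:Z) (iter j (mulmx f) u).
  elim: j => [|j IH] /=; first by rewrite subr0; apply: Qei.
  by rewrite -addn1 PoszD opprD addrA; apply: Qf.
pose c (j : nat) : C := k * (a ^ (N%:Z - 2 * j%:Z) - a ^ (- (N%:Z - 2 * j%:Z))).
have ef j : e *m iter j.+1 (mulmx f) u =
    (\sum_(i < j.+1) c i) *: iter j (mulmx f) u.
  elim: j => [|j IH].
    rewrite big_ord1 /=; have := Qef (Qei m); rewrite -/u um1 mulmx0 subr0 => ->.
    by rewrite /c mulr0 subr0 /N PoszD PoszM.
  have NE : n%:Z + 2 * (m%:Z - j.+1%:Z) = N%:Z - 2 * j.+1%:Z.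
    by rewrite /N PoszD PoszM mulrBr addrA.
  have := Qef (Qfj j.+1); rewrite NE; set x := iter j.+1 _ _ => /eqP.
  rewrite subr_eq => /eqP; rewrite iterS -/x => ->.
  by rewrite /x IH -scalemxAr -/(iter j.+1 _ _) -scalerDl [in RHS]big_ord_recr /= addrC.
(* The identity sum_(i <= j) [N - 2i] = [j + 1] [N - j] for q-integers, with denominators
   cleared. *)
have csum j : (a - a^-1) * (\sum_(i < j.+1) c i) =
    k * ((a ^+ j.+1 - a ^- j.+1) * (a ^ (N%:Z - j%:Z) - a ^ (- (N%:Z - j%:Z)))).
  have X (x : int) : a ^ (- x) = (a ^ x)^-1 by rewrite -invr_expz.
  have Y x y : a ^ (x + y) = a ^ x * a ^ y by apply: expfzDr.
  elim: j => [|j IH].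
    by rewrite big_ord1 /c !mulr0 !subr0 expr1 mulrCA.
  rewrite big_ord_recr /= mulrDr IH /c.
  rewrite (_ : 2 * j.+1%:Z = j%:Z + j%:Z + 1 + 1); last by rewrite intS; ring.
  rewrite (_ : j.+1%:Z = j%:Z + 1); last by rewrite intS addrC.
  rewrite !opprD !opprK !(Y, X) !expr1z !exprS -!exprnP.
  have aj : a ^+ j != 0 by rewrite expf_neq0.
  have aN : a ^+ N != 0 by rewrite expf_neq0.
  by field; rewrite ?a0 ?aj ?aN.
have nz j : (j < N)%N -> \sum_(i < j.+1) c i != 0.
  move=> jN; apply/negP => /eqP s0; have := csum j; rewrite s0 mulr0 => /esym/eqP.
  have I1 m' : (0 < m')%N -> a ^+ m' - a ^- m' != 0.
    move=> m0; rewrite subr_eq0; apply/negP => /eqP h.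
    have : a ^+ (m' + m') = 1 by rewrite exprD {2}h mulfV // expf_neq0.
    by apply/eqP/aX; rewrite addn_gt0 m0.
  rewrite !mulf_eq0 (negbTE k0) (negbTE (I1 _ _)) //=.
  by rewrite subzn 1?ltnW // -invr_expz -exprnP (negbTE (I1 _ _)) // subn_gt0.
have nzf j : (j <= N)%N -> iter j (mulmx f) u != 0.
  elim: j => [//|j IH] jN; apply/negP => /eqP h; have := ef j.
  rewrite h mulmx0 => /esym/eqP; rewrite scaler_eq0 (negbTE (nz _ jN)) /=.
  by apply/negP/IH/ltnW.
(* From index m, going down n + m steps leads to -n; this stays within the N = n + 2m steps on which
   nothing vanishes. *)
exists (iter (n + m) (mulmx f) u).
  by apply: nzf; rewrite leq_add2l leq_pmull.
have := Qfj (n + m)%N; congr (Q _ _).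
by rewrite PoszD opprD addrCA subrr addr0.
Qed.

End Strings.

(** * Weights of an irreducible representation and its lowest weight vector *)

Section Irreps.
Variables (R : realType) (q : R) (q_gt0 : 0 < q) (q_lt1 : q < 1).
Variables (L : lie_datum R).
Notation C := R[i].
Notation I := (ld_I L).
Notation P := (wlat (ld_I L)).
Notation U := (Uqk q L).
Notation K := (uK q (L := L)).
Notation E := (uE q (L := L)).
Notation F := (uF q (L := L)).

Lemma qrE (r : I) : qr q r = qpow q (form (alpha r) (alpha r) / 2).
Proof. by []. Qed.

Lemma qpow_neq1 a : a != 0 -> qpow q a != 1.
Proof.
by move=> a0; apply: contra a0 => /eqP h; apply/eqP/(qpow_inj q_gt0 q_lt1);
  rewrite h qpow0.
Qed.

Lemma qr_neq0 (r : I) : qr q r != 0 :> C.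
Proof. exact: qpow_neq0. Qed.

Lemma qr_exp_neq1 (r : I) m : (0 < m)%N -> qr q r ^+ m != 1 :> C.
Proof.
move=> m0; rewrite qrE -qpowMn // qpow_neq1 // mulrn_eq0 negb_or -lt0n m0 /=.
by rewrite mulf_neq0 ?invr_eq0 ?pnatr_eq0 // gt_eqF // alpha_gt0.
Qed.

Lemma qr_sub_neq0 (r : I) : qr q r - (qr q r)^-1 != 0 :> C.
Proof.
rewrite subr_eq0; apply/negP => /eqP h.
have : qr q r ^+ 2 = 1 :> C by rewrite expr2 {2}h mulfV // qr_neq0.
by apply/eqP/qr_exp_neq1.
Qed.

Section OneIrrep.
Variables (w : P) (V : irrep q w).
Notation H := 'cV[C]_(ir_dim V).
Notation rho := (ir_rho V).

Definition op (x : U) (v : H) : H := rho x *m v.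

Lemma op_linl v : is_linear (fun x => op x v).
Proof. by move=> c x y; rewrite /op ir_linear mulmxDl scalemxAl. Qed.
Lemma op_linr x : is_linear (op x).
Proof. by move=> c u v; rewrite /op mulmxDr scalemxAr. Qed.
Lemma op1 v : op \1 v = v.
Proof. by rewrite /op ir_one mul1mx. Qed.
Lemma opM x y v : op (x ** y) v = op x (op y v).
Proof. by rewrite /op ir_mul mulmxA. Qed.
Lemma op_adj x u v : inner (op x u) v = inner u (op (star x) v).
Proof. by rewrite inner_adj -ir_star. Qed.
Lemma op_adj' x u v : inner u (op x v) = inner (op (star x) u) v.
Proof. by rewrite op_adj starK. Qed.

Implicit Types (x : U) (y mu nu : P) (u v : H).

Lemma op0r x : op x 0 = 0. Proof. exact: lin0 (op_linr x). Qed.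
Lemma opZr x c v : op x (c *: v) = c *: op x v. Proof. exact: linZ (op_linr x). Qed.
Lemma opZl c x v : op (c *: x) v = c *: op x v. Proof. exact: (linZ _ _ (op_linl v)). Qed.
Lemma opDl x x' v : op (x + x') v = op x v + op x' v. Proof. exact: (linD _ _ (op_linl v)). Qed.
Lemma opNl x v : op (- x) v = - op x v. Proof. exact: (linN _ (op_linl v)). Qed.
Lemma has_wtK v mu y : has_wt v mu -> op (K y) v = qpow q (form y mu) *: v.
Proof. exact. Qed.
Lemma has_wt0 mu : has_wt (0 : H) mu.
Proof. by move=> y; rewrite mulmx0 scaler0. Qed.
Lemma has_wt_lin c u v mu : has_wt u mu -> has_wt v mu -> has_wt (c *: u + v) mu.
Proof.
by move=> hu hv y; rewrite mulmxDr -scalemxAr hu hv scalerDr !scalerA mulrC.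
Qed.
Lemma has_wt_sum (J : Type) (s : seq J) (Q : pred J) (f : J -> H) mu :
  (forall j, Q j -> has_wt (f j) mu) -> has_wt (\sum_(j <- s | Q j) f j) mu.
Proof.
move=> h; elim/big_rec: _ => [|j v Qj hv]; first exact: has_wt0.
by rewrite -[f j]scale1r; apply: has_wt_lin => //; apply: h.
Qed.
Lemma has_wtZ c v mu : has_wt v mu -> has_wt (c *: v) mu.
Proof. by move=> h; rewrite -[_ *: _]addr0; apply: has_wt_lin => //; apply: has_wt0. Qed.
Lemma has_wt_opK y v mu : has_wt v mu -> has_wt (op (K y) v) mu.
Proof. by move=> h; rewrite (has_wtK _ h); apply: has_wtZ. Qed.
Lemma has_wtE r v mu : has_wt v mu -> has_wt (op (E r) v) (mu + alpha r).
Proof.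
move=> h y; rewrite -/(op _ _) -opM uKE opZl opM (has_wtK _ h) opZr scalerA.
by rewrite form_addr addrC qpowD.
Qed.
Lemma has_wtF r v mu : has_wt v mu -> has_wt (op (F r) v) (mu - alpha r).
Proof.
move=> h y; rewrite -/(op _ _) -opM uKF opZl opM (has_wtK _ h) opZr scalerA.
by rewrite formBr addrC qpowD.
Qed.
Lemma has_wt_starE r v mu : has_wt v mu -> has_wt (op (star (E r)) v) (mu - alpha r).
Proof. by move=> h; rewrite star_uE opM; apply/has_wtF/has_wt_opK. Qed.
Lemma has_wt_xi : has_wt (ir_xi V) w.
Proof. by move=> y; rewrite ir_wt. Qed.

Lemma op_apowE r k v mu : has_wt v mu -> has_wt (op (apow (E r) k) v) (mu + alpha r *+ k).
Proof.
move=> h; elim: k => [|k IH] /=; first by rewrite op1 addr0.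
by rewrite opM mulrSr addrA; apply: has_wtE.
Qed.
Lemma op_apowF r k v mu : has_wt v mu -> has_wt (op (apow (F r) k) v) (mu - alpha r *+ k).
Proof.
move=> h; elim: k => [|k IH] /=; first by rewrite op1 subr0.
by rewrite opM mulrSr opprD addrA; apply: has_wtF.
Qed.

(** K_y is self-adjoint, and y = nu - mu separates the two weights: equal eigenvalues would give (y,
    y) = 0. *)
Lemma wt_orth u v mu nu : has_wt u mu -> has_wt v nu -> mu != nu -> inner u v = 0.
Proof.
move=> hu hv mn; pose y := nu - mu.
have := op_adj (K y) u v; rewrite star_uK !(has_wtK y hu, has_wtK y hv).
rewrite innerZl innerZr qpow_conj => /eqP.
rewrite -subr_eq0 -mulrBl mulf_eq0 => /orP [|/eqP //].
rewrite subr_eq0 => /eqP /(qpow_inj q_gt0 q_lt1) /eqP.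
rewrite -subr_eq0 -formBr -opprB -/y formNr oppr_eq0 => /eqP /form_eq0 /eqP.
by rewrite subr_eq0 eq_sym (negbTE mn).
Qed.

Lemma irred_op (S : H -> Prop) :
  (forall c u v, S u -> S v -> S (c *: u + v)) ->
  (forall y v, S v -> S (op (K y) v)) -> (forall r v, S v -> S (op (E r) v)) ->
  (forall r v, S v -> S (op (F r) v)) ->
  (exists2 v, v != 0 & S v) -> forall v, S v.
Proof.
move=> SL SK SE SF Sne; apply: (ir_irred SL _ Sne) => x v.
rewrite -/(op x v); elim/uqk_ind: x v => [v|c x y hx hy v|x y hx hy v|y v|r v|r v] Sv.
- by rewrite op1.
- by rewrite op_linl; apply: SL; [apply: hx | apply: hy].
- by rewrite opM; apply/hx/hy.
- exact: SK.
- exact: SE.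
- exact: SF.
Qed.

Lemma xi_neq0 : ir_xi V != 0.
Proof.
apply/eqP => h; have := ir_unit V; rewrite h inner0r => /eqP.
by rewrite eq_sym oner_eq0.
Qed.

Lemma wt_span v : in_span (fun u => exists mu, has_wt u mu) v.
Proof.
apply: irred_op v.
- by move=> c u v; apply: in_span_lin.
- move=> y v; elim/in_span_ind => [|c u u' hu hu'|u [mu hu]].
  + by rewrite op0r; apply: in_span0.
  + by rewrite op_linr; apply: in_span_lin.
  + by apply: in_span_gen; exists mu; apply: has_wt_opK.
- move=> r v; elim/in_span_ind => [|c u u' hu hu'|u [mu hu]].
  + by rewrite op0r; apply: in_span0.
  + by rewrite op_linr; apply: in_span_lin.
  + by apply: in_span_gen; exists (mu + alpha r); apply: has_wtE.
- move=> r v; elim/in_span_ind => [|c u u' hu hu'|u [mu hu]].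
  + by rewrite op0r; apply: in_span0.
  + by rewrite op_linr; apply: in_span_lin.
  + by apply: in_span_gen; exists (mu - alpha r); apply: has_wtF.
exists (ir_xi V); first exact: xi_neq0.
by apply: in_span_gen; exists w; apply: has_wt_xi.
Qed.

Definition Fmon (s : seq I) : H := foldr (fun r => op (F r)) (ir_xi V) s.

Lemma has_wt_Fmon s : has_wt (Fmon s) (w - \sum_(r <- s) alpha r).
Proof.
elim: s => [|r s IH] /=; first by rewrite big_nil subr0; apply: has_wt_xi.
by rewrite big_cons opprD addrCA addrC; apply: has_wtF.
Qed.

(** By irreducibility it is enough that the span is stable. An E_r is moved to the right past the
    F's until it reaches the highest weight vector and kills it. *)
Lemma Fmon_span v : in_span (fun u => exists s, u = Fmon s) v.
Proof.
have gen s : in_span (fun u => exists s, u = Fmon s) (Fmon s).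
  by apply: in_span_gen; exists s.
have genZ c s : in_span (fun u => exists s, u = Fmon s) (c *: Fmon s).
  by rewrite -[_ *: _]addr0; apply: in_span_lin => //; apply: in_span0.
apply: irred_op v.
- by move=> c u v; apply: in_span_lin.
- move=> y v; elim/in_span_ind => [|c u u' hu hu'|_ [s ->]].
  + by rewrite op0r; apply: in_span0.
  + by rewrite op_linr; apply: in_span_lin.
  + by rewrite (has_wtK _ (has_wt_Fmon s)).
- move=> r v; elim/in_span_ind => [|c u u' hu hu'|_ [s ->]].
  + by rewrite op0r; apply: in_span0.
  + by rewrite op_linr; apply: in_span_lin.
  elim: s => [|i s IH] /=.
    by rewrite /op ir_high; apply: in_span0.
  rewrite -opM uEF opDl addrC opZl opDl opNl opM; apply: in_span_lin.
    rewrite !(has_wtK _ (has_wt_Fmon s)) -scaleN1r addrC.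
    by apply: in_span_lin => //.
  elim/in_span_ind: IH => [|c u u' hu hu'|_ [s' ->]].
  + by rewrite op0r; apply: in_span0.
  + by rewrite op_linr; apply: in_span_lin.
  + exact: (gen (i :: s')).
- move=> r v; elim/in_span_ind => [|c u u' hu hu'|_ [s ->]].
  + by rewrite op0r; apply: in_span0.
  + by rewrite op_linr; apply: in_span_lin.
  + exact: (gen (r :: s)).
by exists (ir_xi V); [apply: xi_neq0 | apply: (gen [::])].
Qed.

(** A vector of greater height would be orthogonal to every monomial in the F's applied to the
    highest weight vector, hence to itself. *)
Lemma wt_bound v mu : has_wt v mu -> v != 0 -> form (wrho L) mu <= form (wrho L) w.
Proof.
move=> hv v0; case: (lerP (form (wrho L) mu) (form (wrho L) w)) => // h.
case/eqP: v0; apply: inner_eq0.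
elim/in_span_ind: {2}v / (Fmon_span v) => [|c x y hx hy|_ [s ->]].
- by rewrite inner0r.
- by rewrite inner_lin hx hy mulr0 addr0.
apply: (wt_orth hv (has_wt_Fmon s)); apply/eqP => muE.
move: h; rewrite muE formBr ltNge gerBl => /negP; apply.
elim: s {muE} => [|r s IH]; first by rewrite big_nil form0r.
by rewrite big_cons form_addr addr_ge0 // ltW // wrho_pos // ld_simple.
Qed.

Lemma form_alpha_string mu r (j : int) :
  form (alpha r) (mu + alpha r *~ j) =
  form (alpha r) (alpha r) / 2 * (mu r + 2 * j)%:~R.
Proof.
rewrite form_addr form_mulrzr (form_sym _ mu) form_coroot rmorphD rmorphM /=.
by field.
Qed.

Lemma op_comm r v mu j : has_wt v (mu + alpha r *~ j) ->
  op (E r) (op (F r) v) - op (F r) (op (E r) v) =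
  ((qr q r - (qr q r)^-1)^-1 *
   (qr q r ^ (mu r + 2 * j) - qr q r ^ (- (mu r + 2 * j)))) *: v.
Proof.
move=> h; rewrite -!opM uEF opDl addrC addKr eqxx mul1r opZl opDl opNl.
rewrite !(has_wtK _ h) formNl form_alpha_string -scalerBl scalerA.
by rewrite qrE -!qpowMz // rmorphN /= mulrN.
Qed.

(** [string_reflect] starts at a nonnegative coordinate, so for negative [mu r] it is applied with
    E_r and F_r exchanged and the string reversed. *)
Lemma wt_srefl v mu r : has_wt v mu -> v != 0 ->
  exists2 v' : H, v' != 0 & has_wt v' (srefl L r mu).
Proof.
move=> hv v0; have aa := alpha_gt0 r.
have inj : injective (fun j : int => qpow q (form (alpha r) (mu + alpha r *~ j))).
  move=> i j /(qpow_inj q_gt0 q_lt1); rewrite !form_addr => /addrI.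
  by rewrite !form_mulrzr => /(mulIf (lt0r_neq0 aa)) /intr_inj.
have kap : (qr q r - (qr q r)^-1)^-1 != 0 by rewrite invr_eq0 qr_sub_neq0.
have up (j : int) : mu + alpha r *~ j + alpha r = mu + alpha r *~ (j + 1).
  by rewrite mulrzDr addrA.
have down (j : int) : mu + alpha r *~ j - alpha r = mu + alpha r *~ (j - 1).
  by rewrite mulrzBr addrA.
have nege (m : nat) := @qr_exp_neq1 r m.
case rE: (mu r) => [n|n].
  pose Q (j : int) (u : H) := has_wt u (mu + alpha r *~ j).
  have QK j u : Q j u -> rho (K (alpha r)) *m u =
      qpow q (form (alpha r) (mu + alpha r *~ j)) *: u by move=> hu; apply: has_wtK.
  have QE j u : Q j u -> Q (j + 1) (rho (E r) *m u).
    by move=> hu; rewrite /Q -up; apply: has_wtE.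
  have QF j u : Q j u -> Q (j - 1) (rho (F r) *m u).
    by move=> hu; rewrite /Q -down; apply: has_wtF.
  have QEF j u (hu : Q j u) := op_comm hu; rewrite rE in QEF.
  have Q0 : Q 0 v by rewrite /Q mulr0z addr0.
  have [v' v'0 hv'] :=
    string_reflect (qr_neq0 r) nege kap inj QK QE QF QEF Q0 v0.
  by exists v' => //; rewrite /srefl rE -mulrNz.
pose Q (j : int) (u : H) := has_wt u (mu + alpha r *~ (- j)).
have QK j u : Q j u -> rho (K (alpha r)) *m u =
    qpow q (form (alpha r) (mu + alpha r *~ (- j))) *: u by move=> hu; apply: has_wtK.
have QE j u : Q j u -> Q (j + 1) (rho (F r) *m u).
  by move=> hu; rewrite /Q opprD -down; apply: has_wtF.
have QF j u : Q j u -> Q (j - 1) (rho (E r) *m u).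
  by move=> hu; rewrite /Q opprB [1 - j]addrC -up; apply: has_wtE.
have QEF j u : Q j u -> rho (F r) *m (rho (E r) *m u) - rho (E r) *m (rho (F r) *m u) =
    ((qr q r - (qr q r)^-1)^-1 *
     (qr q r ^ (n.+1%:Z + 2 * j) - qr q r ^ (- (n.+1%:Z + 2 * j)))) *: u.
  move=> hu; rewrite -opprB [X in - X](op_comm hu) -scaleNr -mulrN opprB rE NegzE.
  by congr ((_ * (_ ^ _ - _ ^ _)) *: _); rewrite mulrN !opprD ?opprK.
have Q0 : Q 0 v by rewrite /Q mulr0z addr0.
have inj' : injective (fun j : int => qpow q (form (alpha r) (mu + alpha r *~ (- j)))).
  by move=> i j /inj /oppr_inj.
have [v' v'0 hv'] :=
  string_reflect (qr_neq0 r) nege kap inj' QK QE QF QEF Q0 v0.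
by exists v' => //; rewrite /srefl rE -mulrNz NegzE.
Qed.

Lemma wt_wact s v mu : has_wt v mu -> v != 0 ->
  exists2 v' : H, v' != 0 & has_wt v' (wact L s mu).
Proof.
move=> hv v0; elim: s => [|r s [v' v'0 hv']]; first by exists v.
exact: wt_srefl hv' v'0.
Qed.

Lemma has_wt_lusztig r v mu : has_wt v mu -> has_wt (lusztig r mu v) (srefl L r mu).
Proof.
move=> hv; rewrite /lusztig; apply: has_wt_sum => a _; apply: has_wt_sum => b _.
apply: has_wt_sum => c /eqP h; apply: has_wtZ; rewrite -/(op _ _) !opM.
have := op_apowE r a (op_apowF r b (op_apowE r c hv)); congr has_wt.
rewrite /srefl -h !mulrzDr !mulrNz -!pmulrn !opprD !opprK.
move: (alpha r *+ a) (alpha r *+ b) (alpha r *+ c) => x y z.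
by apply/ffunP => i; rewrite !ffunE; ring.
Qed.

Lemma has_wt_lusztig_word s : has_wt (lusztig_word V s) (wact L s w).
Proof. by elim: s => [|r s IH] /=; [apply: has_wt_xi | apply: has_wt_lusztig]. Qed.

Section Lowest.
Variables (w0 : seq I) (w0_longest : longest_word w0).
Notation eta := (low_vec V w0).

Lemma has_wt_low : has_wt eta (wact L w0 w).
Proof. exact/has_wtZ/has_wt_lusztig_word. Qed.

(* By Weyl group symmetry, [w0 w - alpha r] is a weight only if
   [w - w0 (alpha r)], which is higher than [w], is one. *)
Lemma low_F r : op (F r) eta = 0.
Proof.
have hF := has_wtF r has_wt_low; apply/eqP/negPn/negP => /(wt_wact w0 hF) [v' v'0].
rewrite wact_add wactN longestK // => /wt_bound -/(_ v'0).
rewrite form_addr gerDl leNgt wrho_pos //.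
exact: longest_pos (ld_simple r).
Qed.

End Lowest.
End OneIrrep.
End Irreps.

(** * Lowest weight modules *)

Section LowestWeightModules.
Variables (R : realType) (q : R) (q_gt0 : 0 < q) (L : lie_datum R).
Notation C := R[i].
Notation I := (ld_I L).
Notation P := (wlat (ld_I L)).

(** Operators on a space without reference to U_q(k), so that both an irreducible representation and
    a Hom space fit. [lw_adj] encodes that the adjoint of E_r is F_r K_(alpha_r); of positivity only
    the definiteness [lw_def] is retained. *)
Record lw_module (V : lmodType C) (E F : I -> V -> V) (K : P -> V -> V)
    (h : V -> V -> C) (chi : P -> C) (v : V) : Prop := {
  lw_E : forall r, is_linear (E r);
  lw_F : forall r, is_linear (F r);
  lw_K : forall y, is_linear (K y);
  lw_KE : forall y r x, K y (E r x) = qpow q (form y (alpha r)) *: E r (K y x);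
  lw_EF : forall r s x, E r (F s x) - F s (E r x) =
    ((r == s)%:R / (qr q r - (qr q r)^-1)) *: (K (alpha r) x - K (- alpha r) x);
  lw_Fv : forall r, F r v = 0;
  lw_Kv : forall y, K y v = chi y *: v;
  lw_lin : forall x c y z, h x (c *: y + z) = c * h x y + h x z;
  lw_conj : forall x y, h y x = (h x y)^*;
  lw_def : forall x, h x x = 0 -> x = 0;
  lw_adj : forall r x y, h (E r x) y = h x (F r (K (alpha r) y)) }.

Definition lw_mon (V : Type) (E : I -> V -> V) (v : V) (s : seq I) : V :=
  foldr E v s.

Lemma lw_K_mon V E F K h chi v (M : @lw_module V E F K h chi v) y s :
  K y (lw_mon E v s) =
  (qpow q (form y (\sum_(r <- s) alpha r)) * chi y) *: lw_mon E v s.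
Proof.
elim: s => [|r s IH] /=.
  by rewrite big_nil form0r qpow0 mul1r (lw_Kv M).
rewrite (lw_KE M) IH (linZ _ _ (lw_E M r)) scalerA mulrA -qpowD //.
by rewrite big_cons form_addr.
Qed.

Section Comparison.
Variables (V H : lmodType C).
Variables (E : I -> V -> V) (F : I -> V -> V) (K : P -> V -> V) (h : V -> V -> C) (v : V).
Variables (e : I -> H -> H) (f : I -> H -> H) (k : P -> H -> H) (g : H -> H -> C) (u : H).
Variable (chi : P -> C).
Hypothesis (MV : lw_module E F K h chi v) (MH : lw_module e f k g chi u).
Hypothesis v0 : v != 0.

(* The submodule of [V x H] generated by [(v, u)] *)
Definition lw_graph (x : V) (y : H) : Prop :=
  exists2 s : seq (C * seq I), x = \sum_(p <- s) p.1 *: lw_mon E v p.2 &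
    y = \sum_(p <- s) p.1 *: lw_mon e u p.2.

Lemma lw_graph_lin c x y x' y' : lw_graph x y -> lw_graph x' y' ->
  lw_graph (c *: x + x') (c *: y + y').
Proof.
move=> [s -> ->] [t -> ->]; exists ([seq (c * p.1, p.2) | p <- s] ++ t);
  by rewrite big_cat big_map scaler_sumr; congr (_ + _);
  apply: eq_bigr => p _; rewrite scalerA.
Qed.
Lemma lw_graph0 : lw_graph 0 0.
Proof. by exists [::]; rewrite big_nil. Qed.
Lemma lw_graphZ c x y : lw_graph x y -> lw_graph (c *: x) (c *: y).
Proof. by move=> h'; rewrite -[c *: x]addr0 -[c *: y]addr0; apply/lw_graph_lin/lw_graph0. Qed.
Lemma lw_graph_mon s : lw_graph (lw_mon E v s) (lw_mon e u s).
Proof. by exists [:: (1, s)]; rewrite big_seq1 scale1r. Qed.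

Lemma lw_graph_ind (Q : V -> H -> Prop) : Q 0 0 ->
  (forall c x y x' y', Q x y -> Q x' y' -> Q (c *: x + x') (c *: y + y')) ->
  (forall s, Q (lw_mon E v s) (lw_mon e u s)) ->
  forall x y, lw_graph x y -> Q x y.
Proof.
move=> Q0 QL Qm x y [s -> ->]; elim: s => [|p s IH]; first by rewrite !big_nil.
by rewrite !big_cons; apply: QL.
Qed.

Lemma lw_graph_map (A : V -> V) (B : H -> H) : is_linear A -> is_linear B ->
  (forall s, lw_graph (A (lw_mon E v s)) (B (lw_mon e u s))) ->
  forall x y, lw_graph x y -> lw_graph (A x) (B y).
Proof.
move=> lA lB h0; apply: lw_graph_ind => [|c x y x' y' h1 h2|//].
  by rewrite !lin0 //; apply: lw_graph0.
by rewrite lA lB; apply: lw_graph_lin.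
Qed.

Lemma lw_graphE r x y : lw_graph x y -> lw_graph (E r x) (e r y).
Proof.
apply: lw_graph_map; [exact: (lw_E MV) | exact: (lw_E MH)|move=> s].
exact: (lw_graph_mon (r :: s)).
Qed.
Lemma lw_graphK w x y : lw_graph x y -> lw_graph (K w x) (k w y).
Proof.
apply: lw_graph_map; [exact: (lw_K MV) | exact: (lw_K MH)|move=> s].
by rewrite (lw_K_mon MV) (lw_K_mon MH); apply/lw_graphZ/lw_graph_mon.
Qed.
(** Moving F_r to the right past the E's leaves commutators in the K's, which act by the same
    scalars on both sides because [v] and [u] share the lowest weight [chi]. *)
Lemma lw_graphF r x y : lw_graph x y -> lw_graph (F r x) (f r y).
Proof.
apply: lw_graph_map; [exact: (lw_F MV) | exact: (lw_F MH)|elim=> [|i s IH] /=].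
  by rewrite (lw_Fv MV) (lw_Fv MH); apply: lw_graph0.
have := lw_EF MV i r (lw_mon E v s); have := lw_EF MH i r (lw_mon e u s).
have sub a b c : a - b = c -> b = (-1) *: c + a :> H.
  by move=> <-; rewrite scaleN1r opprB subrK.
have sub' a b c : a - b = c -> b = (-1) *: c + a :> V.
  by move=> <-; rewrite scaleN1r opprB subrK.
move=> /sub -> /sub' ->.
have gK w := lw_graphK w (lw_graph_mon s).
apply: lw_graph_lin; last exact: lw_graphE.
apply: lw_graphZ; rewrite addrC -scaleN1r [X in lw_graph _ X]addrC -scaleN1r.
exact: lw_graph_lin.
Qed.

Lemma lw_h0 (W : lmodType C) E' F' K' h' v' :
  @lw_module W E' F' K' h' chi v' -> forall x, h' x 0 = 0.
Proof. by move=> M x; have := lw_lin M x (-1) 0 0; rewrite scaler0 addr0 mulN1r addNr. Qed.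

Lemma lw_pair (W : lmodType C) E' F' K' h' v' :
  @lw_module W E' F' K' h' chi v' -> forall r s, h' v' (lw_mon E' v' (r :: s)) = 0.
Proof.
move=> M r s /=; rewrite (lw_conj M) (lw_adj M) (lw_Kv M) (linZ _ _ (lw_F M r)).
by rewrite (lw_Fv M) scaler0 (lw_h0 M) conjC0.
Qed.

(* Both sides read off the coefficient of the empty monomial. *)
Lemma lw_graph_pair x y : lw_graph x y -> h v x * g u u = g u y * h v v.
Proof.
move: x y; apply: lw_graph_ind => [|c x y x' y' h1 h2|[|r s]].
- by rewrite (lw_h0 MV) (lw_h0 MH) !mul0r.
- by rewrite (lw_lin MV) (lw_lin MH) !mulrDl -!mulrA h1 h2.
- exact: mulrC.
- by rewrite (lw_pair MV) (lw_pair MH) !mul0r.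
Qed.

(** If (0, y) lies in the submodule, then so do the pairs obtained by moving the E's of a monomial
    across the form. Hence each pairing of [y] with a monomial reduces to one with [u], which
    vanishes by [lw_graph_pair] since [h v v] is nonzero. As [y] is a combination of monomials, it
    is orthogonal to itself. *)
Lemma lw_graph_fun y : lw_graph 0 y -> y = 0.
Proof.
move=> Gy; have orth s y' : lw_graph 0 y' -> g (lw_mon e u s) y' = 0.
  elim: s y' => [|r s IH] y' Gy' /=.
    have := lw_graph_pair Gy'; rewrite (lw_h0 MV) mul0r => /esym/eqP.
    rewrite mulf_eq0 => /orP [/eqP //|/eqP /(lw_def MV) vv].
    by have := v0; rewrite vv eqxx.
  rewrite (lw_adj MH); apply: IH; rewrite -(lin0 (lw_F MV r)).
  apply: lw_graphF; rewrite -(lin0 (lw_K MV (alpha r))).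
  exact: lw_graphK.
apply: (lw_def MH); have [s _ yE] := Gy; rewrite {2}yE.
elim: s {yE} => [|p s IH]; first by rewrite big_nil (lw_h0 MH).
by rewrite big_cons (lw_lin MH) IH (lw_conj MH) orth // conjC0 mulr0 addr0.
Qed.

Hypothesis total : forall x, exists y, lw_graph x y.

Lemma lw_intertwiner : exists Phi : V -> H,
  [/\ is_linear Phi, Phi v = u, forall r x, Phi (E r x) = e r (Phi x),
      forall r x, Phi (F r x) = f r (Phi x) & forall w x, Phi (K w x) = k w (Phi x)].
Proof.
have [Phi hPhi] := choice total.
have uni x y : lw_graph x y -> Phi x = y.
  move=> hy; have := lw_graph_lin (-1) (hPhi x) hy.
  rewrite !scaleN1r !addNr => /lw_graph_fun /eqP.
  by rewrite addrC subr_eq0 => /eqP.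
exists Phi; split.
- by move=> c x y; apply/uni/lw_graph_lin.
- exact: (uni _ _ (lw_graph_mon [::])).
- by move=> r x; apply/uni/lw_graphE.
- by move=> r x; apply/uni/lw_graphF.
- by move=> w x; apply/uni/lw_graphK.
Qed.

End Comparison.
End LowestWeightModules.

(** * Commutation of b_w with Pol_q(K) *)

Section Slices.
Variable R : realType.
Notation C := R[i].
Variables m n : nat.

(* The map [w |-> v (x) w] from C^n to C^m (x) C^n *)
Definition slice (v : 'cV[C]_m) : 'M[C]_(m * n, n) :=
  \matrix_(i, j) (v (mxtens_unindex i).1 0 * ((mxtens_unindex i).2 == j)%:R).

Lemma sum_mxtens (F : 'I_(m * n) -> C) :
  \sum_k F k = \sum_i \sum_j F (mxtens_index (i, j)).
Proof.
rewrite pair_bigA (reindex (@mxtens_index m n)) /=.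
  by apply: eq_bigr => -[i j].
exists (@mxtens_unindex m n) => k _; [exact: mxtens_indexK | exact: mxtens_unindexK].
Qed.

Lemma slice_linear : is_linear slice.
Proof.
move=> c v w; apply/matrixP => i j; rewrite !mxE.
by rewrite mulrDl mulrA.
Qed.

Lemma tensmx_slice (X : 'M[C]_m) (Y : 'M_n) v :
  (X *t Y) *m slice v = slice (X *m v) *m Y.
Proof.
apply/matrixP => i j; case: (mxtens_indexP i) => i1 i2; rewrite !mxE sum_mxtens.
have E1 (k1 : 'I_m) (k2 : 'I_n) : (X *t Y) (mxtens_index (i1, i2)) (mxtens_index (k1, k2)) *
    slice v (mxtens_index (k1, k2)) j = X i1 k1 * Y i2 k2 * (v k1 0 * (k2 == j)%:R).
  by rewrite tensmxE !mxE mxtens_indexK.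
under eq_bigr do under eq_bigr do rewrite E1.
rewrite (bigD1 i2) //= [X in _ = _ + X]big1 => [|k /negbTE ki].
  rewrite !mxE mxtens_indexK /= eqxx mulr1 addr0 mulr_suml.
  apply: eq_bigr => k _.
  rewrite (bigD1 j) //= big1 => [|l /negbTE lj]; last by rewrite lj !mulr0.
  by rewrite eqxx addr0 mulr1 mulrAC.
by rewrite !mxE mxtens_indexK /= eq_sym ki mulr0 mul0r.
Qed.

Lemma slice_inner z v : adjmx (slice z) *m slice v = (inner z v)%:M.
Proof.
apply/matrixP => i j; rewrite !mxE sum_mxtens /inner mxE.
have E1 (k1 : 'I_m) (k2 : 'I_n) :
    adjmx (slice z) i (mxtens_index (k1, k2)) * slice v (mxtens_index (k1, k2)) j =
    (z k1 0 * (k2 == i)%:R)^* * (v k1 0 * (k2 == j)%:R).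
  by rewrite !mxE mxtens_indexK.
under eq_bigr do under eq_bigr do rewrite E1.
rewrite -sumrMnl; apply: eq_bigr => k _.
rewrite (bigD1 j) //= big1 => [|l /negbTE lj]; last by rewrite lj !mulr0.
rewrite eqxx addr0 mulr1 !mxE rmorphM /= conjC_nat eq_sym.
by rewrite mulrAC mulr_natr.
Qed.

Lemma adjmx_tens (X : 'M[C]_m) (Y : 'M[C]_n) : adjmx (X *t Y) = adjmx X *t adjmx Y.
Proof. by rewrite /adjmx trmx_tens map_mxT. Qed.

Lemma slice_adj_tens z (X : 'M[C]_m) (Y : 'M_n) :
  adjmx (slice z) *m (X *t Y) = Y *m adjmx (slice (adjmx X *m z)).
Proof.
rewrite -[X *t Y]adjmxK -adjmxM adjmx_tens tensmx_slice adjmxM adjmxK //.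
Qed.

End Slices.

(** The additive bookkeeping that ends [homEF]: the terms mixing both multiplications cancel in
    pairs. *)
Lemma comm_cancel (Z : zmodType) (a b t x y z : Z) :
  a + x - b - (t - y) - (a - t - (b - (y + z))) = x - z.
Proof.
have -> : a + x - b - (t - y) = x + (a - t - b + y).
  by rewrite opprB !addrA (addrC x) addrAC; congr (_ + _); apply: addrAC.
have -> : a - t - (b - (y + z)) = a - t - b + y + z.
  by rewrite opprB !addrA addrAC; congr (_ + _); apply: addrAC.
by rewrite opprD addrA addrK.
Qed.

(* [Hom(W, Y)] for representations [W] and [Y], seen as a [Y]-[W]-bimodule [H] in
   which [l] and [r] are the left and right multiplications.  The operators below
   are [(X phi)(w) = X_(2) phi(S^-1(X_(1)) w)], the action for which
   [Hom(V, Hom(W, Y)) = Hom(W (x) V, Y)]. *)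
Section HomModule.
Variables (R : realType) (q : R) (q_gt0 : 0 < q) (L : lie_datum R).
Notation C := R[i].
Notation I := (ld_I L).
Notation P := (wlat (ld_I L)).
Notation gK := (@gK R L). Notation gE := (@gE R L). Notation gF := (@gF R L).
Variables (H : lmodType C) (l r : uq_gen L -> H -> H).
Notation cst i j := ((i == j)%:R / (qr q i - (qr q i)^-1)).

(** [l] satisfies the relations of U_q(k) and [r] the opposite ones, because right multiplications
    compose in reverse order. *)
Record bimod : Prop := {
  bl : forall x, is_linear (l x);
  br : forall x, is_linear (r x);
  blr : forall x y v, l x (r y v) = r y (l x v);
  blK : forall x y v, l (gK x) (l (gK y) v) = l (gK (x + y)) v;
  blKE : forall x i v,
    l (gK x) (l (gE i) v) = qpow q (form x (alpha i)) *: l (gE i) (l (gK x) v);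
  blKF : forall x i v,
    l (gK x) (l (gF i) v) = qpow q (- form x (alpha i)) *: l (gF i) (l (gK x) v);
  blEF : forall i j v, l (gE i) (l (gF j) v) = l (gF j) (l (gE i) v) +
    cst i j *: (l (gK (alpha i)) v - l (gK (- alpha i)) v);
  brK : forall x y v, r (gK x) (r (gK y) v) = r (gK (x + y)) v;
  brKE : forall x i v,
    r (gK x) (r (gE i) v) = qpow q (- form x (alpha i)) *: r (gE i) (r (gK x) v);
  brKF : forall x i v,
    r (gK x) (r (gF i) v) = qpow q (form x (alpha i)) *: r (gF i) (r (gK x) v);
  brEF : forall i j v, r (gF j) (r (gE i) v) = r (gE i) (r (gF j) v) +
    cst i j *: (r (gK (alpha i)) v - r (gK (- alpha i)) v) }.

Hypothesis B : bimod.

Definition homE i (v : H) : H :=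
  l (gE i) v - r (gE i) (r (gK (- alpha i)) (l (gK (alpha i)) v)).
Definition homF i (v : H) : H := r (gK (alpha i)) (l (gF i) v - r (gF i) v).
Definition homK x (v : H) : H := r (gK (- x)) (l (gK x) v).

Lemma homE_linear i : is_linear (homE i).
Proof.
move=> c x y; rewrite /homE !(bl B, br B).
by rewrite opprD addrACA -scalerBr.
Qed.
Lemma homF_linear i : is_linear (homF i).
Proof.
move=> c x y; rewrite /homF -(br B); congr (r _ _).
by rewrite (bl B) (br B) opprD addrACA -scalerBr.
Qed.
Lemma homK_linear x : is_linear (homK x).
Proof. by move=> c u v; rewrite /homK !(bl B, br B). Qed.

Lemma lsub x u v : l x (u - v) = l x u - l x v.
Proof. by rewrite (linD _ _ (bl B x)) (linN _ (bl B x)). Qed.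
Lemma rsub x u v : r x (u - v) = r x u - r x v.
Proof. by rewrite (linD _ _ (br B x)) (linN _ (br B x)). Qed.
Lemma rZ x c v : r x (c *: v) = c *: r x v.
Proof. exact: linZ (br B x). Qed.
Lemma rD x u v : r x (u + v) = r x u + r x v.
Proof. exact: linD (br B x). Qed.

Lemma homKE x i v : homK x (homE i v) = qpow q (form x (alpha i)) *: homE i (homK x v).
Proof.
rewrite /homK /homE lsub rsub (blKE B) rZ scalerBr; congr (_ *: _ - _).
  by rewrite (blr B).
rewrite !(blr B) !(blK B) (brKE B) !(brK B) formNl opprK.
by rewrite (addrC x) (addrC (- x)).
Qed.

Lemma homEF i j v : homE i (homF j v) - homF j (homE i v) =
  cst i j *: (homK (alpha i) v - homK (- alpha i) v).
Proof.
rewrite /homE /homF /homK; do 3!rewrite ?lsub ?rsub ?(blr B).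
rewrite (blEF B) rD rZ rsub.
set X := l (gK (alpha i)) v; set X' := l (gK (- alpha i)) v.
have -> : r (gE i) (r (gK (- alpha i)) (r (gK (alpha j)) (l (gK (alpha i)) (l (gF j) v)))) =
    r (gK (alpha j)) (r (gE i) (r (gK (- alpha i)) (l (gF j) X))).
  rewrite (blKF B) !rZ (brKE B) !(brK B) (form_sym (alpha j)).
  by rewrite (addrC (alpha j)).
have -> : r (gK (alpha j)) (r (gF j) (r (gE i) (r (gK (- alpha i)) X))) =
    r (gE i) (r (gK (- alpha i)) (r (gK (alpha j)) (r (gF j) X))) +
    cst i j *: (r (gK (alpha j)) X - r (gK (alpha j + (- alpha i - alpha i))) X).
  rewrite (brEF B) rD rZ rsub !(brK B) addrK -addrA; congr (_ + _).
  rewrite (brKE B) !(brKF B) !rZ scalerA -qpowD // (brK B).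
  by rewrite form_add formNl (form_sym (alpha j) (alpha i)) [- alpha i + _]addrC
    [- form _ _ + _]addrC.
(* For i = j one has alpha_j - 2 alpha_i = - alpha_i, and the term in K_(alpha_j) shared by the left
   and the right commutator cancels; for distinct i and j the constant is 0. *)
have -> : cst i j *: (r (gK (- alpha i)) X - r (gK (- - alpha i)) X') =
    cst i j *: (r (gK (alpha j)) X - r (gK (alpha j)) X') -
    cst i j *: (r (gK (alpha j)) X - r (gK (alpha j + (- alpha i - alpha i))) X).
  case: eqP => [<-|_]; last by rewrite mul0r !scale0r subr0.
  rewrite addrA subrr add0r opprK -scalerBr; congr (_ *: _).
  by rewrite opprB [RHS]addrC addrA subrK.
exact: comm_cancel.
Qed.

End HomModule.

(** * Hom(W, Y) for unitary representations, and its contravariant form *)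

Section HomRep.
Variables (R : realType) (q : R) (q_gt0 : 0 < q) (L : lie_datum R).
Notation C := R[i].
Notation I := (ld_I L).
Notation P := (wlat (ld_I L)).
Notation U := (Uqk q L).
Notation K := (uK q (L := L)).
Notation E := (uE q (L := L)).
Notation F := (uF q (L := L)).

(* [ur_star] is only needed on [K] and [E], where it is easily checked on a
   tensor product. *)
Record unitary_rep d (rho : U -> 'M[C]_d) : Prop := {
  ur_lin : is_linear rho;
  ur_one : rho \1 = 1%:M;
  ur_mul : forall x y, rho (x ** y) = rho x *m rho y;
  ur_K : forall w, adjmx (rho (K w)) = rho (K w);
  ur_E : forall r, adjmx (rho (E r)) = rho (F r) *m rho (K (alpha r)) }.

Lemma irrep_unitary w (V : irrep q w) : unitary_rep (ir_rho V).
Proof.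
split; [exact: ir_linear | exact: ir_one | exact: ir_mul | move=> y|move=> r].
  by rewrite -ir_star star_uK.
by rewrite -ir_star star_uE ir_mul.
Qed.

Variables (m n : nat) (rY : U -> 'M[C]_m) (rW : U -> 'M[C]_n).
Hypotheses (Y : unitary_rep rY) (W : unitary_rep rW).
Notation H := 'M[C]_(m, n).

Definition lmult (g : uq_gen L) (v : H) : H := rY (pgen (@uqk_rel R q L) g) *m v.
Definition rmult (g : uq_gen L) (v : H) : H := v *m rW (pgen (@uqk_rel R q L) g).

Lemma lmultM (x y : U) (v : H) : rY x *m (rY y *m v) = rY (x ** y) *m v.
Proof. by rewrite mulmxA (ur_mul Y). Qed.
Lemma rmultM (x y : U) (v : H) : (v *m rW y) *m rW x = v *m rW (y ** x).
Proof. by rewrite -mulmxA (ur_mul W). Qed.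

Lemma uKE' x i : E i ** K x = qpow q (- form x (alpha i)) *: (K x ** E i).
Proof. by rewrite uKE scalerA -qpowD // addNr qpow0 scale1r. Qed.
Lemma uKF' x i : F i ** K x = qpow q (form x (alpha i)) *: (K x ** F i).
Proof. by rewrite uKF scalerA -qpowD // subrr qpow0 scale1r. Qed.

Lemma hom_bimod : bimod q lmult rmult.
Proof.
have lY := ur_lin Y; have lW := ur_lin W.
split; rewrite /lmult /rmult.
- by move=> g c x y; rewrite mulmxDr scalemxAr.
- by move=> g c x y; rewrite mulmxDl scalemxAl.
- by move=> g g' v; rewrite mulmxA.
- by move=> x y v; rewrite lmultM -/(K _) -/(K _) uKM.
- by move=> x i v; rewrite !lmultM -/(K _) -/(E _) uKE (linZ _ _ lY) scalemxAl.
- by move=> x i v; rewrite !lmultM -/(K _) -/(F _) uKF (linZ _ _ lY) scalemxAl.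
- move=> i j v; rewrite !lmultM -/(E _) -/(F _) uEF (linD _ _ lY) (linZ _ _ lY).
  by rewrite (linD _ _ lY) (linN _ lY) mulmxDl -scalemxAl mulmxBl.
- by move=> x y v; rewrite rmultM -/(K _) -/(K _) uKM addrC.
- by move=> x i v; rewrite !rmultM -/(K _) -/(E _) uKE' (linZ _ _ lW) scalemxAr.
- by move=> x i v; rewrite !rmultM -/(K _) -/(F _) uKF' (linZ _ _ lW) scalemxAr.
- move=> i j v; rewrite !rmultM -/(E _) -/(F _) uEF (linD _ _ lW) (linZ _ _ lW).
  by rewrite (linD _ _ lW) (linN _ lW) mulmxDr -scalemxAr mulmxBr.
Qed.

(* The twist by [K (- 2 rho)] is what makes [homE r] and [homF r \o homK (alpha r)]
   adjoint. *)
Definition hform (phi psi : H) : C :=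
  \tr (adjmx phi *m psi *m rW (K (- wrho L - wrho L))).

Lemma hform_lin phi c x y : hform phi (c *: x + y) = c * hform phi x + hform phi y.
Proof. by rewrite /hform mulmxDr mulmxDl -scalemxAr -scalemxAl raddfD /= mxtraceZ. Qed.

Lemma trace_adj d (X : 'M[C]_d) : \tr (adjmx X) = (\tr X)^*.
Proof. by rewrite rmorph_sum; apply: eq_bigr => i _; rewrite !mxE. Qed.

Lemma hform_conj x y : hform y x = (hform x y)^*.
Proof.
by rewrite /hform -trace_adj !adjmxM adjmxK (ur_K W) mxtrace_mulC mulmxA.
Qed.

(** K_(-2 rho) is the square of the self-adjoint invertible K_(-rho), so [hform x x] is the
    Hilbert-Schmidt norm squared of [x *m D]. *)
Lemma hform_def x : hform x x = 0 -> x = 0.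
Proof.
set D := rW (K (- wrho L)) => h.
have : \tr (adjmx (x *m D) *m (x *m D)) = 0.
  rewrite -h /hform -uKM (ur_mul W) -/D adjmxM (ur_K W) -/D.
  by rewrite mxtrace_mulC !mulmxA mxtrace_mulC !mulmxA.
move/mx_norm_eq0 => /(congr1 (mulmx^~ (rW (K (wrho L))))).
by rewrite /= mul0mx /D rmultM uKM addNr uK0 (ur_one W) mulmx1.
Qed.

Lemma uKrho r : K (- wrho L - wrho L) ** F r =
  qpow q (form (alpha r) (alpha r)) *: (F r ** K (- wrho L - wrho L)).
Proof.
rewrite uKF form_add formNl form_wrho opprD opprK.
by congr (qpow q _ *: _); field.
Qed.

Notation hE := (homE lmult rmult).
Notation hF := (homF lmult rmult).
Notation hK := (homK lmult rmult).

Lemma hform_adj r phi psi : hform (hE r phi) psi = hform phi (hF r (hK (alpha r) psi)).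
Proof.
rewrite /hform; set D := K (_ - _).
have -> : adjmx (hE r phi) = adjmx phi *m rY (F r ** K (alpha r)) -
    rW (F r) *m adjmx phi *m rY (K (alpha r)).
  rewrite /homE /lmult /rmult -/(E _) -/(K _) -/(K _) adjmxD -scaleN1r adjmxZ.
  rewrite rmorphN1 scaleN1r !adjmxM (ur_E Y) (ur_E W) !(ur_K Y) !(ur_K W).
  rewrite (ur_mul Y) !mulmxA; congr (_ - _ *m _ *m _).
  by rewrite -!(ur_mul W) -amulA uKM subrr uK0 amul1r.
have -> : hF r (hK (alpha r) psi) = rY (F r ** K (alpha r)) *m psi -
    rY (K (alpha r)) *m psi *m rW (K (- alpha r) ** F r ** K (alpha r)).
  rewrite /homF /homK /lmult /rmult -/(F _) -/(K _) -/(K _) mulmxBl.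
  rewrite !(ur_mul W) (ur_mul Y) !mulmxA; congr (_ - _).
  by rewrite rmultM uKM addNr uK0 (ur_one W) mulmx1.
rewrite !mulmxBl mulmxBr mulmxBl [LHS]raddfB [RHS]raddfB /= !mulmxA; congr (_ - _).
(* By cyclicity F_r lands to the right of K_(-2 rho). Moving it back costs q^(alpha_r, alpha_r), the
   factor by which K_(-alpha_r) F_r K_(alpha_r) differs from F_r. *)
rewrite -!mulmxA mxtrace_mulC -!mulmxA -!(ur_mul W).
congr (\tr (_ *m (_ *m (_ *m _)))).
rewrite uKrho -!amulA (amulA (K (- alpha r))) uKF formNl opprK amulZl -amulA.
by rewrite (amulA (K (- alpha r))) uKM addNr uK0 amul1l.
Qed.

Variables (chi : P -> C) (phi0 : H).
Hypothesis phi0F : forall r, rY (F r) *m phi0 = phi0 *m rW (F r).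
Hypothesis phi0K : forall y, rY (K y) *m phi0 = chi y *: (phi0 *m rW (K y)).

Lemma hom_lw_module : lw_module q hE hF hK hform chi phi0.
Proof.
have B := hom_bimod; split.
- exact: (homE_linear B).
- exact: (homF_linear B).
- exact: (homK_linear B).
- exact: (homKE B).
- exact: (homEF q_gt0 B).
- by move=> r; rewrite /homF /lmult /rmult -/(F _) phi0F subrr mul0mx.
- move=> y; rewrite /homK /lmult /rmult -/(K _) -/(K _) phi0K -scalemxAl.
  by rewrite rmultM uKM subrr uK0 (ur_one W) mulmx1.
- exact: hform_lin.
- exact: hform_conj.
- exact: hform_def.
- exact: hform_adj.
Qed.
End HomRep.

(** * Maps from an irreducible representation to a lowest weight module *)

Section IrrepLowest.
Variables (R : realType) (q : R) (q_gt0 : 0 < q) (q_lt1 : q < 1) (L : lie_datum R).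
Notation C := R[i].
Notation I := (ld_I L).
Notation P := (wlat (ld_I L)).
Notation U := (Uqk q L).
Notation K := (uK q (L := L)).
Notation E := (uE q (L := L)).
Notation F := (uF q (L := L)).
Variables (w0 : seq I) (w0_longest : longest_word w0).
Variables (w : P) (V : irrep q w).
Notation eta := (low_vec V w0).

Lemma irrep_lw_module : lw_module q (fun r => op (V := V) (E r))
  (fun r => op (F r)) (fun y => op (K y)) (@inner R (ir_dim V))
  (fun y => qpow q (form y (wact L w0 w))) eta.
Proof.
split.
- by move=> r; apply: op_linr.
- by move=> r; apply: op_linr.
- by move=> y; apply: op_linr.
- by move=> y r x; rewrite -!opM uKE opZl.
- by move=> r s x; rewrite -!opM uEF opDl addrC addKr opZl opDl opNl.
- exact: low_F.
- by move=> y; apply/has_wtK/has_wt_low.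
- exact: inner_lin.
- exact: inner_conj.
- exact: inner_eq0.
- by move=> r x y; rewrite op_adj star_uE opM.
Qed.

Variables (H : lmodType C) (e f : I -> H -> H) (k : P -> H -> H) (g : H -> H -> C) (u : H).
Hypothesis MH : lw_module q e f k g (fun y => qpow q (form y (wact L w0 w))) u.
Hypothesis eta0 : eta != 0.

(** The first projection of the submodule is a nonzero subrepresentation of an irreducible one. *)
Lemma irrep_total x :
  exists y, lw_graph (fun r => op (V := V) (E r)) eta e u x y.
Proof.
move: x; apply: irred_op.
- by move=> c x y [x' hx] [y' hy]; exists (c *: x' + y'); apply: lw_graph_lin.
- by move=> y v [v' hv]; exists (k y v'); apply: (lw_graphK q_gt0 irrep_lw_module MH).
- by move=> r v [v' hv]; exists (e r v'); apply: (lw_graphE irrep_lw_module MH).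
- by move=> r v [v' hv]; exists (f r v'); apply: (lw_graphF q_gt0 irrep_lw_module MH).
- by exists eta => //; exists u; apply: (lw_graph_mon _ _ _ _ [::]).
Qed.

Lemma irrep_intertwiner : exists Phi : 'cV[C]_(ir_dim V) -> H,
  [/\ is_linear Phi, Phi eta = u, forall r x, Phi (op (E r) x) = e r (Phi x),
      forall r x, Phi (op (F r) x) = f r (Phi x) &
      forall y x, Phi (op (K y) x) = k y (Phi x)].
Proof. exact: (lw_intertwiner q_gt0 irrep_lw_module MH eta0 irrep_total). Qed.

End IrrepLowest.

Lemma tlift_amul (C : numClosedFieldType) (A B : ualgType C) (M : lmodType C)
    (f : A -> B -> M) (x y : tens A B) : bilin f ->
  tlift f (x ** y) = tlift (fun a' b' => tlift (fun a b => f (a ** a') (b ** b')) x) y.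
Proof.
move=> bf; transitivity
  (\sum_(p <- repr x) \sum_(p' <- repr y) f (p.1 ** p'.1) (p.2 ** p'.2)).
  rewrite {1}(tens_repr x) {1}(tens_repr y) amul_suml tlift_sum //.
  apply: eq_bigr => p _; rewrite amul_sumr tlift_sum //; apply: eq_bigr => p' _.
  by rewrite pureM tlift_pure.
exact: exchange_big.
Qed.

Lemma tensmx11 (R : comPzRingType) m n :
  (1%:M : 'M[R]_m) *t (1%:M : 'M[R]_n) = 1%:M.
Proof.
apply/matrixP => i j; case: (mxtens_indexP i) => i1 i2; case: (mxtens_indexP j) => j1 j2.
rewrite tensmxE !mxE -natrM mulnb; congr (_%:R).
by rewrite (can_eq (@mxtens_indexK m n)) xpair_eqE.
Qed.

(** * Tensor products of representations *)

Section TensorRep.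
Variables (R : realType) (q : R) (q_gt0 : 0 < q) (L : lie_datum R).
Notation C := R[i].
Notation I := (ld_I L).
Notation P := (wlat (ld_I L)).
Notation U := (Uqk q L).
Notation K := (uK q (L := L)).
Notation E := (uE q (L := L)).
Notation F := (uF q (L := L)).
Variable Hf : uqk_hopf q L.
Notation D := (hp_D Hf).

Lemma D_hom : is_alg_hom D. Proof. exact: cop_hom (hp_coproduct Hf). Qed.
Lemma D_K w : D (K w) = pure (K w) (K w). Proof. exact: cop_K (hp_coproduct Hf) w. Qed.
Lemma D_E r : D (E r) = pure (E r) (K (alpha r)) + pure \1 (E r).
Proof. exact: cop_E (hp_coproduct Hf) r. Qed.
Lemma D_F r : D (F r) = pure (F r) \1 + pure (K (- alpha r)) (F r).
Proof. exact: cop_F (hp_coproduct Hf) r. Qed.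

Variables (m n : nat) (rV : U -> 'M[C]_m) (rW : U -> 'M[C]_n).
Hypotheses (V : unitary_rep rV) (W : unitary_rep rW).

Definition tens_rep (x : U) : 'M[C]_(m * n) := tlift (fun a b => rV a *t rW b) (D x).

Lemma tensmx_linl k l s t (Y : 'M[C]_(s, t)) : is_linear (fun X : 'M[C]_(k, l) => X *t Y).
Proof. by move=> c X X'; apply/matrixP => i j; rewrite !mxE mulrDl mulrA. Qed.
Lemma tensmx_linr k l s t (X : 'M[C]_(k, l)) : is_linear (fun Y : 'M[C]_(s, t) => X *t Y).
Proof. by move=> c Y Y'; apply/matrixP => i j; rewrite !mxE mulrDr mulrCA. Qed.

Lemma bilin_tens_rep : bilin (fun a b => rV a *t rW b).
Proof.
split=> [b|a]; first exact: (lin_comp (tensmx_linl _) (ur_lin V)).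
exact: (lin_comp (tensmx_linr _) (ur_lin W)).
Qed.

Lemma bilin_mulmx k l s : bilin (fun (X : 'M[C]_(k, l)) (Y : 'M_(l, s)) => X *m Y).
Proof.
split=> [Y|X] c A B; first by rewrite mulmxDl scalemxAl.
by rewrite mulmxDr scalemxAr.
Qed.

Lemma tens_rep_K w : tens_rep (K w) = rV (K w) *t rW (K w).
Proof. by rewrite /tens_rep D_K tlift_pure //; apply: bilin_tens_rep. Qed.
Lemma tens_rep_E r : tens_rep (E r) = rV (E r) *t rW (K (alpha r)) + 1%:M *t rW (E r).
Proof.
have b := bilin_tens_rep.
by rewrite /tens_rep D_E (linD _ _ (tlift_linear b)) !tlift_pure // (ur_one V).
Qed.
Lemma tens_rep_F r : tens_rep (F r) = rV (F r) *t 1%:M + rV (K (- alpha r)) *t rW (F r).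
Proof.
have b := bilin_tens_rep.
by rewrite /tens_rep D_F (linD _ _ (tlift_linear b)) !tlift_pure // (ur_one W).
Qed.

Lemma tens_rep_unitary : unitary_rep tens_rep.
Proof.
have [lD D1 DM] := D_hom; have b := bilin_tens_rep.
split.
- exact: (lin_comp (tlift_linear b) lD).
- rewrite /tens_rep D1 tlift_pure // (ur_one V) (ur_one W).
  exact: tensmx11.
- move=> x y; rewrite /tens_rep DM.
  have [_ h2] := bilin_mulmx (m * n) (m * n) (m * n).
  rewrite tlift_amul // (lin_tlift _ (D y) (h2 _)); apply: eq_tlift => c d.
  have [h1 _] := bilin_mulmx (m * n) (m * n) (m * n).
  rewrite (lin_tlift _ (D x) (h1 _)); apply: eq_tlift => c' d'.
  by rewrite (ur_mul V) (ur_mul W) tensmx_mul.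
- by move=> w; rewrite tens_rep_K adjmx_tens (ur_K V) (ur_K W).
- move=> r; rewrite tens_rep_E tens_rep_F tens_rep_K adjmxD !adjmx_tens adjmx1.
  rewrite (ur_K W) (ur_E V) (ur_E W) mulmxDl !tensmx_mul mul1mx -!(ur_mul V).
  by rewrite uKM addNr uK0 (ur_one V).
Qed.

Section Intertwiner.
Variables (T : lmodType C) (a : U -> T -> T) (Phi : T -> 'M[C]_(m * n, n)).
Hypothesis al : forall t, is_linear (a^~ t).
Hypothesis a1 : forall t, a \1 t = t.
Hypothesis aM : forall x y t, a (x ** y) t = a x (a y t).
Hypothesis lPhi : is_linear Phi.
Hypothesis PhiK : forall x t, Phi (a (K x) t) = homK (lmult tens_rep) (rmult rW) x (Phi t).
Hypothesis PhiE : forall r t, Phi (a (E r) t) = homE (lmult tens_rep) (rmult rW) r (Phi t).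
Hypothesis PhiF : forall r t, Phi (a (F r) t) = homF (lmult tens_rep) (rmult rW) r (Phi t).

Lemma bilin_hom t : bilin (fun x y => Phi (a y t) *m rW x).
Proof.
have [h1 h2] := bilin_mulmx (m * n) n n.
split=> [y|x]; first exact: (lin_comp (h2 _) (ur_lin W)).
exact: (lin_comp (h1 _) (lin_comp lPhi (al t))).
Qed.

(** In other words, w (x) t |-> Phi(t) w is U_q(k)-linear from W (x) T to the tensor product V (x)
    W. On generators this undoes the definitions of [homK], [homE] and [homF]; multiplicativity of
    the coproduct does the rest. *)
Lemma hom_leibniz x t :
  tens_rep x *m Phi t = tlift (fun x y => Phi (a y t) *m rW x) (D x).
Proof.
have [lD D1 DM] := D_hom; have YU := tens_rep_unitary.
have [h1 h2] := bilin_mulmx (m * n) (m * n) n.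
elim/uqk_ind: x t => [t|c x y hx hy t|x y hx hy t|w t|r t|r t].
- rewrite (ur_one YU) mul1mx D1 tlift_pure; last exact: bilin_hom.
  by rewrite a1 (ur_one W) mulmx1.
- rewrite (ur_lin YU) lD mulmxDl -scalemxAl hx hy.
  by rewrite (tlift_linear (bilin_hom t)).
- have [k1 k2] := bilin_mulmx (m * n) n n.
  rewrite (ur_mul YU) -mulmxA hy (lin_tlift _ _ (h2 _)) DM tlift_amul; last exact: bilin_hom.
  apply: eq_tlift => v z; rewrite mulmxA hx (lin_tlift _ _ (k1 _)).
  by apply: eq_tlift => v' z'; rewrite aM (ur_mul W) mulmxA.
- rewrite D_K tlift_pure; last exact: bilin_hom.
  by rewrite PhiK /homK /lmult /rmult -/(K _) -/(K _) -mulmxA -(ur_mul W) uKM addNr uK0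
    (ur_one W) mulmx1.
- rewrite D_E (linD _ _ (tlift_linear (bilin_hom t))) !tlift_pure; try exact: bilin_hom.
  rewrite (ur_one W) mulmx1 PhiE PhiK /homE /homK /lmult /rmult -/(K _) -/(K _) -/(E _) -/(E _).
  by rewrite addrC subrK.
- rewrite D_F (linD _ _ (tlift_linear (bilin_hom t))) !tlift_pure; try exact: bilin_hom.
  rewrite a1 PhiF /homF /lmult /rmult -/(F _) -/(F _) -/(K _) -mulmxA -(ur_mul W).
  by rewrite uKM subrr uK0 (ur_one W) mulmx1 addrC subrK.
Qed.
End Intertwiner.
End TensorRep.

(** * The braiding map and its triangularity *)

Section Braiding.
Variables (R : realType) (q : R) (q_gt0 : 0 < q) (q_lt1 : q < 1) (L : lie_datum R).
Notation C := R[i].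
Notation I := (ld_I L).
Notation P := (wlat (ld_I L)).
Notation U := (Uqk q L).
Notation K := (uK q (L := L)).
Notation E := (uE q (L := L)).
Notation F := (uF q (L := L)).
Variable Hf : uqk_hopf q L.
Notation D := (hp_D Hf).
Variables (w0 : seq I) (w0_longest : longest_word w0).
Variables (w w' : P) (V : irrep q w) (W : irrep q w').
Notation rW := (ir_rho W).
Notation eta := (low_vec V w0).
Notation lam := (wact L w0 w).
Notation sl := (@slice R (ir_dim V) (ir_dim W)).
Notation Y := (tens_rep Hf (ir_rho V) rW).

Let VU := irrep_unitary V.
Let WU := irrep_unitary W.

Definition low_hom := sl eta *m rW (K lam).

Lemma tensmx_slice' (a : U) (M : 'M_(ir_dim W)) (v : 'cV[C]_(ir_dim V)) :
  (ir_rho V a *t M) *m sl v = sl (op a v) *m M.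
Proof. exact: tensmx_slice. Qed.

Lemma slice_act (a : U) (N : 'M_(ir_dim W)) (z : 'cV[C]_(ir_dim V)) k
    (M : 'M_(_, k)) :
  adjmx (sl z) *m (ir_rho V a *t N) *m M = N *m (adjmx (sl (op (star a) z)) *m M).
Proof. by rewrite slice_adj_tens -ir_star mulmxA. Qed.

(** As F_r kills [eta], only K_(-alpha_r) (x) F_r contributes. The factor from its first leg is
    compensated when F_r crosses [K lam], which is the purpose of [K lam] in [low_hom]. *)
Lemma low_homF r : Y (F r) *m low_hom = low_hom *m rW (F r).
Proof.
rewrite /low_hom mulmxA (tens_rep_F Hf VU WU) mulmxDl !tensmx_slice'.
rewrite (low_F q_gt0 q_lt1 V w0_longest) (lin0 (slice_linear _)) mul0mx add0r.
rewrite (has_wtK _ (has_wt_low q_gt0 V w0)) (linZ _ _ (slice_linear _)) -!scalemxAl.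
rewrite -!mulmxA -!(ur_mul WU) uKF' // (linZ _ _ (ur_lin WU)) -!scalemxAr scalerA.
by rewrite -qpowD // formNl form_sym addNr qpow0 scale1r.
Qed.

Lemma low_homK y : Y (K y) *m low_hom =
  qpow q (form y lam) *: (low_hom *m rW (K y)).
Proof.
rewrite /low_hom mulmxA (tens_rep_K Hf VU WU) tensmx_slice'.
rewrite (has_wtK _ (has_wt_low q_gt0 V w0)) (linZ _ _ (slice_linear _)) -!scalemxAl.
by rewrite -!mulmxA -!(ur_mul WU) !uKM addrC.
Qed.

Section BraidingNonzero.
Hypothesis eta0 : eta != 0.
Let MH := hom_lw_module q_gt0 (tens_rep_unitary Hf VU WU) WU low_homF low_homK.
Let mon (s : seq I) : 'cV[C]_(ir_dim V) := lw_mon (fun r => op (E r)) eta s.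

Lemma has_wt_mon s : has_wt (mon s) (lam + \sum_(r <- s) alpha r).
Proof.
elim: s => [|r s IH] /=; first by rewrite big_nil addr0; apply: has_wt_low.
by rewrite big_cons addrCA addrC; apply: has_wtE.
Qed.

Lemma mon_span v : in_span (fun x => exists s, x = mon s) v.
Proof.
have [y [s -> _]] := irrep_total q_gt0 q_lt1 w0_longest MH eta0 v.
exists [seq (p.1, mon p.2) | p <- s]; last by rewrite big_map.
by move=> _ /mapP [p _ ->]; exists p.2.
Qed.

Section Phi.
Variable Phi : 'cV[C]_(ir_dim V) -> 'M[C]_(ir_dim V * ir_dim W, ir_dim W).
Hypothesis lPhi : is_linear Phi.
Hypothesis Phi_eta : Phi eta = low_hom.
Hypothesis PhiE : forall r x, Phi (op (E r) x) = homE (lmult Y) (rmult rW) r (Phi x).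

(* [Phi] moves weight from the V-leg to the W-leg: apart from the leading term,
   [Phi (mon s)] has V-components of lower weight only. *)
Lemma Phi_leading s kap (z : 'cV[C]_(ir_dim V)) : has_wt z kap ->
  form (wrho L) (lam + \sum_(r <- s) alpha r) <= form (wrho L) kap ->
  adjmx (sl z) *m Phi (mon s) =
  inner z (mon s) *: rW (K (lam + \sum_(r <- s) alpha r)).
Proof.
elim: s z kap => [|r s IH] z kap hz; rewrite /= ?big_nil ?big_cons.
  by rewrite !addr0 Phi_eta /low_hom mulmxA slice_inner mul_scalar_mx.
set mu := lam + \sum_(i <- s) alpha i; rewrite addrCA -/mu => hle.
have hrho := wrho_pos (ld_simple r); rewrite form_addr in hle.
have hlt : form (wrho L) mu < form (wrho L) kap.
  by apply: lt_le_trans hle; rewrite ltrDr.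
have z0 : inner z (mon s) = 0.
  apply: (wt_orth q_gt0 q_lt1 hz (has_wt_mon s)); apply: contraTneq hlt => ->.
  by rewrite -/mu ltxx.
(* The hypothesis serves twice: for [z], which is too high to pair with [mon s] and gives 0, and for
   the image of [z] under the adjoint of E_r, which carries the leading term. *)
have IHz := IH z kap hz (ltW hlt); rewrite z0 scale0r in IHz.
have IHE := IH _ _ (has_wt_starE q_gt0 r hz); rewrite -op_adj' in IHE.
rewrite PhiE /homE /lmult /rmult -/(E _) -/(K _) -/(K _) mulmxBr !mulmxA.
rewrite (tens_rep_E Hf VU WU) (tens_rep_K Hf VU WU) mulmxDr mulmxDl.
rewrite -(ir_one V) (slice_act (E r)) (slice_act \1) (slice_act (K _)).
rewrite [X in rW (K _) *m X + _]IHE; last by rewrite formBr -/mu lerBrDl.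
rewrite star1 op1 star_uK (has_wtK _ hz) (linZ _ _ (slice_linear _)).
rewrite adjmxZ -scalemxAl IHz scaler0 !mulmx0 !mul0mx subr0 addr0.
by rewrite -scalemxAr -(ur_mul WU) uKM.
Qed.

(** No weight is higher than [w], so for the highest weight vector [Phi_leading] applies to every
    monomial. *)
Lemma Phi_xi v : adjmx (sl (ir_xi V)) *m Phi v = inner (ir_xi V) v *: rW (K w).
Proof.
elim/in_span_ind: v / (mon_span v) => [|c x y hx hy|_ [s ->]].
- by rewrite (lin0 lPhi) mulmx0 inner0r scale0r.
- by rewrite lPhi mulmxDr -scalemxAr hx hy inner_lin scalerDl scalerA.
have [m0|m0] := eqVneq (mon s) 0.
  by rewrite m0 (lin0 lPhi) mulmx0 inner0r scale0r.
rewrite (Phi_leading (has_wt_xi V)).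
  have [->//|ne] := eqVneq (lam + \sum_(r <- s) alpha r) w.
  rewrite (wt_orth q_gt0 q_lt1 (has_wt_xi V) (has_wt_mon s)) ?scale0r //.
  by rewrite eq_sym.
exact: (wt_bound q_gt0 q_lt1 (has_wt_mon s) m0).
Qed.
End Phi.

Lemma inner_mx_linear k (z : 'cV[C]_k) j (M : 'M_(k, j)) i (N : 'M_(i, 1)) :
  is_linear (fun X : 'M[C]_(j, i) => inner z (M *m X *m N) : C^o).
Proof.
by move=> c X X'; rewrite mulmxDr mulmxDl -scalemxAr -scalemxAl inner_lin.
Qed.

(** The matrix entry of [Y X *m Phi eta] between xi (x) z and t is computed in two ways: by
    inserting [low_hom] for [Phi eta], and by moving [X] through [Phi] with [hom_leibniz] before
    projecting to xi with [Phi_xi]. *)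
Lemma braiding_neq0 (X : U) l m (z t : 'cV[C]_(ir_dim W)) : has_wt z l -> has_wt t m ->
  qpow q (form lam m) *
    tlift (fun a b => inner (ir_xi V) (op a eta) * inner z (op b t) : C^o) (D X)
  = qpow q (form w l) *
    tlift (fun a b => inner z (op a t) * inner (ir_xi V) (op b eta) : C^o) (D X).
Proof.
move=> hz ht; have [Phi [lPhi Phi_eta PhiE PhiF PhiK]] :=
  irrep_intertwiner q_gt0 q_lt1 w0_longest MH eta0.
have lhs : tlift (fun a b => inner (ir_xi V) (op a eta) * inner z (op b t) : C^o) (D X)
    = inner z (adjmx (sl (ir_xi V)) *m Y X *m (sl eta *m t)).
  rewrite (lin_tlift _ (D X) (inner_mx_linear z _ _)); apply: eq_tlift => a b.
  rewrite slice_act mulmxA slice_inner -op_adj' mul_scalar_mx -scalemxAr.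
  by rewrite innerZr.
have -> : qpow q (form lam m) *
      tlift (fun a b => inner (ir_xi V) (op a eta) * inner z (op b t) : C^o) (D X)
    = inner z (adjmx (sl (ir_xi V)) *m (Y X *m Phi eta) *m t).
  rewrite lhs -innerZr; congr inner; rewrite Phi_eta /low_hom -!mulmxA.
  by rewrite -[rW _ *m t]/(op _ _) (has_wtK _ ht) -!scalemxAr.
have al v : is_linear (fun a => op (V := V) a v) by apply: op_linl.
rewrite (hom_leibniz VU WU al (@op1 _ _ _ _ V) (@opM _ _ _ _ V) lPhi PhiK PhiE PhiF).
rewrite (lin_tlift _ (D X) (inner_mx_linear z _ _)).
rewrite -[qpow q _ * _]/(qpow q _ *: (_ : C^o)).
rewrite [RHS](lin_tlift _ (D X) (lin_scale (V := C^o) (qpow q (form w l)) (@lin_id _ C^o))).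
apply: eq_tlift => a b.
rewrite mulmxA (Phi_xi lPhi Phi_eta PhiE) -!scalemxAl innerZr -mulmxA.
rewrite -[rW (K w) *m _]/(op _ _) (op_adj' (K w)) star_uK (has_wtK _ hz) innerZl qpow_conj.
by rewrite mulrC -mulrA.
Qed.
End BraidingNonzero.

Lemma braiding (X : U) l m (z t : 'cV[C]_(ir_dim W)) : has_wt z l -> has_wt t m ->
  qpow q (form lam m) *
    tlift (fun a b => inner (ir_xi V) (op a eta) * inner z (op b t) : C^o) (D X)
  = qpow q (form w l) *
    tlift (fun a b => inner z (op a t) * inner (ir_xi V) (op b eta) : C^o) (D X).
Proof.
(* If [eta] were 0 there would be no [Phi] to construct, but both sides would be 0. *)
move=> hz ht; have [e0|] := eqVneq eta 0; last by move=> h; apply: braiding_neq0.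
by rewrite /tlift /fsum !big1 ?mulr0 // => p _; rewrite e0 op0r inner0r ?mul0r ?mulr0.
Qed.

End Braiding.

(** * The relation for b_w in Pol_q(K) *)

Section PolRelation.
Variables (R : realType) (q : R) (q_gt0 : 0 < q) (q_lt1 : q < 1) (L : lie_datum R).
Notation C := R[i].
Notation I := (ld_I L).
Notation P := (wlat (ld_I L)).
Notation U := (Uqk q L).
Variables (Hf : uqk_hopf q L) (V : forall w : domw L, irrep q w) (A : polK Hf V).
Variables (w0 : seq I) (w0_longest : longest_word w0).

Lemma pol_ext (x y : A) : (forall X, pol_ev x X = pol_ev y X) -> x = y.
Proof.
move=> h; apply/eqP; rewrite -subr_eq0; apply/eqP/pol_ev_inj => X.
have := pol_ev_linear (-1) y x X; rewrite scaleN1r addrC => ->.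
by rewrite h mulN1r addNr.
Qed.

Lemma pol_evZ c (x : A) X : pol_ev (c *: x) X = c * pol_ev x X.
Proof.
have z0 : pol_ev (0 : A) X = 0.
  by have := pol_ev_linear (-1) 0 (0 : A) X; rewrite scaler0 addr0 mulN1r addNr.
by have := pol_ev_linear c x 0 X; rewrite !addr0 z0 addr0.
Qed.

Lemma b_comm (w : domw L) l m (x : A) : bideg l m x ->
  b_ A w0 w ** x = qpow q (form w (l - wact L w0 m)) *: (x ** b_ A w0 w).
Proof.
elim=> [w' z t hz ht|c y z hy ey hz ez]; last first.
  by rewrite amulDr amulZr amulDl amulZl scalerDr ey ez !scalerA mulrC.
apply: pol_ext => X; rewrite pol_evZ !pol_ev_mul.
(* The factor q^(w_0 w, m) of [braiding]. As w_0 is an isometric involution, (w_0 w, m) = (w, w_0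
   m), so the exponents add up to (w, l). *)
apply: (mulfI (qpow_neq0 q_gt0 (form (wact L w0 w) m))).
have := braiding q_gt0 q_lt1 Hf w0_longest (V w) X hz ht.
rewrite /tlift /fsum mulrA -qpowD // form_longest // formBr addrC subrK => h.
under eq_bigr do rewrite !pol_ev_mcoef.
under [in RHS]eq_bigr do rewrite !pol_ev_mcoef.
exact: h.
Qed.
End PolRelation.

(** * The antipode and the left action on Pol_q(K) *)

Section Antipode.
Variables (R : realType) (q : R) (L : lie_datum R).
Notation C := R[i].
Notation I := (ld_I L).
Notation P := (wlat (ld_I L)).
Notation U := (Uqk q L).
Notation K := (uK q (L := L)).
Notation E := (uE q (L := L)).
Notation F := (uF q (L := L)).
Variable Hf : uqk_hopf q L.
Notation D := (hp_D Hf).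
Notation S := (hp_S Hf).
Notation eps := (hp_eps Hf).

Lemma tlift_exchange (A B A' B' M : lmodType C) (f : A -> B -> A' -> B' -> M) s t :
  tlift (fun a b => tlift (f a b) s) t = tlift (fun c d => tlift (fun a b => f a b c d) t) s.
Proof. exact: exchange_big. Qed.

Definition trilin (M : lmodType C) (f : U -> U -> U -> M) : Prop :=
  (forall c, bilin (fun a b => f a b c)) /\ (forall a b, is_linear (f a b)).

Lemma bilin_D (M : lmodType C) (f : U -> U -> U -> M) : trilin f ->
  bilin (fun a c => tlift (fun a1 a2 => f a1 a2 c) (D a)) /\
  bilin (fun a b => tlift (fun b1 b2 => f a b1 b2) (D b)).
Proof.
move=> [f1 f2]; have [lD _ _] := D_hom Hf.
split; split=> [c|a].
- exact: (lin_comp (tlift_linear (f1 c)) lD).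
- exact: tlift_bilin_lin.
- by apply: tlift_bilin_lin => b1 b2; apply: bilin_l (f1 b2).
- have bl : bilin (f a).
    by split=> [b2|b1]; [apply: bilin_r (f1 b2) | apply: f2].
  exact: (lin_comp (tlift_linear bl) lD).
Qed.

(** The coproduct is given by its values on generators, so coassociativity is checked there and
    propagated along products. Testing against trilinear maps replaces triple tensor products. *)
Lemma coassoc (M : lmodType C) (f : U -> U -> U -> M) Z : trilin f ->
  tlift (fun a c => tlift (fun a1 a2 => f a1 a2 c) (D a)) (D Z) =
  tlift (fun a b => tlift (fun b1 b2 => f a b1 b2) (D b)) (D Z).
Proof.
have [lD D1 DM] := D_hom Hf.
have B (M' : lmodType C) (g : U -> U -> U -> M') a : trilin g -> bilin (g a).
  by move=> [g1 g2]; split=> [b2|b1]; [apply: bilin_r (g1 b2) | apply: g2].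
elim/uqk_ind: Z M f => [|c x y hx hy|x y hx hy|w|r|r] M f tf; have [b1 b2] := bilin_D tf.
- by rewrite D1 !tlift_pure // D1 !tlift_pure //; [apply: B | case: tf].
- rewrite lD (tlift_linear b1) (tlift_linear b2); congr (_ *: _ + _); [exact: hx|exact: hy].
- have [f1 f2] := tf.
  have tf' a' b' c' : trilin (fun a b c => f (a ** a') (b ** b') (c ** c')).
    split=> [c|a b].
      exact: (bilin_pre (f1 (c ** c')) (amul_linl a') (amul_linl b')).
    exact: (lin_comp (f2 _ _) (amul_linl c')).
  (* [f] with the three legs of x multiplied in from the left. It is again trilinear, so the
     hypothesis for y applies to it; this is why the induction quantifies over [f]. *)
  pose G a' b' c' :=
    tlift (fun a b => tlift (fun b1 b2 => f (a ** a') (b1 ** b') (b2 ** c')) (D b)) (D x).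
  have tG : trilin G.
    split=> [c'|a' b']; first split=> [b'|a'].
    - do 2!apply: tlift_bilin_lin => ? ?.
      exact: (lin_comp (bilin_l _ (f1 _)) (amul_linr _)).
    - do 2!apply: tlift_bilin_lin => ? ?.
      exact: (lin_comp (bilin_r _ (f1 _)) (amul_linr _)).
    - do 2!apply: tlift_bilin_lin => ? ?.
      exact: (lin_comp (f2 _ _) (amul_linr _)).
  rewrite DM !tlift_amul //.
  transitivity (tlift (fun a' c' => tlift (fun a'1 a'2 => G a'1 a'2 c') (D a')) (D y)).
    apply: eq_tlift => a' c'; rewrite -[RHS]/(tlift _ _).
    under eq_tlift do rewrite DM tlift_amul //.
    rewrite tlift_exchange; apply: eq_tlift => a'1 a'2.
    exact: (hx _ _ (tf' a'1 a'2 c')).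
  rewrite (hy _ _ tG); apply: eq_tlift => a' b'.
  rewrite tlift_exchange; apply: eq_tlift => a b.
  rewrite DM tlift_amul //; exact: (B _ _ _ tf).
- by rewrite D_K !tlift_pure // D_K !tlift_pure //; [apply: B | case: tf].
- rewrite D_E !(linD _ _ (tlift_linear b1)) !(linD _ _ (tlift_linear b2)) !tlift_pure //.
  have [f1 f2] := tf; have c1 := f1; have c2 a := B _ _ a tf.
  rewrite D1 D_E D_K !(linD _ _ (tlift_linear (f1 _))) !(linD _ _ (tlift_linear (c2 _))).
  by rewrite !tlift_pure // -addrA.
- rewrite D_F !(linD _ _ (tlift_linear b1)) !(linD _ _ (tlift_linear b2)) !tlift_pure //.
  have [f1 f2] := tf; have c1 := f1; have c2 a := B _ _ a tf.
  rewrite D1 D_F D_K !(linD _ _ (tlift_linear (f1 _))) !(linD _ _ (tlift_linear (c2 _))).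
  by rewrite !tlift_pure // -addrA.
Qed.

Lemma counit x : tlift (fun a b => eps b *: a) (D x) = x.
Proof.
have [lD D1 DM] := D_hom Hf.
have b0 : bilin (fun a b : U => eps b *: a).
  split=> [b|a] c u v; first by rewrite scalerDr !scalerA mulrC.
  by rewrite hp_eps_linear scalerDl scalerA.
elim/uqk_ind: x => [|c x y hx hy|x y hx hy|w|r|r].
- by rewrite D1 tlift_pure // hp_eps1 scale1r.
- by rewrite lD (tlift_linear b0) hx hy.
- rewrite DM tlift_amul //.
  rewrite -{2}hx -{2}hy (lin_tlift _ _ (amul_linr _)); apply: eq_tlift => a' b'.
  rewrite (lin_tlift _ _ (amul_linl _)); apply: eq_tlift => a b.
  by rewrite hp_epsM amulZl amulZr scalerA mulrC.
- by rewrite D_K tlift_pure // hp_epsK scale1r.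
- by rewrite D_E (linD _ _ (tlift_linear b0)) !tlift_pure // hp_epsK hp_epsE scale1r scale0r addr0.
- by rewrite D_F (linD _ _ (tlift_linear b0)) !tlift_pure // hp_eps1 hp_epsF scale1r scale0r addr0.
Qed.

(* [T = T * (id * S) = (T * id) * S] for the convolution product [*] *)
Lemma conv_right_cancel (T : U -> U) Z : is_linear T ->
  T Z = tlift (fun a c => tlift (fun a1 a2 => T a1 ** a2) (D a) ** S c) (D Z).
Proof.
move=> lT.
have tf : trilin (fun a b c => T a ** b ** S c).
  split=> [c|a b]; last exact: (lin_comp (amul_linr _) (hp_S_linear Hf)).
  split=> [b|a]; apply: (lin_comp (amul_linl _)).
    exact: (lin_comp (amul_linl _) lT).
  exact: amul_linr.
transitivity (tlift (fun a b => tlift (fun b1 b2 => T a ** b1 ** S b2) (D b)) (D Z)).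
  rewrite -{1}(counit Z) (lin_tlift _ _ lT); apply: eq_tlift => a b.
  rewrite (linZ _ _ lT) -[T a in LHS]amul1r -amulZr -hp_antipoder.
  rewrite (lin_tlift _ _ (amul_linr _)); apply: eq_tlift => b1 b2.
  by rewrite amulA.
rewrite -coassoc //; apply: eq_tlift => a c.
by rewrite (lin_tlift _ _ (amul_linl _)).
Qed.

Lemma D_amul_pure (M : lmodType C) (f : U -> U -> M) a b z : bilin f ->
  tlift f (pure a b ** D z) = tlift (fun x y => f (a ** x) (b ** y)) (D z).
Proof.
move=> bf; rewrite tlift_amul //; apply: eq_tlift => x y; rewrite tlift_pure //.
exact: (bilin_pre bf (amul_linl x) (amul_linl y)).
Qed.

Lemma bilin_Sid : bilin (fun a b => S a ** b).
Proof.
split=> [b|a]; last exact: amul_linr.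
exact: (lin_comp (amul_linl b) (hp_S_linear Hf)).
Qed.

(** As functions of Z, S(K_w Z) K_w and S(Z) are both left convolution inverses of the identity, and
    [conv_right_cancel] makes such an inverse unique. *)
Lemma S_Kmul w Z : S (K w ** Z) = S Z ** K (- w).
Proof.
have [_ _ DM] := D_hom Hf.
have lT : is_linear (fun Z => S (K w ** Z) ** K w).
  apply: (lin_comp (amul_linl _)).
  exact: (lin_comp (hp_S_linear Hf) (amul_linr _)).
suff <- : S (K w ** Z) ** K w = S Z by rewrite -amulA uKM subrr uK0 amul1r.
rewrite (conv_right_cancel Z lT) [RHS](conv_right_cancel Z (hp_S_linear Hf)).
apply: eq_tlift => a c; congr (_ ** _).
have := hp_antipodel Hf (K w ** a); rewrite DM D_K D_amul_pure; last exact: bilin_Sid.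
rewrite hp_epsM hp_epsK mul1r -hp_antipodel => <-.
by apply: eq_tlift => x y; rewrite amulA.
Qed.

(** The function S(E_r Z) K_(alpha_r) + S(Z) E_r of Z, convolved with the identity, gives the counit
    of E_r Z times 1, which is 0; hence the function itself is 0. *)
Lemma S_Emul r Z : S (E r ** Z) = - (S Z ** E r ** K (- alpha r)).
Proof.
have [_ _ DM] := D_hom Hf.
have lT : is_linear (fun Z => S (E r ** Z) ** K (alpha r) + S Z ** E r).
  apply: lin_add; apply: (lin_comp (amul_linl _)); last exact: hp_S_linear.
  exact: (lin_comp (hp_S_linear Hf) (amul_linr _)).
have h : S (E r ** Z) ** K (alpha r) + S Z ** E r = 0.
  have conv0 y : tlift (fun a1 a2 =>
      (S (E r ** a1) ** K (alpha r) + S a1 ** E r) ** a2) (D y) = 0.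
    have := hp_antipodel Hf (E r ** y).
    rewrite DM D_E amulDl (linD _ _ (tlift_linear bilin_Sid)).
    rewrite !D_amul_pure; try exact: bilin_Sid.
    rewrite hp_epsM hp_epsE mul0r scale0r /tlift /fsum -big_split /= => h.
    by rewrite -[RHS]h; apply: eq_bigr => p _; rewrite amulDl !amulA amul1l.
  rewrite (conv_right_cancel Z lT) /tlift /fsum big1 // => p _.
  by have := conv0 p.1; rewrite /tlift /fsum => ->; rewrite amul0l.
have := congr1 (fun x => x ** K (- alpha r)) h.
rewrite /= amulDl amul0l -amulA uKM subrr uK0 amul1r => /eqP.
by rewrite addr_eq0 => /eqP.
Qed.

End Antipode.

(** * The two actions of U_q(k) on Pol_q(K) *)

Section LeftAction.
Variables (R : realType) (q : R) (q_gt0 : 0 < q) (q_lt1 : q < 1) (L : lie_datum R).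
Notation C := R[i].
Notation I := (ld_I L).
Notation P := (wlat (ld_I L)).
Notation U := (Uqk q L).
Notation K := (uK q (L := L)).
Notation E := (uE q (L := L)).
Notation F := (uF q (L := L)).
Variables (Hf : uqk_hopf q L) (V : forall w : domw L, irrep q w) (A : polK Hf V).
Notation D := (hp_D Hf).
Implicit Types (x y : A) (X Y : U).

Lemma pol_evD x y X : pol_ev (x + y) X = pol_ev x X + pol_ev y X.
Proof. by have := pol_ev_linear 1 x y X; rewrite scale1r mul1r. Qed.
Lemma pol_ev0 X : pol_ev (0 : A) X = 0.
Proof. by have := pol_evZ 0 (0 : A) X; rewrite scale0r mul0r. Qed.
Lemma pol_ev_sum (J : Type) (s : seq J) (f : J -> A) X :
  pol_ev (\sum_(j <- s) f j) X = \sum_(j <- s) pol_ev (f j) X.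
Proof.
apply: (big_morph (fun x => pol_ev x X)) => [x y|]; [exact: pol_evD|exact: pol_ev0].
Qed.

Lemma pol_ind (Q : A -> Prop) : Q 0 ->
  (forall c x y, Q x -> Q y -> Q (c *: x + y)) ->
  (forall w (xi eta : 'cV_(ir_dim (V w))), Q (mcoef A xi eta)) -> forall x, Q x.
Proof.
by move=> Q0 QL Qm x; apply: (in_span_ind Q0 QL _ (pol_span x)) => _ [w [xi [eta ->]]].
Qed.

Lemma mcoef_linr w (xi : 'cV_(ir_dim (V w))) : is_linear (mcoef A xi).
Proof.
move=> c u v; apply: pol_ext => X.
by rewrite pol_ev_linear !pol_ev_mcoef -!/(op _ _) op_linr inner_lin.
Qed.
Lemma mcoef_antil w (eta : 'cV_(ir_dim (V w))) c u v :
  mcoef A (c *: u + v) eta = c^* *: mcoef A u eta + mcoef A v eta.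
Proof.
apply: pol_ext => X.
by rewrite pol_ev_linear !pol_ev_mcoef innerDl innerZl.
Qed.
Lemma mcoef0l w (eta : 'cV_(ir_dim (V w))) : mcoef A 0 eta = 0.
Proof. by apply: pol_ext => X; rewrite pol_ev_mcoef inner0l pol_ev0. Qed.

Lemma bideg_span x : in_span (fun y => exists l m, bideg l m y) x.
Proof.
move: x; apply: pol_ind => [|c x y|w xi eta].
- exact: in_span0.
- exact: in_span_lin.
elim/in_span_ind: xi / (wt_span q_gt0 xi) => [|c u v hu hv|u [l hl]].
- by rewrite mcoef0l; apply: in_span0.
- by rewrite mcoef_antil; apply: in_span_lin.
elim/in_span_ind: eta / (wt_span q_gt0 eta) => [|c v v' hu hv|v [m hm]].
- by rewrite (lin0 (mcoef_linr _)); apply: in_span0.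
- by rewrite mcoef_linr; apply: in_span_lin.
by apply: in_span_gen; exists l, m; apply: bideg_mcoef.
Qed.

Lemma bideg_ind (Q : A -> Prop) : Q 0 ->
  (forall c x y, Q x -> Q y -> Q (c *: x + y)) ->
  (forall l m x, bideg l m x -> Q x) -> forall x, Q x.
Proof.
move=> Q0 QL Qm x; apply: (in_span_ind Q0 QL _ (bideg_span x)) => y [l [m]].
exact: Qm.
Qed.

Lemma pol_ev_linX x : is_linear (pol_ev x : U -> C^o).
Proof.
move=> c X Y; move: x; apply: pol_ind => [|d x y hx hy|w xi eta].
- by rewrite !pol_ev0 scaler0 addr0.
- rewrite !pol_ev_linear hx hy -![c *: (_ : C^o)]/(c * _); ring.
- by rewrite !pol_ev_mcoef -!/(op _ _) op_linl inner_lin.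
Qed.

(** This is x <| X with [X] written first, so that products act in reverse order ([lactM]). *)
Definition lact X x : A := tlift (fun a b => pol_ev a X *: b) (pol_D x).

Lemma bilin_lact X : bilin (fun a b : A => pol_ev a X *: b).
Proof.
split=> [b|a] c u v; first by rewrite pol_ev_linear scalerDl scalerA.
by rewrite scalerDr !scalerA mulrC.
Qed.
Lemma bilin_ract Y : bilin (fun a b : A => pol_ev b Y *: a).
Proof.
split=> [b|a] c u v; last by rewrite pol_ev_linear scalerDl scalerA.
by rewrite scalerDr !scalerA mulrC.
Qed.

Lemma lact_linear X : is_linear (lact X).
Proof. exact: (lin_comp (tlift_linear (bilin_lact X)) (@pol_D_linear _ _ _ _ _ A)). Qed.
Lemma right_act_linear Y : is_linear (@right_act R q L Hf V A Y).
Proof. exact: (lin_comp (tlift_linear (bilin_ract Y)) (@pol_D_linear _ _ _ _ _ A)). Qed.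

Lemma lact_mcoef X w (xi eta : 'cV_(ir_dim (V w))) :
  lact X (mcoef A xi eta) = mcoef A (op (star X) xi) eta.
Proof.
rewrite /lact pol_D_mcoef tlift_sum; last exact: bilin_lact.
apply: pol_ext => Y; rewrite pol_ev_sum pol_ev_mcoef -/(op _ _).
rewrite inner_delta; apply: eq_bigr => i _.
rewrite tlift_pure; last exact: bilin_lact.
by rewrite pol_evZ !pol_ev_mcoef -op_adj'.
Qed.

Lemma ract_mcoef Y w (xi eta : 'cV_(ir_dim (V w))) :
  right_act Y (mcoef A xi eta) = mcoef A xi (op Y eta).
Proof.
rewrite /right_act pol_D_mcoef tlift_sum; last exact: bilin_ract.
apply: pol_ext => X; rewrite pol_ev_sum pol_ev_mcoef -/(op _ _).
rewrite (op_adj' X) inner_delta; apply: eq_bigr => i _.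
rewrite tlift_pure; last exact: bilin_ract.
by rewrite pol_evZ !pol_ev_mcoef mulrC -(op_adj' X).
Qed.

Lemma pol_ev_lact X x Y : pol_ev (lact X x) Y = pol_ev x (X ** Y).
Proof.
move: x; apply: pol_ind => [|c x y hx hy|w xi eta].
- by rewrite (lin0 (lact_linear X)) !pol_ev0.
- by rewrite lact_linear !pol_ev_linear hx hy.
- by rewrite lact_mcoef !pol_ev_mcoef -!/(op _ _) -op_adj' opM.
Qed.

Lemma lactM X Y x : lact X (lact Y x) = lact (Y ** X) x.
Proof. by apply: pol_ext => Z; rewrite !pol_ev_lact amulA. Qed.

Lemma lact1 x : lact \1 x = x.
Proof. by apply: pol_ext => Z; rewrite !pol_ev_lact amul1l. Qed.

Lemma lact_linX x : is_linear (lact^~ x).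
Proof.
move=> c X Y; apply: pol_ext => Z; rewrite pol_ev_linear !pol_ev_lact.
by rewrite amulDl amulZl (pol_ev_linX x).
Qed.

Lemma right_actM X Y x : right_act X (right_act Y x) = right_act (X ** Y) x.
Proof.
move: x; apply: pol_ind => [|c x y hx hy|w xi eta].
- by rewrite !lin0 //; apply: right_act_linear.
- by rewrite !right_act_linear hx hy.
- by rewrite !ract_mcoef opM.
Qed.
Lemma right_act1 x : right_act \1 x = x.
Proof.
move: x; apply: pol_ind => [|c x y hx hy|w xi eta].
- by rewrite lin0 //; apply: right_act_linear.
- by rewrite right_act_linear hx hy.
- by rewrite ract_mcoef op1.
Qed.
Lemma right_act_linX x : is_linear ((@right_act R q L Hf V A)^~ x).
Proof.
move=> c X Y; rewrite /right_act /tlift /fsum scaler_sumr -big_split /=.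
apply: eq_bigr => p _; rewrite (pol_ev_linX p.2).
by rewrite scalerDl -![c *: (_ : C^o)]/(c * _) scalerA.
Qed.

(** Both sides insert Y into the middle leg of x_(1) (x) x_(2) (x) x_(3). A rule that produces <| on
    the second leg thus becomes a translation on the first. *)
Lemma lact_ract (M : lmodType C) (f : A -> A -> M) Y x : bilin f ->
  tlift (fun a b => f a (lact Y b)) (pol_D x) = tlift (fun a b => f (right_act Y a) b) (pol_D x).
Proof.
move=> bf; have b1 : bilin (fun a b => f a (lact Y b)).
  exact: (bilin_pre bf (@lin_id _ _) (lact_linear Y)).
have b2 : bilin (fun a b => f (right_act Y a) b).
  exact: (bilin_pre bf (right_act_linear Y) (@lin_id _ _)).
have lD := @pol_D_linear _ _ _ _ _ A.
move: x; apply: pol_ind => [|c x y hx hy|w xi eta].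
- by rewrite (lin0 lD) !(lin0 (tlift_linear _)).
- by rewrite lD (tlift_linear b1) (tlift_linear b2) hx hy.
rewrite pol_D_mcoef !tlift_sum //.
have fl := bilin_l _ bf; have fr := bilin_r _ bf.
have mcl u : mcoef A u eta = \sum_j inner u (delta_mx j 0) *: mcoef A (delta_mx j 0) eta.
  apply: pol_ext => X; rewrite pol_ev_sum pol_ev_mcoef inner_delta.
  by apply: eq_bigr => j _; rewrite pol_evZ pol_ev_mcoef.
have mcr v : mcoef A xi v = \sum_j inner (delta_mx j 0) v *: mcoef A xi (delta_mx j 0).
  apply: pol_ext => X; rewrite pol_ev_sum pol_ev_mcoef -/(op _ _) (op_adj' X) inner_delta.
  by apply: eq_bigr => j _; rewrite pol_evZ pol_ev_mcoef mulrC -(op_adj' X).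
transitivity (\sum_(i < ir_dim (V w)) \sum_(j < ir_dim (V w))
  inner (op (star Y) (delta_mx i 0)) (delta_mx j 0) *:
    f (mcoef A xi (delta_mx i 0)) (mcoef A (delta_mx j 0) eta)).
  apply: eq_bigr => i _; rewrite tlift_pure // lact_mcoef mcl (lin_sum _ _ _ (fr _)).
  by apply: eq_bigr => j _; rewrite (linZ _ _ (fr _)).
rewrite exchange_big; apply: eq_bigr => j _ /=; rewrite tlift_pure // ract_mcoef mcr.
rewrite (lin_sum _ _ _ (fl _)); apply: eq_bigr => i _.
by rewrite (linZ _ _ (fl _)) (op_adj' Y).
Qed.

Lemma lact_amul X x y :
  lact X (x ** y) = tlift (fun a b => lact a x ** lact b y) (D X).
Proof.
have [lD D1 DM] := D_hom Hf.
have bf : bilin (fun a b => pol_ev x a * pol_ev y b : C^o).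
  split=> [b|a] c u v; rewrite pol_ev_linX.
    by rewrite -![c *: (_ : C^o)]/(c * _) mulrDl mulrA.
  by rewrite -![c *: (_ : C^o)]/(c * _) mulrDr mulrCA.
apply: pol_ext => Y; rewrite pol_ev_lact pol_ev_mul DM.
rewrite [LHS](tlift_amul (M := C^o) _ _ bf) /tlift /fsum pol_ev_sum.
rewrite exchange_big; apply: eq_bigr => p _ /=.
by rewrite pol_ev_mul; apply: eq_bigr => p' _; rewrite !pol_ev_lact.
Qed.

Lemma bilin_lact_mul x y : bilin (fun a b => lact a x ** lact b y).
Proof.
split=> [b|a].
  exact: (lin_comp (amul_linl _) (lact_linX x)).
exact: (lin_comp (amul_linr _) (lact_linX y)).
Qed.

Lemma lactE_mul r x y :
  lact (E r) (x ** y) = lact (E r) x ** lact (K (alpha r)) y + x ** lact (E r) y.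
Proof.
have b := bilin_lact_mul x y.
by rewrite lact_amul D_E (linD _ _ (tlift_linear b)) !tlift_pure // lact1.
Qed.

Lemma lactK_bideg (y : P) l m x : bideg l m x -> lact (K y) x = qpow q (form y l) *: x.
Proof.
elim=> [w xi eta hxi heta|c u v _ hu _ hv].
  rewrite lact_mcoef star_uK (has_wtK _ hxi) -[_ *: xi]addr0 mcoef_antil.
  by rewrite mcoef0l addr0 qpow_conj.
by rewrite lact_linear hu hv scalerDr !scalerA mulrC.
Qed.

Lemma lactE_bideg r l m x : bideg l m x -> bideg (l - alpha r) m (lact (E r) x).
Proof.
elim=> [w xi eta hxi heta|c u v _ hu _ hv].
  by rewrite lact_mcoef; apply: bideg_mcoef => //; apply: has_wt_starE.
by rewrite lact_linear; apply: bideg_lin.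
Qed.

Lemma star_mcoef_ev w (xi eta : 'cV_(ir_dim (V w))) X :
  pol_ev (star (mcoef A xi eta)) X = inner eta (op (hp_S Hf X) xi).
Proof. exact: pol_ev_star. Qed.

Lemma lactK_star (y : P) x : lact (K y) (star x) = star (lact (K (- y)) x).
Proof.
move: x; apply: pol_ind => [|c u v hu hv|w xi eta].
- by rewrite (lin0 (lact_linear _)) star0 (lin0 (lact_linear _)).
- rewrite starD starZ lact_linear hu hv lact_linear starD starZ //.
- apply: pol_ext => X; rewrite pol_ev_lact star_mcoef_ev S_Kmul lact_mcoef.
  by rewrite star_mcoef_ev star_uK opM.
Qed.

(** In general the star of x, acted on by Y, is the star of x <| Y' with Y' the star of S(Y). For Y
    = E_r one has S(E_r) = - E_r K_(-alpha_r), whose star is - q^(alpha_r, alpha_r) F_r. *)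
Lemma lactE_star r x : lact (E r) (star x) =
  - (qpow q (form (alpha r) (alpha r)) *: star (lact (F r) x)).
Proof.
move: x; apply: pol_ind => [|c u v hu hv|w xi eta].
- by rewrite (lin0 (lact_linear _)) star0 (lin0 (lact_linear _)) scaler0 oppr0.
- rewrite starD starZ lact_linear hu hv lact_linear starD starZ.
  by rewrite scalerDr opprD !scalerA mulrC -scalerA scalerN.
- apply: pol_ext => X; rewrite pol_ev_lact star_mcoef_ev S_Emul lact_mcoef.
  rewrite -[- (qpow _ _ *: _)]scaleN1r !pol_evZ star_mcoef_ev star_uF.
  rewrite opNl -scaleN1r innerZr; congr (_ * _).
  rewrite uKE formNl opZl opZr innerZr mulrA -qpowD // subrr qpow0 mul1r.
  by rewrite -amulA opM.
Qed.
End LeftAction.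

(** * Commutation of pi(X) with Pol_q(K) *)

Section AmpTheory.
Variables (R : realType) (L : lie_datum R).
Notation C := R[i].
Notation P := (wlat (ld_I L)).
Variables (A : staralgType C) (deg : P -> A -> Prop).
Notation X := (mX deg).
Notation F := (mF deg).

Lemma mX_hom : is_star_hom X. Proof. exact: am_X (amp_rel_gen deg). Qed.
Lemma mX_lin : is_linear X. Proof. exact: ah_linear (sh_hom mX_hom). Qed.
Lemma mX1 : X \1 = \1. Proof. exact: ah_one (sh_hom mX_hom). Qed.
Lemma mXM x y : X (x ** y) = X x ** X y. Proof. exact: ah_mul (sh_hom mX_hom) x y. Qed.
Lemma mX_star x : X (star x) = star (X x). Proof. exact: sh_star mX_hom x. Qed.
Lemma mF1 : F (fun => 1) = \1. Proof. exact: am_F1 (amp_rel_gen deg). Qed.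
Lemma mF_lin c f g : F (fun x => c * f x + g x) = c *: F f + F g.
Proof. exact: am_Flin (amp_rel_gen deg) c f g. Qed.
Lemma mFM f g : F (fun x => f x * g x) = F f ** F g.
Proof. exact: am_FM (amp_rel_gen deg) f g. Qed.
Lemma mFX f l x : deg l x -> F f ** X x = X x ** F (fshift l f).
Proof. exact: am_FX (amp_rel_gen deg) f l x. Qed.
Lemma mF_ext f g : f =1 g -> F f = F g.
Proof. by move=> h; congr mF; apply/funext. Qed.
Lemma mF0 : F (fun => 0) = 0.
Proof.
rewrite -(addNr (F (fun => 0))) -scaleN1r -mF_lin; apply: mF_ext => x.
by rewrite mulr0 addr0.
Qed.
Lemma mFZ c f : F (fun x => c * f x) = c *: F f.
Proof. by rewrite -[RHS]addr0 -mF0 -mF_lin; apply: mF_ext => x; rewrite addr0. Qed.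
Lemma mFD f g : F (fun x => f x + g x) = F f + F g.
Proof. by rewrite -[F f]scale1r -mF_lin; apply: mF_ext => x; rewrite mul1r. Qed.
Lemma mF_sum (J : Type) (s : seq J) (f : J -> P -> C) :
  F (fun x => \sum_(j <- s) f j x) = \sum_(j <- s) F (f j).
Proof.
elim: s => [|j s IH].
  by rewrite big_nil -mF0; apply: mF_ext => x; rewrite big_nil.
by rewrite big_cons -IH -mFD; apply: mF_ext => x; rewrite big_cons.
Qed.
End AmpTheory.

(** * Commutation of k_w, l_w, e_r, f_r with Pol_q(K) and with functions *)

Section FextRelations.
Variables (R : realType) (q : R) (q_gt0 : 0 < q) (q_lt1 : q < 1) (L : lie_datum R).
Notation C := R[i].
Notation I := (ld_I L).
Notation P := (wlat (ld_I L)).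
Notation U := (Uqk q L).
Notation K := (uK q (L := L)).
Notation E := (uE q (L := L)).
Notation F := (uF q (L := L)).
Variables (Hf : uqk_hopf q L) (V : forall w : domw L, irrep q w) (A : polK Hf V).
Variables (w0 : seq I) (w0_longest : longest_word w0).
Notation xX := (@xX R q L Hf V A w0).
Notation deg := (@lwt_ext R q L Hf V A w0).
Implicit Types (x y : A) (w : P).

Definition ext_of (x : A) : Fext A w0 := mX deg (xX x).
Notation i_ := ext_of.

Lemma xX_lin : is_linear xX. Proof. exact: ah_linear (sh_hom (xX_hom A w0)). Qed.
Lemma xXM x y : xX (x ** y) = xX x ** xX y. Proof. exact: ah_mul (sh_hom (xX_hom A w0)) x y. Qed.
Lemma xX_star x : xX (star x) = star (xX x). Proof. exact: sh_star (xX_hom A w0) x. Qed.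
Lemma ext_of_lin : is_linear ext_of.
Proof. exact: (lin_comp (mX_lin _) xX_lin). Qed.
Lemma ext_ofM x y : i_ (x ** y) = i_ x ** i_ y.
Proof. by rewrite /ext_of xXM mXM. Qed.
Lemma ext_of_star x : i_ (star x) = star (i_ x).
Proof. by rewrite /ext_of xX_star mX_star. Qed.

Lemma xUX w x : xU A w0 w ** xX x = xX x ** xU A w0 w.
Proof.
apply: pres_ext => B g r; have [[_ _ pM] _] := plift_hom r.
by rewrite !pM !plift_gen // (ex_UX r).
Qed.

Lemma z_ext_of w l m x : bideg l m x ->
  i_ x ** mF deg (zfun q w) = qpow q (form w l) *: (mF deg (zfun q w) ** i_ x).
Proof.
move=> hx; rewrite /ext_of (mFX (zfun q w) (lwt_X w0 hx)) -amulZr -mFZ.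
congr (_ ** _); apply: mF_ext => y; rewrite /fshift /zfun -qpowD //.
by rewrite formBr addrC subrK.
Qed.

Lemma ext_of_ind (f g : A -> Fext A w0) :
  is_linear f -> is_linear g -> (forall l m x, bideg l m x -> f x = g x) -> f =1 g.
Proof.
move=> lf lg h; apply: (bideg_ind q_gt0) => [|c x y hx hy|l m x hx].
- by rewrite !lin0.
- by rewrite lf lg hx hy.
- exact: h hx.
Qed.

Lemma ext_of_kk w y : i_ y ** kk A w0 w = kk A w0 w ** i_ (lact (K w) y).
Proof.
move: y; apply: ext_of_ind.
- by move=> c x x'; rewrite ext_of_lin amulDl amulZl.
- by move=> c x x'; rewrite lact_linear ext_of_lin amulDr amulZr.
move=> l m y hy; rewrite (lactK_bideg w hy) (linZ _ _ ext_of_lin) /kk.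
rewrite amulZl !amulZr; congr (_ *: _).
rewrite amulA (z_ext_of w hy) amulZl -!amulA; congr (_ *: (_ ** _)).
by rewrite /ext_of -!mXM xUX.
Qed.

Lemma ext_of_ll w y : i_ y ** ll A w0 w = ll A w0 w ** i_ (lact (K w) y).
Proof.
move: y; apply: ext_of_ind.
- by move=> c x x'; rewrite ext_of_lin amulDl amulZl.
- by move=> c x x'; rewrite lact_linear ext_of_lin amulDr amulZr.
move=> l m y hy; rewrite (lactK_bideg w hy) (linZ _ _ ext_of_lin) /ll.
rewrite amulZl !amulZr; congr (_ *: _).
rewrite amulA {1}/ext_of -mXM -xUX mXM -/(ext_of _) -amulA (z_ext_of w hy).
by rewrite amulZr amulA.
Qed.

Lemma bE_lact r : bE A w0 r = lact (E r) (b_ A w0 (fundd L r)).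
Proof. by rewrite lact_mcoef. Qed.

Lemma form_alpha_fundw r : form (alpha r) (fundw L r) = form (alpha r) (alpha r) / 2.
Proof. by rewrite form_sym form_fundw eqxx mul1r. Qed.

Lemma b_bideg (w : domw L) : bideg (dw w) (wact L w0 w) (b_ A w0 w).
Proof. by apply: bideg_mcoef; [apply: has_wt_xi | apply: has_wt_low]. Qed.

(* [E r] acts on both sides of [b_comm]. *)
Lemma bE_comm r l m x : bideg l m x ->
  (1 - qr q r ^+ 2) *: (b_ A w0 (fundd L r) ** lact (E r) x) =
  qpow q (form (fundw L r) (l - wact L w0 m)) *: (x ** bE A w0 r)
  - qpow q (form (alpha r) l) *: (bE A w0 r ** x).
Proof.
move=> hx; set b := b_ A w0 _; set c := qpow q (form (fundw L r) _).
have e1 := congr1 (lact (E r)) (b_comm q_gt0 q_lt1 w0_longest (fundd L r) hx).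
rewrite -/b (linZ _ _ (lact_linear _)) !lactE_mul -bE_lact in e1.
rewrite (lactK_bideg _ hx) (lactK_bideg _ (b_bideg (fundd L r))) in e1.
have := b_comm q_gt0 q_lt1 w0_longest (fundd L r) (lactE_bideg q_gt0 r hx).
rewrite -/b => e2.
(* E_r lowers the left weight by alpha_r, so the constant for [lact (E r) x] differs from [c] by
   q^(-(varpi_r, alpha_r)). *)
have e3 : c *: (lact (E r) x ** b) = qpow q (form (alpha r) (fundw L r)) *: (b ** lact (E r) x).
  rewrite e2 scalerA -qpowD //; congr (qpow q _ *: _).
  rewrite (form_sym (alpha r)) -form_addr; congr (form _ _).
  by rewrite !addrA [_ + l]addrC addrK.
rewrite !amulZr scalerDr scalerA mulrC -scalerA e3 scalerA -qpowD // in e1.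
(* One factor q^(alpha_r, varpi_r) comes from K_(alpha_r) acting on b and one from [e3]; together
   they give q_r^2. *)
rewrite scalerBl scale1r qrE -qpowMn // mulr2n -form_alpha_fundw.
apply/eqP; rewrite subr_eq addrAC [X in X - _]addrC.
by rewrite [X in X - _](esym e1) [X in X - _]addrC addrK.
Qed.

Lemma qr2_neq1 (r : I) : 1 - qr q r ^+ 2 != 0 :> C.
Proof. by rewrite subr_eq0 eq_sym qr_exp_neq1. Qed.

Lemma ext_of_ee r y : i_ y ** ee A w0 r =
  ee A w0 r ** i_ (lact (K (alpha r)) y) + i_ (lact (E r) y).
Proof.
move: y; apply: ext_of_ind.
- by move=> c x x'; rewrite ext_of_lin amulDl amulZl.
- apply: lin_add; last exact: (lin_comp ext_of_lin (lact_linear _)).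
  by move=> c x x'; rewrite lact_linear ext_of_lin amulDr amulZr.
move=> l m x hx; rewrite (lactK_bideg _ hx) (linZ _ _ ext_of_lin) /ee.
set b := b_ A w0 (fundd L r); set d := binv A w0 (fundd L r).
have [db bd] := binvE A w0 (fundd L r); rewrite -/d -/b in db bd.
set c := qpow q (form (fundw L r) (l - wact L w0 m)).
(* The relation for b multiplied by its inverse from both sides. *)
have xd : xX x ** d = c *: (d ** xX x).
  have := congr1 (fun y => d ** xX y ** d) (b_comm q_gt0 q_lt1 w0_longest (fundd L r) hx).
  rewrite -/b (linZ _ _ xX_lin) !xXM amulZr amulZl !amulA db amul1l => ->.
  by rewrite -!amulA bd amul1r.
have key : xX x ** (d ** xX (bE A w0 r)) =
    qpow q (form (alpha r) l) *: (d ** xX (bE A w0 r) ** xX x) +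
    (1 - qr q r ^+ 2) *: xX (lact (E r) x).
  have := congr1 (fun y => d ** xX y) (bE_comm r hx).
  rewrite -/b -/c (linZ _ _ xX_lin) (linD _ _ xX_lin) (linN _ xX_lin).
  rewrite !(linZ _ _ xX_lin) !xXM amulDr amulNr !amulZr !amulA db amul1l.
  by rewrite -(amulZl c) -xd => ->; rewrite addrC subrK amulA.
rewrite amulZr {1}/ext_of -mXM key (mX_lin _) scalerDr (linZ _ _ (mX_lin _)) !scalerA.
rewrite mulVf ?qr2_neq1 // scale1r -/(ext_of _) mXM amulZl amulZr.
by rewrite !scalerA mulrC.
Qed.

Lemma ext_of_starE r x : i_ x ** star (ee A w0 r) =
  star (ee A w0 r) ** i_ (lact (K (alpha r)) x) + i_ (lact (F r ** K (alpha r)) x).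
Proof.
(* With this choice K_(alpha_r) sends [star y] to [star x], since the star turns K_(alpha_r) into
   K_(-alpha_r). *)
set y := lact (K (alpha r)) x.
have := ext_of_ee r (star y); move: (ee A w0 r) => e /(congr1 star).
rewrite starM starD starM -!ext_of_star lactK_star lactE_star // starN starZ qpow_conj !starK.
rewrite (linN _ ext_of_lin) (linZ _ _ ext_of_lin).
rewrite /y !lactM uKM subrr uK0 lact1 uKF (linZ _ _ (lact_linX x)).
rewrite (linZ _ _ ext_of_lin) scalerA -qpowD // subrr qpow0 scale1r => ->.
by rewrite subrK.
Qed.

Lemma ext_of_ff r x : i_ x ** ff A w0 r =
  ff A w0 r ** i_ x + ll A w0 (- alpha r) ** i_ (lact (F r) x).
Proof.
rewrite /ff amulA ext_of_starE amulDl -!amulA !ext_of_ll !lactM.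
rewrite -amulA !uKM subrr uK0 lact1 amul1r.
by [].
Qed.

(** The degree with respect to functions on P: such a [z] maps M_chi to M_(chi - d), see
    [supported_shift]. *)
Definition shifts (d : P) (z : Fext A w0) : Prop :=
  forall f, mF deg f ** z = z ** mF deg (fshift d f).

Lemma shiftsZ c d z : shifts d z -> shifts d (c *: z).
Proof. by move=> h f; rewrite amulZl amulZr h. Qed.
Lemma shiftsM d d' z z' : shifts d z -> shifts d' z' -> shifts (d + d') (z ** z').
Proof.
move=> h h' f; rewrite amulA h -amulA h' amulA; congr (_ ** _); apply: mF_ext => x.
by rewrite /fshift opprD addrA addrAC.
Qed.
Lemma shifts_mX d z : lwt_ext d z -> shifts d (mX deg z).
Proof. by move=> h f; apply: mFX. Qed.
Lemma shifts_mF g : shifts 0 (mF deg g).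
Proof.
by move=> f; rewrite -!mFM; apply: mF_ext => x; rewrite /fshift subr0 mulrC.
Qed.
Lemma mF_star f : star (mF deg f) = mF deg (fun x : P => (f x)^*).
Proof. exact: esym (am_Fstar (amp_rel_gen deg) f). Qed.
Lemma shifts_star d z : shifts d z -> shifts (- d) (star z).
Proof.
move=> h f; have := congr1 star (h (fun x : P => (fshift (- d) f x)^*)).
rewrite !starM !mF_star => e; transitivity
  (mF deg (fun x : P => (fshift d (fun x : P => (fshift (- d) f x)^*) x)^*) ** star z).
  congr (_ ** _); apply: mF_ext => x.
  by rewrite /fshift cjK opprK subrK.
by rewrite -e; congr (_ ** _); apply: mF_ext => x; rewrite cjK.
Qed.

Lemma shifts_kk w : shifts (- w) (kk A w0 w).
Proof.
apply: shiftsZ; have := shiftsM (shifts_mF (zfun q w)) (shifts_mX (lwt_U A w0 (- w))).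
by rewrite add0r.
Qed.
Lemma shifts_ll w : shifts w (ll A w0 w).
Proof.
apply: shiftsZ; have := shiftsM (shifts_mX (lwt_U A w0 w)) (shifts_mF (zfun q w)).
by rewrite addr0.
Qed.
Lemma shifts_ee r : shifts (- alpha r) (ee A w0 r).
Proof.
apply/shiftsZ/shifts_mX.
have -> : - alpha r = 0 + - fundw L r + (fundw L r - alpha r) :> P.
  by rewrite add0r addKr.
apply: lwt_mul; first by apply: lwt_mul; [apply: lwt_B | apply: lwt_U].
by rewrite bE_lact; apply: (lwt_X w0 (lactE_bideg q_gt0 r (b_bideg (fundd L r)))).
Qed.
Lemma shifts_ff r : shifts 0 (ff A w0 r).
Proof.
have := shiftsM (shifts_star (shifts_ee r)) (shifts_ll (- alpha r)).
by rewrite opprK subrr.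
Qed.

End FextRelations.

(** * The coaction gamma and V_0 *)

Section OrthogonalIdempotents.
Variables (C : numClosedFieldType) (B : ualgType C) (J : eqType) (e : J -> B).
Hypothesis eM : forall i j, e i ** e j = (i == j)%:R *: e i.

Lemma idem_split (s : seq J) j : j \in s -> (\sum_(i <- undup s) e i) ** e j = e j.
Proof.
move=> js; rewrite amul_suml (bigD1_seq j) ?mem_undup ?undup_uniq //=.
rewrite big1 ?addr0 ?eM ?eqxx ?scale1r // => i /negbTE ij.
by rewrite eM ij scale0r.
Qed.

Lemma idem_split' (s : seq J) j : j \in s -> e j ** (\sum_(i <- undup s) e i) = e j.
Proof.
move=> js; rewrite amul_sumr (bigD1_seq j) ?mem_undup ?undup_uniq //=.
rewrite big1 ?addr0 ?eM ?eqxx ?scale1r // => i /negbTE ij.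
by rewrite eM eq_sym ij scale0r.
Qed.

(** Only finitely many idempotents occur in an expression of [d], and their sum is a left unit for
    [d]. *)
Lemma idem_sepl d : in_span (fun z => exists j d', z = e j ** d') d ->
  (forall j, e j ** d = 0) -> d = 0.
Proof.
move=> [s hs dE] d0.
have [l hl] : exists l : seq J, {in s, forall p : C * B, exists2 j, j \in l & exists d', p.2 = e j ** d'}.
  elim: s hs {dE} => [_|p s IH hs]; first by exists [::].
  have [l hl] : exists l : seq J, {in s, forall p : C * B,
      exists2 j, j \in l & exists d', p.2 = e j ** d'}.
    by apply: IH => r rs; apply: hs; rewrite inE rs orbT.
  have [j [d' pE]] := hs p (mem_head _ _).
  exists (j :: l) => r; rewrite inE => /orP [/eqP ->|/hl [j' jl hj']].
    by exists j; [rewrite mem_head | exists d'].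
  by exists j' => //; rewrite inE jl orbT.
have <- : (\sum_(i <- undup l) e i) ** d = d.
  rewrite {1}dE amul_sumr [RHS]dE big_seq [RHS]big_seq; apply: eq_bigr => p ps.
  by have [j jl [d' ->]] := hl p ps; rewrite amulZr amulA idem_split.
by rewrite amul_suml big1 // => j _; apply: d0.
Qed.

Lemma idem_sepr d : in_span (fun z => exists j d', z = d' ** e j) d ->
  (forall j, d ** e j = 0) -> d = 0.
Proof.
move=> [s hs dE] d0.
have [l hl] : exists l : seq J, {in s, forall p : C * B, exists2 j, j \in l & exists d', p.2 = d' ** e j}.
  elim: s hs {dE} => [_|p s IH hs]; first by exists [::].
  have [l hl] : exists l : seq J, {in s, forall p : C * B,
      exists2 j, j \in l & exists d', p.2 = d' ** e j}.
    by apply: IH => r rs; apply: hs; rewrite inE rs orbT.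
  have [j [d' pE]] := hs p (mem_head _ _).
  exists (j :: l) => r; rewrite inE => /orP [/eqP ->|/hl [j' jl hj']].
    by exists j; [rewrite mem_head | exists d'].
  by exists j' => //; rewrite inE jl orbT.
have <- : d ** (\sum_(i <- undup l) e i) = d.
  rewrite {1}dE amul_suml [RHS]dE big_seq [RHS]big_seq; apply: eq_bigr => p ps.
  by have [j jl [d' ->]] := hl p ps; rewrite amulZl -amulA idem_split'.
by rewrite amul_sumr big1 // => j _; apply: d0.
Qed.
End OrthogonalIdempotents.

Section AmpC.
Variables (R : realType) (L : lie_datum R).
Notation C := R[i].
Notation P := (wlat (ld_I L)).
Implicit Types (w : P) (f : P -> C).

Lemma finsupp_dirac w : finsupp_fun (@fdirac R L w).
Proof. by exists [:: w] => x; rewrite inE /fdirac => /negbTE ->. Qed.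
Lemma finsupp_shift w f : finsupp_fun f -> finsupp_fun (fshift w f).
Proof.
move=> [s hs]; exists [seq x + w | x <- s] => x hx; apply: hs; apply: contra hx.
by move=> h; apply/mapP; exists (x - w); rewrite ?subrK.
Qed.
Lemma finsupp_expand f s : (forall x, x \notin s -> f x = 0) ->
  f =1 (fun x => \sum_(w <- undup s) f w * fdirac w x).
Proof.
move=> hs x; have [xs|xs] := boolP (x \in s).
  rewrite (bigD1_seq x) ?mem_undup ?undup_uniq //= /fdirac eqxx mulr1.
  by rewrite big1 ?addr0 // => w /negbTE wx; rewrite eq_sym wx mulr0.
rewrite hs // big1_seq // => w; rewrite mem_undup => /andP [_ ws].
rewrite /fdirac; case: eqP => [xw|_]; last by rewrite mulr0.
by move: xs; rewrite xw ws.
Qed.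

Variables (A : staralgType C) (deg : P -> A -> Prop).
Notation X := (mX deg).
Notation F := (mF deg).

Lemma mF_dirac f w : F f ** F (fdirac w) = f w *: F (fdirac w).
Proof.
rewrite -mFM -mFZ; apply: mF_ext => x; rewrite /fdirac.
by case: eqP => [->//|_]; rewrite !mulr0.
Qed.
Lemma mF_dirac' f w : F (fdirac w) ** F f = f w *: F (fdirac w).
Proof. by rewrite -mF_dirac -!mFM; apply: mF_ext => x; rewrite mulrC. Qed.
Lemma mF_dirac2 w w' : F (fdirac w) ** F (fdirac w') = (w == w')%:R *: F (fdirac w).
Proof. by rewrite mF_dirac'. Qed.

Lemma mX_dirac x d w : deg d x -> X x ** F (fdirac w) = F (fdirac (w - d)) ** X x.
Proof.
move=> hx; rewrite (mFX _ hx); congr (_ ** _); apply: mF_ext => y.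
by rewrite /fshift /fdirac (inj_eq (addIr _)).
Qed.

(** The default 0 of [insubd] is never reached for finitely supported [f]; see [xfE]. *)
Definition xf (x : A) f : amp_c deg := insubd (0 : amp_c deg) (X x ** F f).

Definition spv (a : amp_c deg) : amp deg := spval a.

Lemma xfE x f : finsupp_fun f -> spv (xf x f) = X x ** F f.
Proof.
move=> hf; rewrite -[spv _]/(val _) insubdK //; apply/asboolP.
by apply: in_span_gen; exists x, f.
Qed.

Lemma spv_inj : injective spv.
Proof. exact: val_inj. Qed.
Lemma spv_lin : is_linear spv.
Proof. by move=> c x y; exact: (linearP (val : amp_c deg -> amp deg) c x y). Qed.

Lemma xf_linl f : finsupp_fun f -> is_linear (xf^~ f).
Proof.
move=> hf c x y; apply: spv_inj; rewrite spv_lin !xfE //.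
by rewrite mX_lin amulDl amulZl.
Qed.

Lemma amp_c_span (Q : A -> Prop) : (forall x, in_span Q x) -> forall a : amp_c deg,
  in_span (fun u => exists x w, Q x /\ u = xf x (fdirac w)) a.
Proof.
move=> hQ a; have spf x w : in_span (fun u => exists x w, Q x /\ u = xf x (fdirac w))
    (xf x (fdirac w)).
  elim/in_span_ind: x / (hQ x) => [|c x y hx hy|x Qx].
  - by rewrite (lin0 (xf_linl (finsupp_dirac w))); apply: in_span0.
  - by rewrite (xf_linl (finsupp_dirac w)); apply: in_span_lin.
  - by apply: in_span_gen; exists x, w.
have [s hs aE] : in_span (fun y : amp deg => exists x f, finsupp_fun f /\ y = X x ** F f) (spv a).
  by case: a => a /= /asboolP.
have -> : a = \sum_(p <- s) p.1 *: insubd (0 : amp_c deg) p.2.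
  apply: spv_inj => /=; rewrite aE (lin_sum _ _ _ spv_lin) big_seq [RHS]big_seq.
  apply: eq_bigr => p ps; rewrite (linZ _ _ spv_lin); congr (_ *: _).
  by have [x [f [hf ->]]] := hs p ps; rewrite -[insubd _ _]/(xf x f) xfE.
elim: s hs {aE} => [_|p s IH hs]; first by rewrite big_nil; apply: in_span0.
rewrite big_cons; apply: in_span_lin; last first.
  by apply: IH => r rs; apply: hs; rewrite inE rs orbT.
have [x [f [[t ht] ->]]] := hs p (mem_head _ _); rewrite -/(xf x f).
have -> : xf x f = \sum_(w <- undup t) f w *: xf x (fdirac w).
  apply: spv_inj => /=; rewrite xfE; last by exists t.
  rewrite (lin_sum _ _ _ spv_lin) (mF_ext _ (finsupp_expand ht)) mF_sum amul_sumr.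
  apply: eq_bigr => w _; rewrite (linZ _ _ spv_lin) xfE; last exact: finsupp_dirac.
  by rewrite mFZ amulZr.
elim: (undup t) => [|w l IHl]; first by rewrite big_nil; apply: in_span0.
by rewrite big_cons; apply: in_span_lin.
Qed.
End AmpC.

(** * The multiplier gamma(x f) times 1 (x) delta_chi *)

Section Gamma.
Variables (R : realType) (q : R) (q_gt0 : 0 < q) (L : lie_datum R).
Notation C := R[i].
Notation P := (wlat (ld_I L)).
Variables (Hf : uqk_hopf q L) (V : forall w : domw L, irrep q w) (A : polK Hf V).
Notation dp := (@deg_plus R q L Hf V A).
Notation dz := (@deg_zero R q L Hf V A).
Notation S := (tens (Fplus_c A) (Fzero_c A)).
Notation B := (tens (Fplus A) (Fzero A)).
Notation emb := (@emb R q L Hf V A).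
Notation point := (@point R q L Hf V A).

Definition pt (p : P * P) : B := point p.1 p.2.

Lemma emb_lin : is_linear emb.
Proof. exact: (tmap_linear (@spv_lin _ _ _ dp) (@spv_lin _ _ _ dz)). Qed.
Lemma emb_pure (a : Fplus_c A) (b : Fzero_c A) : emb (pure a b) = pure (spv a) (spv b).
Proof. exact: (tmap_pure _ _ (@spv_lin _ _ _ dp) (@spv_lin _ _ _ dz)). Qed.

Lemma ptM i j : pt i ** pt j = (i == j)%:R *: pt i.
Proof.
rewrite /pt /Defs.point pureM !mF_dirac2 pureZl pureZr scalerA -natrM mulnb.
by rewrite -xpair_eqE -!surjective_pairing.
Qed.

(** Dirac functions stand on the right in the spanning elements. They pass to the left, shifted by
    the degree, when the factor from Pol_q(K) is homogeneous, hence the use of [bideg_span]. *)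
Lemma emb_left (s : S) : in_span (fun z => exists j d', z = pt j ** d') (emb s).
Proof.
have hp := amp_c_span (deg := dp) (bideg_span q_gt0 (A := A)).
have hz := amp_c_span (deg := dz) (bideg_span q_gt0 (A := A)).
elim/in_span_ind: s / (tens_span hp hz s) => [|c x y hx hy|_ [a [b [[x [w [[l [m hx]] ->]]] [y [v [[l' [m' hy]] ->]]] ->]]]].
- by rewrite (lin0 emb_lin); apply: in_span0.
- by rewrite emb_lin; apply: in_span_lin.
apply: in_span_gen; rewrite emb_pure !xfE; try exact: finsupp_dirac.
have e1 := @mX_dirac _ _ _ dp x (l - m) w (ex_intro _ l (ex_intro _ m (conj hx erefl))).
have e2 := @mX_dirac _ _ _ dz y l' v (ex_intro _ m' hy).
exists (w - (l - m), v - l'), (pure (mX dp x) (mX dz y)).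
by rewrite pureM e1 e2.
Qed.

Lemma emb_right (s : S) : in_span (fun z => exists j d', z = d' ** pt j) (emb s).
Proof.
have hp := amp_c_span (deg := dp) (bideg_span q_gt0 (A := A)).
have hz := amp_c_span (deg := dz) (bideg_span q_gt0 (A := A)).
elim/in_span_ind: s / (tens_span hp hz s) => [|c x y hx hy|_ [a [b [[x [w [_ ->]]] [y [v [_ ->]]] ->]]]].
- by rewrite (lin0 emb_lin); apply: in_span0.
- by rewrite emb_lin; apply: in_span_lin.
apply: in_span_gen; rewrite emb_pure !xfE; try exact: finsupp_dirac.
by exists (w, v), (pure (mX dp x) (mX dz y)); rewrite pureM.
Qed.

(* [Delta(f) (1 (x) delta_chi) = f(. + chi) (x) delta_chi] *)
Variables (f : P -> C) (hf : finsupp_fun f) (chi : P).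
Definition shift_delta : B := pure (mF dp (fshift (- chi) f)) (mF dz (fdirac chi)).

Lemma pt_shift_delta j : pt j ** shift_delta = ((j.2 == chi)%:R * f (j.1 + chi)) *: pt j.
Proof.
rewrite /pt /Defs.point /shift_delta pureM mF_dirac' mF_dirac2 pureZl pureZr.
by rewrite scalerA mulrC /fshift opprK.
Qed.
Lemma shift_delta_pt j : shift_delta ** pt j = ((j.2 == chi)%:R * f (j.1 + chi)) *: pt j.
Proof.
rewrite /pt /Defs.point /shift_delta pureM mF_dirac mF_dirac2 pureZl pureZr.
rewrite scalerA mulrC /fshift opprK eq_sym.
by case: eqP => [->|]; rewrite // !mul0r !scale0r.
Qed.

Lemma pt_delta j : pt j ** pure \1 (mF dz (fdirac chi)) = (j.2 == chi)%:R *: pt j.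
Proof. by rewrite /pt /Defs.point pureM amul1r mF_dirac2 pureZr. Qed.

Lemma delta_pt j : pure \1 (mF dz (fdirac chi)) ** pt j = (j.2 == chi)%:R *: pt j.
Proof.
rewrite /pt /Defs.point pureM amul1l mF_dirac2 pureZr eq_sym.
by case: eqP => [->|]; rewrite // !scale0r.
Qed.

Lemma in_span_amulr (Q : B -> Prop) (z d : B) :
  (forall y, Q y -> in_span Q (y ** d)) -> in_span Q z -> in_span Q (z ** d).
Proof.
move=> h; elim/in_span_ind => [|c x y hx hy|x]; last exact: h.
  by rewrite amul0l; apply: in_span0.
by rewrite amulDl amulZl; apply: in_span_lin.
Qed.

Lemma left_span z d : in_span (fun z => exists j d', z = pt j ** d') z ->
  in_span (fun z => exists j d', z = pt j ** d') (z ** d).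
Proof.
apply: in_span_amulr => _ [j [d' ->]]; apply: in_span_gen.
by exists j, (d' ** d); rewrite amulA.
Qed.

Lemma right_span z d : in_span (fun z => exists j d', z = d' ** pt j) z ->
  in_span (fun z => exists j d', z = d' ** pt j) (d ** z).
Proof.
elim/in_span_ind => [|c x y hx hy|_ [j [d' ->]]].
- by rewrite amul0r; apply: in_span0.
- by rewrite amulDr amulZr; apply: in_span_lin.
by apply: in_span_gen; exists j, (d ** d'); rewrite amulA.
Qed.

Lemma shift_delta_expand : exists s : seq P,
  shift_delta = \sum_(w <- s) fshift (- chi) f w *: pt (w, chi).
Proof.
have [s hs] := finsupp_shift (- chi) hf; exists (undup s).
rewrite /shift_delta (mF_ext _ (finsupp_expand hs)) mF_sum (lin_sum _ _ _ (pure_linl _)).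
by apply: eq_bigr => w _; rewrite mFZ pureZl.
Qed.

Lemma span_sumE (Q : B -> Prop) (J : Type) (s : seq J) (F : J -> B) :
  (forall j, in_span Q (F j)) -> in_span Q (\sum_(j <- s) F j).
Proof.
move=> h; elim: s => [|j s IH]; first by rewrite big_nil; apply: in_span0.
by rewrite big_cons -[F j]scale1r; apply: in_span_lin.
Qed.

Lemma shift_delta_left : in_span (fun z => exists j d', z = pt j ** d') shift_delta.
Proof.
have [s ->] := shift_delta_expand; apply: span_sumE => w.
rewrite -[_ *: _]addr0; apply: in_span_lin; last exact: in_span0.
by apply: in_span_gen; exists (w, chi), \1; rewrite amul1r.
Qed.
Lemma shift_delta_right : in_span (fun z => exists j d', z = d' ** pt j) shift_delta.
Proof.
have [s ->] := shift_delta_expand; apply: span_sumE => w.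
rewrite -[_ *: _]addr0; apply: in_span_lin; last exact: in_span0.
by apply: in_span_gen; exists (w, chi), \1; rewrite amul1l.
Qed.

Variables (x : A) (m mx mf : multiplier emb).
Hypothesis hmx : mult_is_elt mx (tmap (mX dp) (mX dz) (pol_D x) : B).
Hypothesis hmf : mult_is_fun mf (fun w x => f (w + x)).
Hypothesis hm : mult_is_prod m mx mf.

(** The tensor x_(1) f(. + chi) (x) x_(2) delta_chi, which is to represent gamma(x f)(1 (x)
    delta_chi). *)
Definition gamma_delta : S :=
  tlift (fun a b => pure (xf dp a (fshift (- chi) f)) (xf dz b (fdirac chi))) (pol_D x).

Lemma emb_gamma_delta :
  emb gamma_delta = tmap (mX dp) (mX dz) (pol_D x) ** shift_delta.
Proof.
rewrite /gamma_delta (lin_tlift _ _ emb_lin) (lin_tlift _ _ (amul_linl shift_delta)).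
apply: eq_tlift => a b; rewrite emb_pure !xfE ?pureM //; first exact: finsupp_dirac.
exact: finsupp_shift.
Qed.

(** The multiplier [mf] is known only through its products with the points of P x P, so both
    identities are tested on those points. This is conclusive because the elements compared involve
    finitely many of them on the relevant side. *)
Lemma gamma_times_delta : mult_times_elt m (pure \1 (mF dz (fdirac chi))) gamma_delta.
Proof.
have [hl hr] := hm; split=> [s s' hs'|s].
  rewrite hl /= (hmx _).1 emb_gamma_delta -amulA; congr (_ ** _).
  apply/eqP; rewrite -subr_eq0; apply/eqP; apply: (idem_sepl ptM).
    rewrite addrC -scaleN1r; apply: in_span_lin; last exact: emb_left.
    exact/left_span/shift_delta_left.
  move=> j; rewrite amulBr (hmf j.1 j.2 s').1 -/(pt j) hs' !amulA.
  rewrite pt_delta pt_shift_delta !amulZl scalerA mulrC.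
  case: eqP => [->|_]; last by rewrite !mul0r subrr.
  by rewrite subrr.
rewrite hr /= emb_gamma_delta amulA -(hmx _).2; move: (mr mx s) => s1.
apply/eqP; rewrite -subr_eq0; apply/eqP; apply: (idem_sepr ptM).
  rewrite addrC -scaleN1r; apply: in_span_lin.
    exact/right_span/shift_delta_right.
  apply: in_span_amulr (emb_right _) => _ [j [d' ->]]; rewrite -amulA pt_delta amulZr.
  rewrite -[_ *: _]addr0; apply: in_span_lin; last exact: in_span0.
  by apply: in_span_gen; exists j, d'.
move=> j; rewrite amulBl -!amulA delta_pt shift_delta_pt !amulZr.
rewrite (hmf j.1 j.2 s1).2 -/(pt j) scalerA.
case: eqP => [->|_]; last by rewrite !mul0r subrr.
by rewrite subrr.
Qed.

End Gamma.

(** * V_0 on weight vectors of the module *)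

Section V0Formula.
Variables (R : realType) (q : R) (q_gt0 : 0 < q) (L : lie_datum R).
Notation C := R[i].
Notation P := (wlat (ld_I L)).
Variables (Hf : uqk_hopf q L) (V : forall w : domw L, irrep q w) (A : polK Hf V).
Variable w0 : seq (ld_I L).
Notation dp := (@deg_plus R q L Hf V A).
Notation dz := (@deg_zero R q L Hf V A).
Notation dx := (@lwt_ext R q L Hf V A w0).
Variables (gamma : Fzero_c A -> multiplier (@emb R q L Hf V A)) (gamma_spec : is_gamma gamma).
Variables (M : lmodType C) (act : Fext A w0 -> M -> M) (act_module : is_module act).
Variables (V0 : tens (Fzero_c A) M -> tens (Fplus_c A) M) (V0_spec : is_V0 act gamma V0).

Lemma act_linl v : is_linear (act^~ v). Proof. exact: mod_linl act_module v. Qed.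
Lemma act_linr a : is_linear (act a). Proof. exact: mod_linr act_module a. Qed.
Lemma actM a b v : act (a ** b) v = act a (act b v). Proof. exact: mod_mul act_module a b v. Qed.

Lemma Fzero_ext_rel : amp_rel dz (fun z => match z with
  | aX x => mX dx (xX w0 x) | aF f => mF dx f end).
Proof.
split; first split; first split.
- exact: ext_of_lin.
- by rewrite (ah_one (sh_hom (xX_hom A w0))) mX1.
- exact: ext_ofM.
- exact: ext_of_star.
- exact: mF1.
- exact: mF_lin.
- exact: mFM.
- exact: am_Fstar (amp_rel_gen dx).
- by move=> f l x [m h]; apply: mFX; apply: lwt_X h.
Qed.

Lemma Fzero_extX x f : Fzero_ext w0 (mX dz x ** mF dz f) = ext_of w0 x ** mF dx f.
Proof.
rewrite (ah_mul (sh_hom (Fzero_ext_hom A w0))).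
by rewrite /Fzero_ext !plift_gen //; apply: Fzero_ext_rel.
Qed.

Lemma act_c_xf x f v : finsupp_fun f ->
  act_c act (xf dz x f) v = act (ext_of w0 x) (act (mF dx f) v).
Proof.
by move=> hf; rewrite /act_c -[spval _]/(spv _) xfE // Fzero_extX actM.
Qed.

Lemma act_c_linl v : is_linear (fun y => act_c act y v).
Proof.
exact: (lin_comp (act_linl v)
  (lin_comp (ah_linear (sh_hom (Fzero_ext_hom A w0))) (@spv_lin _ _ _ dz))).
Qed.
Lemma bilin_act_c v : bilin (fun (a : Fplus_c A) b => pure a (act_c act b v)).
Proof.
split=> [b c a a'|a c b b']; first exact: pureLl.
by rewrite act_c_linl pureLr.
Qed.

Definition supported (chi : P) (v : M) : Prop := act (mF dx (fdirac chi)) v = v.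

Lemma V0_formula x f chi v : finsupp_fun f -> supported chi v ->
  V0 (pure (xf dz x f) v) =
  tlift (fun a b => pure (xf dp a (fshift (- chi) f)) (act (ext_of w0 b) v)) (pol_D x).
Proof.
move=> hf hv; have hd := @finsupp_dirac R L chi.
have [_ hg] := gamma_spec; have [mx [mf [hmx hmf hm]]] := hg (xf dz x f) x f hf (xfE _ _ hf).
(* [is_V0] determines V_0 only on vectors of the form y v, so [v] is written as delta_chi v. *)
have e : act_c act (xf dz \1 (fdirac chi)) v = v.
  rewrite act_c_xf // hv /ext_of (ah_one (sh_hom (xX_hom A w0))) mX1.
  exact: mod_one act_module v.
have [_ h] := V0_spec; rewrite -{1}e (h _ _ (gamma_delta f chi x)).
  rewrite (lin_tlift _ _ (tlift_linear (bilin_act_c v))); apply: eq_tlift => a b.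
  by rewrite tlift_pure ?act_c_xf ?hv //; apply: bilin_act_c.
rewrite -[spval _]/(spv _) xfE // mX1 amul1l.
exact: gamma_times_delta hmx hmf hm.
Qed.

Lemma supported_shift chi d z v : shifts d z -> supported chi v ->
  supported (chi - d) (act z v).
Proof.
move=> hz hv; rewrite /supported -actM hz actM; congr (act z _).
rewrite -{2}hv; congr act; apply: mF_ext => x.
by rewrite /fshift /fdirac (inj_eq (addIr _)).
Qed.

Hypothesis nondeg : nondegenerate_act act.
(** By non-degeneracy M is spanned by vectors x delta_w v with x homogeneous; if l is the left
    weight of x, such a vector lies in M_(w - l). *)
Lemma supported_span v : in_span (fun u => exists chi, supported chi u) v.
Proof.
elim/in_span_ind: v / (nondeg v) => [|c x y|_ [y [v ->]]].
- exact: in_span0.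
- exact: in_span_lin.
have hz := amp_c_span (deg := dz) (bideg_span q_gt0 (A := A)) y.
elim/in_span_ind: y / hz => [|c x y hx hy|_ [x [w [[l [m hx]] ->]]]].
- by rewrite (lin0 (act_c_linl v)); apply: in_span0.
- by rewrite act_c_linl; apply: in_span_lin.
apply: in_span_gen; exists (w - l); rewrite act_c_xf; last exact: finsupp_dirac.
apply: (supported_shift (shifts_mX (lwt_X w0 hx))).
by rewrite /supported -actM mF_dirac2 eqxx scale1r.
Qed.

End V0Formula.

(** * The translation action *)

Lemma tmapM (C : numClosedFieldType) (A B A' B' : ualgType C) (f : A -> A') (g : B -> B')
    (x y : tens A B) : is_alg_hom f -> is_alg_hom g ->
  tmap f g (x ** y) = tmap f g x ** tmap f g y.
Proof.
move=> [fl _ fM] [gl _ gM]; have b := bilin_tmap fl gl.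
rewrite /tmap tlift_amul // (lin_tlift _ y (amul_linr _)); apply: eq_tlift => a' b'.
rewrite (lin_tlift _ x (amul_linl _)); apply: eq_tlift => a c.
by rewrite pureM fM gM.
Qed.

Section Translation.
Variables (R : realType) (q : R) (q_gt0 : 0 < q) (L : lie_datum R).
Notation C := R[i].
Notation I := (ld_I L).
Notation P := (wlat (ld_I L)).
Notation U := (Uqk q L).
Notation Up := (Uplus q L).
Variables (Hf : uqk_hopf q L) (V : forall w : domw L, irrep q w) (A : polK Hf V).
Notation dp := (@deg_plus R q L Hf V A).
Notation qd := (qd_plus q L).
Variables (Dp : Up -> tens Up Up) (Dp_spec : is_coproduct qd qd qd Dp).
Variables (pk : Up -> U) (pk_spec : is_pi_k pk).
Variables (pa : Up -> grpP L) (pa_spec : is_pi_a pa).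
Variables (rhd : Up -> Fplus_c A -> Fplus_c A) (rhd_spec : is_translation Dp pk pa rhd).

Lemma gUM w x : gU w ** gU x = gU (w + x) :> grpP L.
Proof.
apply: pres_ext => B g r; have [[_ _ pM] _] := plift_hom r.
by rewrite pM !plift_gen //; have [_ ->] := gr_mul r.
Qed.
Lemma gU0 : gU 0 = \1 :> grpP L.
Proof.
rewrite -pres_one; apply: pres_ext => B g r.
by rewrite plift_gen // plift_pres //; have [-> _] := gr_mul r.
Qed.
Lemma star_gU w : star (gU w) = gU (- w) :> grpP L.
Proof.
apply: pres_ext => B g r; have [_ ps] := plift_hom r.
by rewrite ps !plift_gen // (gr_star r).
Qed.

Lemma grp_span (x : grpP L) : in_span (fun y => exists w, y = gU w) x.
Proof.
have gen w : in_span (fun y : grpP L => exists w, y = gU w) (gU w).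
  by apply: in_span_gen; exists w.
move: x; apply: presented_ind => [||c x y|x y hx hy|w|w].
- exact: in_span0.
- by rewrite -gU0.
- exact: in_span_lin.
- elim/in_span_ind: x / hx => [|c x x' hx hx'|_ [w ->]].
  + by rewrite amul0l; apply: in_span0.
  + by rewrite amulDl amulZl; apply: in_span_lin.
  elim/in_span_ind: y / hy => [|c y y' hy hy'|_ [w' ->]].
  + by rewrite amul0r; apply: in_span0.
  + by rewrite amulDr amulZr; apply: in_span_lin.
  + by rewrite gUM.
- exact: gen.
- by rewrite -/(gU w) star_gU.
Qed.

(** Supplies the expansion along the U_w through which [is_translation] describes the action. *)
Lemma tens_grp (t : tens U (grpP L)) :
  exists s : seq (U * P), t = \sum_(p <- s) pure p.1 (gU p.2).
Proof.
have hU (x : U) : in_span (fun _ => True) x by apply: in_span_gen.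
elim/in_span_ind: t / (tens_span hU grp_span t) => [|c x y [s ->] [s' ->]|_ [x [_ [_ [w ->] ->]]]].
- by exists [::]; rewrite big_nil.
- exists ([seq (c *: p.1, p.2) | p <- s] ++ s').
  rewrite big_cat big_map scaler_sumr; congr (_ + _).
  by apply: eq_bigr => p _; rewrite pureZl.
- by exists [:: (x, w)]; rewrite big_seq1.
Qed.

Lemma legs_hom : is_alg_hom (fun X => tmap pk pa (Dp X)).
Proof.
have hk := pk_hom pk_spec; have ha := pa_hom pa_spec; have hD := cop_hom Dp_spec.
split.
- exact: (lin_comp (tmap_linear (ah_linear hk) (ah_linear ha)) (ah_linear hD)).
- rewrite (ah_one hD) tmap_pure; [|exact: ah_linear hk|exact: ah_linear ha].
  by rewrite (ah_one hk) (ah_one ha).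
- by move=> x y; rewrite (ah_mul hD) tmapM.
Qed.

Lemma rhd_xf X s x f : tmap pk pa (Dp X) = \sum_(p <- s) pure p.1 (gU p.2) ->
  finsupp_fun f ->
  rhd X (xf dp x f) = \sum_(p <- s) xf dp (right_act p.1 x) (fshift (- p.2) f).
Proof.
move=> hs hf; apply: (@spv_inj _ _ _ dp).
rewrite [LHS](tr_act rhd_spec hs hf (xfE dp x hf)).
rewrite (lin_sum _ _ _ (@spv_lin _ _ _ dp)); apply: eq_bigr => p _.
by rewrite xfE //; apply: finsupp_shift.
Qed.

Lemma Fplus_c_ext (M : lmodType C) (g h : Fplus_c A -> M) : is_linear g -> is_linear h ->
  (forall x f, finsupp_fun f -> g (xf dp x f) = h (xf dp x f)) -> g =1 h.
Proof.
move=> lg lh e a.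
have hA (x : A) : in_span (fun _ => True) x by apply: in_span_gen.
elim/in_span_ind: a / (amp_c_span (deg := dp) hA a) => [|c x y hx hy|_ [x [w [_ ->]]]].
- by rewrite !lin0.
- by rewrite lg lh hx hy.
- by apply: e; apply: finsupp_dirac.
Qed.

(** [is_translation] states linearity in the function argument. Linearity in X follows since
    expansions for X and Y, scaled and concatenated, form one for c X + Y. *)
Lemma rhd_linl a : is_linear (rhd^~ a).
Proof.
move=> c X Y; move: a; apply: Fplus_c_ext.
- exact: (tr_linear rhd_spec).
- by apply: lin_add; first apply: lin_scale; apply: (tr_linear rhd_spec).
move=> x f hf; have [s hs] := tens_grp (tmap pk pa (Dp X)).
have [s' hs'] := tens_grp (tmap pk pa (Dp Y)).
rewrite (rhd_xf x hs hf) (rhd_xf x hs' hf).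
rewrite (@rhd_xf _ ([seq (c *: p.1, p.2) | p <- s] ++ s')) //; last first.
  rewrite (ah_linear legs_hom) hs hs' big_cat big_map scaler_sumr; congr (_ + _).
  by apply: eq_bigr => p _; rewrite pureZl.
rewrite big_cat big_map scaler_sumr; congr (_ + _); apply: eq_bigr => p _ /=.
have h := finsupp_shift (- p.2) hf.
by rewrite (linZ _ _ (right_act_linX x)) (linZ _ _ (xf_linl dp h)).
Qed.

Lemma fshift0 (f : P -> C) : fshift 0 f = f.
Proof. by apply/funext => x; rewrite /fshift subr0. Qed.
Lemma fshiftD w w' (f : P -> C) : fshift w (fshift w' f) = fshift (w + w') f.
Proof. by apply/funext => x; rewrite /fshift opprD addrA. Qed.

Lemma rhd1 a : rhd \1 a = a.
Proof.
move: a; apply: Fplus_c_ext => [||x f hf]; [exact: (tr_linear rhd_spec)|by []|].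
rewrite (@rhd_xf _ [:: (\1, 0)]) //; last by rewrite (ah_one legs_hom) big_seq1 /= gU0.
by rewrite big_seq1 /= right_act1 oppr0 fshift0.
Qed.

Lemma rhdM X Y a : rhd (X ** Y) a = rhd X (rhd Y a).
Proof.
have lr := tr_linear rhd_spec.
move: a; apply: Fplus_c_ext => [||x f hf]; [exact: lr|exact: (lin_comp (lr X) (lr Y))|].
have [s hs] := tens_grp (tmap pk pa (Dp X)).
have [s' hs'] := tens_grp (tmap pk pa (Dp Y)).
rewrite (rhd_xf x hs' hf) (lin_sum _ _ _ (lr X)).
rewrite (@rhd_xf _ [seq (p.1 ** p'.1, p.2 + p'.2) | p' <- s', p <- s]) //; last first.
  rewrite (ah_mul legs_hom) hs hs' amul_sumr big_allpairs_dep /=.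
  apply: eq_bigr => p' _; rewrite amul_suml; apply: eq_bigr => p _.
  by rewrite pureM gUM.
rewrite big_allpairs_dep /=; apply: eq_bigr => p' _.
rewrite (rhd_xf _ hs (finsupp_shift _ hf)); apply: eq_bigr => p _.
by rewrite right_actM fshiftD opprD.
Qed.

Lemma rhd_gen X (Y : U) w a f : finsupp_fun f ->
  tmap pk pa (Dp X) = pure Y (gU w) ->
  rhd X (xf dp a f) = xf dp (right_act Y a) (fshift (- w) f).
Proof. by move=> hf h; rewrite (@rhd_xf _ [:: (Y, w)]) ?big_seq1. Qed.

Let lk := ah_linear (pk_hom pk_spec).
Let la := ah_linear (pa_hom pa_spec).

Lemma rhd_K w a f : finsupp_fun f ->
  rhd (cK qd w) (xf dp a f) = xf dp (right_act (uK q w) a) (fshift (- w) f).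
Proof.
move=> hf; apply: rhd_gen => //.
by rewrite (cop_K Dp_spec) tmap_pure // (pk_K pk_spec) (pa_K pa_spec).
Qed.
Lemma rhd_L w a f : finsupp_fun f ->
  rhd (cL qd w) (xf dp a f) = xf dp (right_act (uK q w) a) (fshift w f).
Proof.
move=> hf; rewrite -[w in fshift w]opprK; apply: rhd_gen => //.
by rewrite (cop_L Dp_spec) tmap_pure // (pk_L pk_spec) (pa_L pa_spec).
Qed.
Lemma rhd_E r a f : finsupp_fun f ->
  rhd (cE qd r) (xf dp a f) = xf dp (right_act (uE q r) a) (fshift (- alpha r) f).
Proof.
move=> hf; apply: rhd_gen => //.
rewrite (cop_E Dp_spec) (linD _ _ (tmap_linear lk la)) !tmap_pure //.
by rewrite (pk_E pk_spec) (pa_K pa_spec) (pa_E pa_spec) pure0r addr0.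
Qed.
Lemma rhd_F r a f : finsupp_fun f ->
  rhd (cF qd r) (xf dp a f) = xf dp (right_act (uF q r) a) f.
Proof.
move=> hf; rewrite -[f in RHS]fshift0 -oppr0; apply: rhd_gen => //.
rewrite (cop_F Dp_spec) (linD _ _ (tmap_linear lk la)) !tmap_pure //.
rewrite (pk_F pk_spec) (pa_F pa_spec) pure0r addr0 gU0.
by rewrite (ah_one (pa_hom pa_spec)).
Qed.
End Translation.

(** * Covariance *)

Section UzeroTheory.
Variables (R : realType) (q : R) (L : lie_datum R).
Notation C := R[i].
Notation I := (ld_I L).
Notation P := (wlat (ld_I L)).
Notation Uz := (Uzero q L).
Notation qz := (qd_zero q L).

(** Relations inside the copy of U_q(b^-) are available through [copies], which transports every
    star-free relation between the K's and F's of U_q(k). *)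
Lemma zL0 : cL qz 0 = \1.
Proof.
rewrite -pres_one; apply: pres_ext => B g r; rewrite plift_gen // plift_pres //.
have [_ h] := uz_copies r.
by apply: (h (SGen C (inl 0)) SOne) => //=; rewrite uK0.
Qed.
Lemma zLM w x : cL qz w ** cL qz x = cL qz (w + x).
Proof.
apply: pres_ext => B g r; have [[_ _ pM] _] := plift_hom r.
rewrite pM !plift_gen //; have [_ h] := uz_copies r.
apply: (h (SMul (SGen C (inl w)) (SGen C (inl x))) (SGen C (inl (w + x)))) => //=.
by rewrite uKM.
Qed.
Lemma star_zK w : star (cK qz w) = cL qz w.
Proof.
apply: pres_ext => B g r; have [_ ps] := plift_hom r.
rewrite ps !plift_gen //; have [h _] := uz_star r; exact: h.
Qed.
Lemma star_zE r : star (cE qz r) = cF qz r ** cL qz (alpha r).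
Proof.
apply: pres_ext => B g rl; have [[_ _ pM] ps] := plift_hom rl.
rewrite ps pM !plift_gen //; have [_ h] := uz_star rl; exact: h.
Qed.
Lemma star_zF r : star (cF qz r) = cK qz (- alpha r) ** cE qz r.
Proof.
have -> : cF qz r = star (cE qz r) ** cL qz (- alpha r).
  by rewrite star_zE -amulA zLM subrr zL0 amul1r.
by rewrite starM -star_zK !starK.
Qed.

Lemma uzero_ind (Q : Uz -> Prop) :
  Q \1 -> (forall c x y, Q x -> Q y -> Q (c *: x + y)) ->
  (forall x y, Q x -> Q y -> Q (x ** y)) ->
  (forall w, Q (cK qz w)) -> (forall w, Q (cL qz w)) ->
  (forall r, Q (cE qz r)) -> (forall r, Q (cF qz r)) -> forall x, Q x.
Proof.
move=> Q1 QL QM QK QLw QE QF; apply: presented_ind => //.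
- by rewrite -(addNr \1) -scaleN1r; apply: QL.
- by case=> [w|w|r|r]; [apply: QK | apply: QLw | apply: QE | apply: QF].
case=> [w|w|r|r].
- by rewrite -[pgen _ _]/(cK qz w) star_zK.
- by rewrite -[pgen _ _]/(cL qz w) -star_zK starK.
- by rewrite -[pgen _ _]/(cE qz r) star_zE; apply: QM.
- by rewrite -[pgen _ _]/(cF qz r) star_zF; apply: QM.
Qed.
End UzeroTheory.

Section Covariance.
Variables (R : realType) (q : R) (q_gt0 : 0 < q) (q_lt1 : q < 1).
Variables (L : lie_datum R) (w0 : seq (ld_I L)) (w0_longest : longest_word w0).
Variables (Hf : uqk_hopf q L) (V : forall w : domw L, irrep q w) (A : polK Hf V).
Variables (Dp : Uplus q L -> tens (Uplus q L) (Uplus q L)).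
Variables (Dp_spec : is_coproduct (qd_plus q L) (qd_plus q L) (qd_plus q L) Dp).
Variables (pi_k : Uplus q L -> Uqk q L) (pi_k_spec : is_pi_k pi_k).
Variables (pi_a : Uplus q L -> grpP L) (pi_a_spec : is_pi_a pi_a).
Variables (rhd : Uplus q L -> Fplus_c A -> Fplus_c A).
Variables (rhd_spec : is_translation Dp pi_k pi_a rhd).
Variables (alf : Uzero q L -> tens (Uzero q L) (Uplus q L)).
Variables (alf_spec : is_coproduct (qd_zero q L) (qd_zero q L) (qd_plus q L) alf).
Variables (gamma : Fzero_c A -> multiplier (@emb R q L Hf V A)).
Variables (gamma_spec : is_gamma gamma).
Variables (pi : Uzero q L -> Fext A w0) (pi_spec : is_pi pi).
Variables (M : lmodType R[i]) (act : Fext A w0 -> M -> M) (act_module : is_module act).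
Variables (act_nondeg : nondegenerate_act act).
Variables (V0 : tens (Fzero_c A) M -> tens (Fplus_c A) M) (V0_spec : is_V0 act gamma V0).
Notation C := R[i].
Notation P := (wlat (ld_I L)).
Notation dp := (@deg_plus R q L Hf V A).
Notation dz := (@deg_zero R q L Hf V A).
Notation TA := (tens_act act pi rhd).
Notation i_ := (ext_of w0).

Let pil := ah_linear (sh_hom (pi_hom pi_spec)).
Let V0l : is_linear V0 := V0_spec.1.

Lemma tens_act_bilin u : bilin (fun X Y => tmap (act (pi X)) (rhd Y) u).
Proof.
split=> [Y c X X'|X c Y Y']; rewrite /tmap /tlift /fsum scaler_sumr -big_split /=;
  apply: eq_bigr => p _.
  by rewrite pil (act_linl act_module) pureLl.
by rewrite (rhd_linl Dp_spec pi_k_spec pi_a_spec rhd_spec) pureLr.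
Qed.
Lemma tens_act_linT u : is_linear (TA^~ u).
Proof. exact/tlift_linear/tens_act_bilin. Qed.
Lemma tens_act_pure X Y u : TA (pure X Y) u = tmap (act (pi X)) (rhd Y) u.
Proof. by rewrite /tens_act tlift_pure //; apply: tens_act_bilin. Qed.
Lemma tens_act_lin T : is_linear (TA T).
Proof.
apply: tlift_bilin_lin => X Y.
exact: (tmap_linear (act_linr act_module _) (tr_linear rhd_spec _)).
Qed.
Lemma tens_act1 u : TA \1 u = u.
Proof.
rewrite [\1]/(pure _ _) tens_act_pure (ah_one (sh_hom (pi_hom pi_spec))).
move: u; apply: tens_lin_ext => // [|v a].
  exact: (tmap_linear (act_linr act_module _) (tr_linear rhd_spec _)).
rewrite tmap_pure; [|exact: act_linr|exact: tr_linear rhd_spec _].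
by rewrite (rhd1 Dp_spec pi_k_spec pi_a_spec rhd_spec) (mod_one act_module).
Qed.
Lemma tens_actM T T' u : TA (T ** T') u = TA T (TA T' u).
Proof.
move: T; apply: tens_lin_ext => [||X Y].
- exact: (lin_comp (tens_act_linT u) (amul_linl T')).
- exact: tens_act_linT.
move: T'; apply: tens_lin_ext => [||X' Y'].
- exact: (lin_comp (tens_act_linT u) (amul_linr _)).
- exact: (lin_comp (tens_act_lin _) (tens_act_linT u)).
rewrite pureM !tens_act_pure.
have lt Z Z' : is_linear (tmap (act (pi Z)) (rhd Z')).
  exact: (tmap_linear (act_linr act_module _) (tr_linear rhd_spec _)).
move: u; apply: tens_lin_ext => [||v a]; [exact: lt|exact: (lin_comp (lt _ _) (lt _ _))|].
have la := act_linr act_module; have lr := tr_linear rhd_spec.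
rewrite !tmap_pure // (ah_mul (sh_hom (pi_hom pi_spec))) (actM act_module).
by rewrite (rhdM Dp_spec pi_k_spec pi_a_spec rhd_spec).
Qed.

Definition covariant (X : Uzero q L) : Prop := forall u,
  tflip (V0 (tmap id (act (pi X)) u)) = TA (alf X) (tflip (V0 u)).

Let lid : is_linear (fun a : Fzero_c A => a) := @lin_id _ _.
Lemma tmap_act_lin X : is_linear (tmap (fun a : Fzero_c A => a) (act (pi X))).
Proof. exact: (tmap_linear lid (act_linr act_module _)). Qed.

Lemma covariant1 : covariant \1.
Proof.
move=> u; rewrite (ah_one (cop_hom alf_spec)) tens_act1 (ah_one (sh_hom (pi_hom pi_spec))).
congr (tflip (V0 _)); move: u; apply: tens_lin_ext => // [|a v].
  exact: (tmap_linear lid (act_linr act_module _)).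
by rewrite tmap_pure //; [rewrite (mod_one act_module) | exact: act_linr].
Qed.

Lemma covariant_lin c X Y : covariant X -> covariant Y -> covariant (c *: X + Y).
Proof.
move=> hX hY u; rewrite (ah_linear (cop_hom alf_spec)) tens_act_linT -hX -hY.
rewrite -(tflip_linear (C := C)) -V0l; congr (tflip (V0 _)).
rewrite /tmap /tlift /fsum scaler_sumr -big_split /=; apply: eq_bigr => p _.
by rewrite pil (act_linl act_module) pureLr.
Qed.

Lemma covariant_mul X Y : covariant X -> covariant Y -> covariant (X ** Y).
Proof.
move=> hX hY u; rewrite (ah_mul (cop_hom alf_spec)) tens_actM -hY -hX.
congr (tflip (V0 _)); move: u; apply: tens_lin_ext => [||a v].
- exact: tmap_act_lin.
- exact: (lin_comp (tmap_act_lin _) (tmap_act_lin _)).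
have la := act_linr act_module.
by rewrite !tmap_pure // (ah_mul (sh_hom (pi_hom pi_spec))) (actM act_module).
Qed.

Lemma covariant_gen X :
  (forall x f chi v, finsupp_fun f -> supported act chi v ->
     tflip (V0 (pure (xf dz x f) (act (pi X) v))) = TA (alf X) (tflip (V0 (pure (xf dz x f) v)))) ->
  covariant X.
Proof.
move=> h u.
have hA (x : A) : in_span (fun _ => True) x by apply: in_span_gen.
have hM := supported_span q_gt0 act_module act_nondeg.
elim/in_span_ind: u / (tens_span (amp_c_span (deg := dz) hA) hM u)
  => [|c x y hx hy|_ [_ [v [[x [w [_ ->]]] [chi hv] ->]]]].
- rewrite (lin0 (tmap_act_lin X)) (lin0 V0l) (lin0 (tflip_linear (C := C) (V := _) (W := _))).
  by rewrite (lin0 (tens_act_lin _)).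
- by rewrite (tmap_act_lin X) !V0l !(tflip_linear (C := C)) (tens_act_lin _) hx hy.
rewrite tmap_pure //; last exact: act_linr.
exact: h (finsupp_dirac w) hv.
Qed.

(** The shape of a summand once pi(X) stands to the left of x_(2). It is bilinear in the two legs of
    the coproduct, as [lact_ract] requires. *)
Definition leg_pure (v : M) (f : P -> C) (z : Fext A w0) (a b : A) : tens M (Fplus_c A) :=
  pure (act z (act (i_ b) v)) (xf dp a f).

Lemma leg_pure_bilin v f z : finsupp_fun f -> bilin (leg_pure v f z).
Proof.
move=> hf; split=> [b c a a'|a c b b']; rewrite /leg_pure.
  by rewrite xf_linl // pureLr.
by rewrite ext_of_lin (act_linl act_module) (act_linr act_module) pureLl.
Qed.

Lemma V0_flip x f chi v : finsupp_fun f -> supported act chi v ->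
  tflip (V0 (pure (xf dz x f) v)) =
  tlift (fun a b => pure (act (i_ b) v) (xf dp a (fshift (- chi) f))) (pol_D x).
Proof.
move=> hf hv; rewrite (V0_formula q_gt0 gamma_spec act_module V0_spec x hf hv).
rewrite (lin_tlift _ _ (tflip_linear (C := C) (V := _) (W := _))).
by apply: eq_tlift => a b; rewrite tflip_pure.
Qed.

(** k_w carries M_chi to M_(chi + w), so V_0 produces f(. + chi + w) in place of f(. + chi); on the
    other side this is the translation by U_w. *)
Lemma covariant_K w : covariant (cK (qd_zero q L) w).
Proof.
apply: covariant_gen => x f chi v hf hv; rewrite (pi_K pi_spec) (cop_K alf_spec).
rewrite (V0_flip _ hf hv) tens_act_pure (pi_K pi_spec).
rewrite (V0_flip _ hf (supported_shift act_module (shifts_kk A w0 w) hv)) opprD opprK.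
have la := act_linr act_module; have lr := tr_linear rhd_spec.
rewrite (lin_tlift _ _ (tmap_linear (la _) (lr _))).
have hf' := finsupp_shift (- chi) hf.
have hf2 := finsupp_shift (- chi - w) hf.
transitivity (tlift (fun a b => leg_pure v (fshift (- chi - w) f) (kk A w0 w) a
    (lact (uK q w) b)) (pol_D x)).
  by apply: eq_tlift => a b; rewrite -(actM act_module) (ext_of_kk q_gt0) (actM act_module).
rewrite (lact_ract _ _ (leg_pure_bilin v _ hf2)); apply: eq_tlift => a b.
rewrite tmap_pure // (rhd_K Dp_spec pi_k_spec pi_a_spec rhd_spec) // fshiftD.
by rewrite (addrC (- w)).
Qed.
Lemma covariant_L w : covariant (cL (qd_zero q L) w).
Proof.
apply: covariant_gen => x f chi v hf hv; rewrite (pi_L pi_spec) (cop_L alf_spec).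
rewrite (V0_flip _ hf hv) tens_act_pure (pi_L pi_spec).
rewrite (V0_flip _ hf (supported_shift act_module (shifts_ll A w0 w) hv)) opprB.
have la := act_linr act_module; have lr := tr_linear rhd_spec.
rewrite (lin_tlift _ _ (tmap_linear (la _) (lr _))).
have hf' := finsupp_shift (- chi) hf.
have hf2 := finsupp_shift (w - chi) hf.
transitivity (tlift (fun a b => leg_pure v (fshift (w - chi) f) (ll A w0 w) a
    (lact (uK q w) b)) (pol_D x)).
  by apply: eq_tlift => a b; rewrite -(actM act_module) (ext_of_ll q_gt0) (actM act_module).
rewrite (lact_ract _ _ (leg_pure_bilin v _ hf2)); apply: eq_tlift => a b.
by rewrite tmap_pure // (rhd_L Dp_spec pi_k_spec pi_a_spec rhd_spec) // fshiftD.
Qed.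

(** e_r carries M_chi to M_(chi + alpha_r), and in both terms of the coaction on E_r the second leg
    translates functions by U_(alpha_r). *)
Lemma covariant_E r : covariant (cE (qd_zero q L) r).
Proof.
apply: covariant_gen => x f chi v hf hv; rewrite (pi_E pi_spec) (cop_E alf_spec).
rewrite (V0_flip _ hf hv) (linD _ _ (tens_act_linT _)) !tens_act_pure (pi_E pi_spec).
rewrite (ah_one (sh_hom (pi_hom pi_spec))).
rewrite (V0_flip _ hf (supported_shift act_module (shifts_ee q_gt0 A w0 r) hv)) opprD opprK.
have la := act_linr act_module; have lr := tr_linear rhd_spec.
rewrite !(lin_tlift _ _ (tmap_linear (la _) (lr _))).
have hf' := finsupp_shift (- chi) hf.
have hf2 := finsupp_shift (- chi - alpha r) hf; set f2 := fshift _ f in hf2 *.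
have b1 := leg_pure_bilin v (ee A w0 r) hf2; have b2 := leg_pure_bilin v \1 hf2.
transitivity (tlift (fun a b => leg_pure v f2 (ee A w0 r) a (lact (uK q (alpha r)) b))
    (pol_D x) + tlift (fun a b => leg_pure v f2 \1 a (lact (uE q r) b)) (pol_D x)).
  rewrite /tlift /fsum -big_split /=; apply: eq_bigr => p _; rewrite /leg_pure.
  rewrite -!(actM act_module) amul1l (ext_of_ee q_gt0 q_lt1 w0_longest).
  by rewrite (linD _ _ (act_linl act_module v)) (linD _ _ (pure_linl _)).
have f2E : f2 = fshift (- alpha r) (fshift (- chi) f) by rewrite fshiftD addrC.
rewrite !lact_ract //; congr (_ + _); apply: eq_tlift => a b; rewrite tmap_pure //.
  by rewrite (rhd_K Dp_spec pi_k_spec pi_a_spec rhd_spec) // -f2E.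
by rewrite (rhd_E Dp_spec pi_k_spec pi_a_spec rhd_spec) // -f2E.
Qed.

(** f_r preserves M_chi, because the degrees of the star of e_r and of l_(-alpha_r) are opposite;
    correspondingly the second legs 1 and F_r leave functions in place. *)
Lemma covariant_F r : covariant (cF (qd_zero q L) r).
Proof.
apply: covariant_gen => x f chi v hf hv; rewrite (pi_F pi_spec) (cop_F alf_spec).
rewrite (V0_flip _ hf hv) (linD _ _ (tens_act_linT _)) !tens_act_pure (pi_F pi_spec).
rewrite (pi_L pi_spec).
rewrite (V0_flip _ hf (supported_shift act_module (shifts_ff q_gt0 A w0 r) hv)) subr0.
have la := act_linr act_module; have lr := tr_linear rhd_spec.
rewrite !(lin_tlift _ _ (tmap_linear (la _) (lr _))).
have hf2 := finsupp_shift (- chi) hf; set f2 := fshift _ f in hf2 *.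
have b2 := leg_pure_bilin v (ll A w0 (- alpha r)) hf2.
transitivity (tlift (fun a b => leg_pure v f2 (ff A w0 r) a b) (pol_D x) +
  tlift (fun a b => leg_pure v f2 (ll A w0 (- alpha r)) a (lact (uF q r) b)) (pol_D x)).
  rewrite /tlift /fsum -big_split /=; apply: eq_bigr => p _; rewrite /leg_pure.
  rewrite -!(actM act_module) (ext_of_ff q_gt0 q_lt1 w0_longest).
  by rewrite (linD _ _ (act_linl act_module v)) (linD _ _ (pure_linl _)).
rewrite lact_ract //; congr (_ + _); apply: eq_tlift => a b; rewrite tmap_pure //.
  by rewrite (rhd1 Dp_spec pi_k_spec pi_a_spec rhd_spec).
by rewrite (rhd_F Dp_spec pi_k_spec pi_a_spec rhd_spec).
Qed.

Lemma covariant_all X : covariant X.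
Proof.
elim/uzero_ind: X.
- exact: covariant1.
- exact: covariant_lin.
- exact: covariant_mul.
- exact: covariant_K.
- exact: covariant_L.
- exact: covariant_E.
- exact: covariant_F.
Qed.
End Covariance.

Theorem theorem7p22
  (* q, the Lie data, and a reduced expression of the longest Weyl element *)
  (R : realType) (q : R) (q_gt0 : 0 < q) (q_lt1 : q < 1)
  (L : lie_datum R) (w0 : seq (ld_I L)) (w0_longest : longest_word w0)
  (* the Hopf algebra U_q(k), its irreducible representations, and Pol_q(K) *)
  (Hf : uqk_hopf q L) (V : forall w : domw L, irrep q w) (A : polK Hf V)
  (* the coproduct of U_q^+(b_R), the maps pi_k and pi_a, and pi_rhd *)
  (Dp : Uplus q L -> tens (Uplus q L) (Uplus q L))
  (Dp_spec : is_coproduct (qd_plus q L) (qd_plus q L) (qd_plus q L) Dp)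
  (pi_k : Uplus q L -> Uqk q L) (pi_k_spec : is_pi_k pi_k)
  (pi_a : Uplus q L -> grpP L) (pi_a_spec : is_pi_a pi_a)
  (pi_rhd : Uplus q L -> Fplus_c A -> Fplus_c A)
  (pi_rhd_spec : is_translation Dp pi_k pi_a pi_rhd)
  (* the coactions alpha and gamma, and the map pi *)
  (alpha : Uzero q L -> tens (Uzero q L) (Uplus q L))
  (alpha_spec : is_coproduct (qd_zero q L) (qd_zero q L) (qd_plus q L) alpha)
  (gamma : Fzero_c A -> multiplier (@emb R q L Hf V A))
  (gamma_spec : is_gamma gamma)
  (pi : Uzero q L -> Fext A w0) (pi_spec : is_pi pi)
  (* the module M and the map V_0 *)
  (M : lmodType R[i]) (act : Fext A w0 -> M -> M) (act_module : is_module act)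
  (act_nondeg : nondegenerate_act act)
  (V0 : tens (Fzero_c A) M -> tens (Fplus_c A) M)
  (V0_spec : is_V0 act gamma V0) :
  forall (X : Uzero q L) (u : tens (Fzero_c A) M),
    tflip (V0 (tmap id (act (pi X)) u))
    = tens_act act pi pi_rhd (alpha X) (tflip (V0 u)).
Proof.
exact: (covariant_all q_gt0 q_lt1 w0_longest Dp_spec pi_k_spec pi_a_spec pi_rhd_spec
  alpha_spec gamma_spec pi_spec act_module act_nondeg V0_spec).
Qed.
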